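(* There exists an absolute constant $c>0$ such that the following holds. Let $F\subset\mathbb{N}$ be a non-empty finite set, let $M$ be the largest element of $F$, and let $S\subseteq\mathbb{N}$ be multiplicatively $F$-syndetic. If $N\geq 3$ satisfies $M\leq\exp\left(c\sqrt{\log\log N}\right)$, then there exist $x,d\in\mathbb{N}$ such that $\{x,d,x+d,x+2d\}\subseteq S\cap\{1,2,\dots,N\}$.
   Context: $\mathbb{N}=\{1,2,3,\dots\}$. For a non-empty finite set $F\subset\mathbb{N}$, a set $S\subseteq\mathbb{N}$ is multiplicatively $F$-syndetic if for every $n\in\mathbb{N}$ there exists $t\in F$ with $nt\in S$. *)

(* Defs.v *)
From HB Require Import structures.
From mathcomp Require Import all_boot all_order all_algebra.
From mathcomp Require Import all_classical all_reals all_analysis.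

Set Implicit Arguments.
Unset Strict Implicit.
Unset Printing Implicit Defensive.

Local Open Scope classical_set_scope.

(* The natural numbers start at 1; nat is cut down to its positive elements. *)
Definition posnat : set nat := [set n | (0 < n)%N].

Definition mult_syndetic (F S : set nat) : Prop :=
  forall n, posnat n -> exists2 t, F t & S (n * t)%N.

(* Main.v *)
Require Import Defs.
From HB Require Import structures.
From mathcomp Require Import all_boot all_order all_algebra.
From mathcomp Require Import all_classical all_reals all_analysis.
From mathcomp Require Import ring lra zify.

Import Order.TTheory GRing.Theory Num.Theory.
Import numFieldNormedType.Exports.
Set Implicit Arguments.
Unset Strict Implicit.
Unset Printing Implicit Defensive.
Local Open Scope ring_scope.

(** For every n some t <= M has n t in S, so it suffices to find one n such that S
    contains a three-term progression of difference n t for every t <= M at once.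
    For suitable shifts v_t these progressions all come from a single one in
    A' = {a : v_t + t a in S for all t <= M}, and averaging over the shifts makes the
    density of A' at least M^(-O(M)).  By the theorem of Kelley and Meka, an interval
    of length exp(D^O(1)) is enough for a subset of density 2^(-D) to contain a
    three-term progression, so N >= exp(M^O(1)) suffices.

    The Kelley-Meka theorem is proved by density increment on Bohr sets in Z/q.  If A
    is free of progressions, a high moment of the balanced autocorrelation of A is
    large; sifting turns this into a dense set most of whose differences are popular
    differences of A; Croot-Sisask almost periodicity and a relative form of Chang's
    theorem then give a Bohr set of slightly larger rank on a translate of which A has
    density larger by a constant factor.  All the Fourier analysis is done with real
    cosines and sines. *)

(** * Autocorrelations and their moments *)

(** The t supplied by syndeticity depends on the difference n, known only once the progression is
    found; hence all t <= M are served at once, at a density exponentially small in a power of M.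
    Only a bound of Kelley-Meka quality then keeps N exponential in a power of M: one asking for
    density (log N)^(-c) would make N doubly exponential.

    The increment must multiply the density by an absolute constant, so that O(D) rounds suffice,
    while the rank grows only polynomially in D. A moment of order P comparable to D achieves this.
    A progression-free A has abnormally small convolution at the points 2b with b in A, a set of
    density only 2^(-D), but the P-th root of that density is bounded below. The deficit of the
    convolution turns into an excess of the autocorrelation because the moments of the latter, odd
    ones included, are nonnegative.

    Doubling the radius of a Bohr set of rank d can multiply its size by 4^d, a loss that would
    compound over the rounds; so sums and differences pair a Bohr set with one of much smaller
    radius, at radii where the size is nearly stationary. *)

Section Correlation.
Variables (R : realType) (G : finZmodType).
Implicit Types (f : G -> R) (A B X : {set G}).

Definition ind A (x : G) : R := (x \in A)%:R.
Definition corr f (u : G) : R := \sum_y f y * f (y + u).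
Definition conv f (u : G) : R := \sum_y f y * f (u - y).

Lemma ind_ge0 A x : 0 <= ind A x. Proof. exact: ler0n. Qed.

Lemma ind_le1 A x : ind A x <= 1. Proof. by rewrite /ind; case: (x \in A). Qed.

Lemma sum_ind A : \sum_x ind A x = #|A|%:R.
Proof.
by rewrite -sum1_card natr_sum [RHS]big_mkcond; apply: eq_bigr => x _; rewrite /ind; case: ifP.
Qed.

Lemma sum_indM A (F : G -> R) : \sum_x ind A x * F x = \sum_(x in A) F x.
Proof.
rewrite [RHS]big_mkcond; apply: eq_bigr => x _.
by rewrite /ind; case: ifP => _; rewrite ?mul1r ?mul0r.
Qed.

Lemma sum_shift (F : G -> R) (a : G) : \sum_x F (x + a) = \sum_x F x.
Proof. by rewrite [RHS](reindex_inj (addIr a)). Qed.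

Lemma exp_sum (I : finType) (F : I -> R) n :
  (\sum_i F i) ^+ n = \sum_(w : {ffun 'I_n -> I}) \prod_i F (w i).
Proof.
by rewrite -(bigA_distr_bigA (fun (_ : 'I_n) i => F i)) prodr_const card_ord.
Qed.

(** Expanding the n-th power over tuples w of base points separates z from v: the kernel
    [corr f (v - z)] is positive definite and so are its powers. Odd moments are thus nonnegative
    even for f of varying sign. *)
Lemma sum_corr_exp X f n :
  \sum_(z in X) \sum_(v in X) corr f (v - z) ^+ n =
  \sum_(w : {ffun 'I_n -> G}) (\sum_(z in X) \prod_i f (w i + z)) ^+ 2.
Proof.
transitivity (\sum_(z in X) \sum_(v in X) \sum_(w : {ffun 'I_n -> G})
    \prod_i f (w i + z) * \prod_i f (w i + v)).
  apply: eq_bigr => z _; apply: eq_bigr => v _.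
  rewrite /corr -(sum_shift _ z) exp_sum; apply: eq_bigr => w _.
  rewrite -big_split; apply: eq_bigr => i _ /=.
  by rewrite -addrA [z + _]addrC subrK.
under eq_bigr do rewrite exchange_big /=.
rewrite exchange_big /=; apply: eq_bigr => w _.
by rewrite expr2 mulr_suml; apply: eq_bigr => z _; rewrite mulr_sumr.
Qed.

Lemma sum_corr_exp_ge0 X f n :
  0 <= \sum_(z in X) \sum_(v in X) corr f (v - z) ^+ n.
Proof. by rewrite sum_corr_exp sumr_ge0 // => w _; rewrite sqr_ge0. Qed.

(** Cauchy-Schwarz: the tuple expansion of the convolution is the sum of [a w * b w], and the
    squares of [a] and of [b] both sum to the moment of the autocorrelation. *)
Lemma sum_conv_exp_le X f n :
  \sum_(z in X) \sum_(v in X) conv f (v - z) ^+ n <=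
  \sum_(z in X) \sum_(v in X) corr f (v - z) ^+ n.
Proof.
pose a (w : {ffun 'I_n -> G}) := \sum_(z in X) \prod_i f (w i - z).
pose b (w : {ffun 'I_n -> G}) := \sum_(v in X) \prod_i f (v - w i).
have -> : \sum_(z in X) \sum_(v in X) conv f (v - z) ^+ n = \sum_w a w * b w.
  transitivity (\sum_(z in X) \sum_(v in X) \sum_(w : {ffun 'I_n -> G})
      \prod_i f (w i - z) * \prod_i f (v - w i)).
    apply: eq_bigr => z _; apply: eq_bigr => v _.
    rewrite /conv -(sum_shift _ (- z)) exp_sum; apply: eq_bigr => w _.
    rewrite -big_split; apply: eq_bigr => i _ /=.
    by rewrite opprB addrA subrK.
  under eq_bigr do rewrite exchange_big /=.
  rewrite exchange_big /=; apply: eq_bigr => w _.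
  by rewrite mulr_suml; apply: eq_bigr => z _; rewrite mulr_sumr.
have Ea : \sum_w a w ^+ 2 = \sum_(z in X) \sum_(v in X) corr f (v - z) ^+ n.
  rewrite exchange_big /=.
  transitivity (\sum_(z in X) \sum_(v in X) \sum_(w : {ffun 'I_n -> G})
      \prod_i f (w i - z) * \prod_i f (w i - v)).
    under [RHS]eq_bigr do rewrite exchange_big /=.
    rewrite [RHS]exchange_big /=; apply: eq_bigr => w _.
    by rewrite expr2 mulr_suml; apply: eq_bigr => z _; rewrite mulr_sumr.
  apply: eq_bigr => z _; apply: eq_bigr => v _.
  rewrite /corr -(sum_shift _ (- z)) exp_sum; apply: eq_bigr => w _.
  rewrite -big_split; apply: eq_bigr => i _ /=.
  by rewrite addrA subrK.
have Eb : \sum_w b w ^+ 2 = \sum_(z in X) \sum_(v in X) corr f (v - z) ^+ n.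
  rewrite sum_corr_exp.
  rewrite (reindex_inj (h := fun w : {ffun 'I_n -> G} => [ffun i => - w i])).
    apply: eq_bigr => w _; congr (_ ^+ 2); apply: eq_bigr => z _.
    by apply: eq_bigr => i _; rewrite ffunE opprK addrC.
  move=> w1 w2 /ffunP E; apply/ffunP => i; move: (E i); rewrite !ffunE.
  exact: oppr_inj.
have : \sum_w a w * b w <= \sum_w (a w ^+ 2 / 2 + b w ^+ 2 / 2).
  by apply: ler_sum => w _; have := sqr_ge0 (a w - b w); nra.
rewrite big_split -!mulr_suml Ea Eb /=; lra.
Qed.

End Correlation.

(** * From moments of a balanced function to a large level set *)

Section Unbalance.
Variable R : realType.

Lemma bernoulli (x : R) n : -1 <= x -> 1 + n%:R * x <= (1 + x) ^+ n.
Proof.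
move=> x1; elim: n => [|n IH]; first by rewrite mul0r addr0 expr0.
rewrite exprS; have : (1 + x) * (1 + n%:R * x) <= (1 + x) * (1 + x) ^+ n.
  by rewrite ler_wpM2l //; lra.
have : 0 <= n%:R * x ^+ 2 :> R by rewrite mulr_ge0 ?sqr_ge0.
by rewrite -natr1 expr2; nra.
Qed.

Lemma four_exp_ge96 n : (4 <= n)%N -> 96 <= 4 ^+ n :> R.
Proof.
move=> n4; apply: (@le_trans _ _ (4 ^+ 4)); first by rewrite -natrX ler_nat.
by rewrite ler_eXn2l //; lra.
Qed.

Lemma two_exp_ge66 n : (7 <= n)%N -> 66 <= 2 ^+ n :> R.
Proof.
move=> n4; apply: (@le_trans _ _ (2 ^+ 7)); first by rewrite -natrX ler_nat.
by rewrite ler_eXn2l //; lra.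
Qed.

(* A large even moment of g together with a nonnegative odd moment forces mass
   on large positive g; raising 1 + g to a high power then concentrates it. *)
Lemma unbalance (J : finType) (Q : pred J) (g h : J -> R) (P : nat) :
  ~~ odd P -> (8 <= P)%N ->
  (forall j, Q j -> -2 <= g j) -> (forall j, Q j -> 0 <= h j) ->
  (forall j, Q j -> 1 + g j - 32^-1 <= h j) ->
  0 <= \sum_(j | Q j) g j ^+ P.-1 ->
  (4 ^+ P)^-1 * #|Q|%:R <= \sum_(j | Q j) g j ^+ P ->
  4 ^+ P * #|Q|%:R <= \sum_(j | Q j) h j ^+ (65 * P) /\
  \sum_(j | Q j && (h j < 65 / 64)) h j ^+ (65 * P)
    <= (4 ^+ P)^-1 * \sum_(j | Q j) h j ^+ (65 * P).
Proof.
move=> evP P8 g2 h0 hg odd0 evn.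
have P0 : P = P.-1.+1 by lia.
have P4 : (4 <= P)%N by exact: leq_trans P8.
have P7 : (7 <= P)%N by exact: leq_trans P8.
have oddP1 : odd P.-1 by move: evP; rewrite P0 /=; case: odd.
pose N : R := #|Q|%:R.
have sumQ (c : R) : \sum_(j | Q j) c = N * c.
  by rewrite sumr_const -mulr_natl.
(* g^P + 2 g^(P-1) = g^(P-1) (g + 2) is at most 0 for -2 <= g < 0, as P - 1 is odd: adding twice the
   odd moment removes the negative values of g. Values in [0, 1/16) contribute at most half of
   4^(-P) each, and for g >= 1/16 the sum is at most (1 + 32) g^P. *)
have step1 : (4 ^+ P)^-1 * N <= \sum_(j | Q j) (g j ^+ P + 2 * g j ^+ P.-1).
  rewrite big_split -mulr_sumr /=; lra.
have e4 : 0 < 4 ^+ P :> R by rewrite exprn_gt0.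
have e16 : 0 < 16 ^+ P :> R by rewrite exprn_gt0.
have E16 : 16 ^+ P = 4 ^+ P * 4 ^+ P :> R by rewrite -exprMn; congr (_ ^+ P); lra.
have step2 j : Q j -> g j ^+ P + 2 * g j ^+ P.-1 <=
    2^-1 * (4 ^+ P)^-1 + (if 16^-1 <= g j then 33 * g j ^+ P else 0).
  move=> Qj; have := g2 _ Qj; set x := g j => x2.
  have Ex : x ^+ P = x * x ^+ P.-1 by rewrite -exprS -P0.
  have inv0 : 0 <= 2^-1 * (4 ^+ P)^-1 :> R by rewrite mulr_ge0 // invr_ge0 ltW.
  case: ifP => hx.
    have : 0 <= x ^+ P.-1 by rewrite exprn_ge0 //; lra.
    rewrite Ex; nra.
  have {}hx : x < 16^-1 by rewrite ltNge hx.
  rewrite addr0; have [x0|x0] := leP 0 x; last first.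
    have : x ^+ P.-1 <= 0.
      have -> : x ^+ P.-1 = - (- x) ^+ P.-1.
        by rewrite exprNn -signr_odd oddP1 expr1 mulN1r opprK.
      by rewrite oppr_le0 exprn_ge0 //; lra.
    rewrite Ex; nra.
  have xP : x ^+ P.-1 <= 16 * (16 ^+ P)^-1.
    rewrite P0 [in X in _ <= X]exprS invfM mulrA mulfV ?mul1r -?P0; last by lra.
    by rewrite -exprVn; apply: lerXn2r; rewrite ?nnegrE //; lra.
  have xP0 : 0 <= x ^+ P.-1 by rewrite exprn_ge0.
  apply: (@le_trans _ _ (3 * x ^+ P.-1)); first by rewrite Ex; nra.
  apply: (@le_trans _ _ (3 * (16 * (16 ^+ P)^-1))); first by lra.
  rewrite E16 invfM.
  have iv : 96 * (4 ^+ P)^-1 <= 1 :> R.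
    by rewrite ler_pdivrMr // mul1r; exact: four_exp_ge96.
  have i0 : 0 <= (4 ^+ P)^-1 :> R by rewrite invr_ge0 ltW.
  nra.
have step3 : 2^-1 * (4 ^+ P)^-1 * N <=
    \sum_(j | Q j && (16^-1 <= g j)) 33 * g j ^+ P.
  rewrite [leRHS]big_mkcondr /=.
  have : \sum_(j | Q j) (g j ^+ P + 2 * g j ^+ P.-1) <=
     \sum_(j | Q j) (2^-1 * (4 ^+ P)^-1 + (if 16^-1 <= g j then 33 * g j ^+ P else 0)).
    by apply: ler_sum => j /step2.
  rewrite [X in _ <= X]big_split /= sumQ; lra.
have step4 : (8 ^+ P)^-1 * N <= \sum_(j | Q j && (16^-1 <= g j)) g j ^+ P.
  move: step3; rewrite -mulr_sumr; set Sg := \sum_(j | _) _.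
  have N0 : 0 <= N by rewrite ler0n.
  have -> : 8 ^+ P = 2 ^+ P * 4 ^+ P :> R by rewrite -exprMn; congr (_ ^+ P); lra.
  rewrite invfM; have i0 : 0 <= (4 ^+ P)^-1 * N by rewrite mulr_ge0 // invr_ge0 ltW.
  have : (2 ^+ P)^-1 * 66 <= 1 :> R.
    by rewrite ler_pdivrMl ?exprn_gt0 // mulr1; exact: two_exp_ge66.
  nra.
have [q Eq] : exists q, q = (65 * P)%N by exists (65 * P)%N.
rewrite -Eq.
(* For g >= 1/16 the hypothesis gives h >= 1 + g/2 = (65/64) (1 + (32 g - 1)/65), and Bernoulli with
   exponent 65 turns the second factor into 32 g. This is the origin of the exponent 65 P: 32^P
   against the 8^(-P) of [step4] leaves 4^P. *)
have step5 j : Q j -> 16^-1 <= g j ->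
    (65 / 64) ^+ q * (32 ^+ P * g j ^+ P) <= h j ^+ q.
  move=> Qj gj; have := hg _ Qj => hj.
  have h1 : (65 / 64) * (1 + (32 * g j - 1) / 65) <= h j by lra.
  apply: (@le_trans _ _ (((65 / 64) * (1 + (32 * g j - 1) / 65)) ^+ q)); last first.
    by apply: lerXn2r; rewrite ?nnegrE //; lra.
  rewrite [leRHS]exprMn ler_wpM2l ?exprn_ge0 //.
  have g0 : 0 <= 32 * g j by lra.
  have g1 : -1 <= (32 * g j - 1) / 65 by lra.
  have Eg : 1 + 65%:R * ((32 * g j - 1) / 65) = 32 * g j by lra.
  have := bernoulli 65 g1; rewrite Eg Eq exprM -exprMn => g2'.
  by apply: lerXn2r; rewrite ?nnegrE //; exact: le_trans g2'.
have step6 : (65 / 64) ^+ q * (4 ^+ P * N) <= \sum_(j | Q j) h j ^+ q.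
  apply: (@le_trans _ _ (\sum_(j | Q j && (16^-1 <= g j)) h j ^+ q)).
    apply: (@le_trans _ _ (\sum_(j | Q j && (16^-1 <= g j))
       (65 / 64) ^+ q * (32 ^+ P * g j ^+ P))); last first.
      by apply: ler_sum => j /andP[]; apply: step5.
    rewrite -!mulr_sumr ler_wpM2l ?exprn_ge0 //.
    apply: (@le_trans _ _ (32 ^+ P * ((8 ^+ P)^-1 * N))); last first.
      by rewrite ler_wpM2l // exprn_ge0.
    rewrite mulrA -exprVn -exprMn ler_wpM2r ?ler0n //.
    by apply: lerXn2r; rewrite ?nnegrE //; lra.
  by rewrite [leRHS](bigID (fun j => 16^-1 <= g j)) /= lerDl sumr_ge0 // => j /andP[/h0 hj _]; rewrite exprn_ge0.
have q1 : 1 <= (65 / 64) ^+ q :> R by rewrite exprn_ege1 //; lra.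
have N0 : 0 <= N by rewrite ler0n.
split; first by apply: le_trans step6; rewrite ler_peMl // mulr_ge0 // ltW.
rewrite ler_pdivlMl //; apply: le_trans step6; rewrite [leRHS]mulrCA.
rewrite (ler_pM2l e4) [leRHS]mulrC -sumQ.
apply: (@le_trans _ _ (\sum_(j | Q j && (h j < 65 / 64)) (65 / 64) ^+ q)).
  apply: ler_sum => j /andP[/h0 hj hj'].
  by apply: lerXn2r; rewrite ?nnegrE //; lra.
rewrite [leRHS](bigID (fun j => h j < 65 / 64)) /= lerDl sumr_ge0 // => j _.
Qed.

End Unbalance.

(** * Sifting by dependent random choice *)

Section Sifting.
Variables (R : realType) (G : finZmodType).
Implicit Types (A B X : {set G}).

Lemma exists_le (I : finType) (P : pred I) (a b : I -> R) :
  (exists i, P i) -> \sum_(i | P i) a i <= \sum_(i | P i) b i ->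
  exists2 i, P i & a i <= b i.
Proof.
move=> [i0 Pi0] leab; apply/exists_inP; apply: contraLR leab.
rewrite negb_exists_in -ltNge => /forall_inP H.
apply: ltr_sum; first by apply/hasP; exists i0; rewrite ?mem_index_enum.
by move=> i Pi; rewrite ltNge H.
Qed.

Lemma card_shift A (a : G) : \sum_x ind R A (x + a) = #|A|%:R.
Proof. by rewrite sum_shift sum_ind. Qed.

Lemma natr_card_sum (I : finType) (P : pred I) : #|P|%:R = \sum_(i | P i) 1 :> R.
Proof. by rewrite -sum1_card natr_sum. Qed.

(** The tuple expansion once more: up to normalization, [corr (ind R A) (v - z) ^+ q] is the
    probability that z and v both survive in the random set of those z in X with every w_i + z in
    A. *)
Lemma sum_corr_set A X (phi : G -> G -> R) q :
  \sum_(z in X) \sum_(v in X) phi z v * corr (ind R A) (v - z) ^+ q =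
  \sum_(w : {ffun 'I_q -> G})
    \sum_(z in [set z in X | [forall i, w i + z \in A]])
    \sum_(v in [set z in X | [forall i, w i + z \in A]]) phi z v.
Proof.
have pind (w : {ffun 'I_q -> G}) z :
    \prod_i ind R A (w i + z) = [forall i, w i + z \in A]%:R.
  have [/forallP H|] := boolP [forall i, w i + z \in A].
    by rewrite big1 // => i _; rewrite /ind H.
  rewrite negb_forall => /existsP[i Hi].
  by rewrite (bigD1 i) //= /ind (negbTE Hi) mul0r.
transitivity (\sum_(z in X) \sum_(v in X) \sum_(w : {ffun 'I_q -> G})
    phi z v * ([forall i, w i + z \in A]%:R * [forall i, w i + v \in A]%:R)).
  apply: eq_bigr => z _; apply: eq_bigr => v _.
  rewrite -mulr_sumr; congr (_ * _).
  rewrite /corr -(sum_shift _ z) exp_sum; apply: eq_bigr => w _.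
  rewrite -!pind -big_split; apply: eq_bigr => i _ /=.
  by rewrite -addrA [z + _]addrC subrK.
under eq_bigr do rewrite exchange_big /=.
rewrite exchange_big /=; apply: eq_bigr => w _.
rewrite [RHS](eq_bigl (fun z => (z \in X) && [forall i, w i + z \in A])); last first.
  by move=> z; rewrite !inE.
rewrite [RHS]big_mkcondr; apply: eq_bigr => z _.
case: ifP => _; last by apply: big1 => v _; rewrite mul0r mulr0.
rewrite [RHS](eq_bigl (fun z => (z \in X) && [forall i, w i + z \in A])); last first.
  by move=> v; rewrite !inE.
rewrite [RHS]big_mkcondr; apply: eq_bigr => v _.
by case: ifP => _; rewrite !(mul1r, mulr1, mulr0).
Qed.

Definition bad_pairs (S : pred G) A B : R :=
  \sum_(z in A) \sum_(v in B) (~~ S (v - z))%:R.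

(** Only tuples w in W0^q leave a nonempty random subset of X. On average over these, the bad pairs
    divided by 2 kap account for at most half of the squared size, and (lam |X|)^2 for at most the
    other half. Comparing the sum of both with the squared size yields one w that has both
    properties. *)
Lemma sift A X (W0 : {set G}) (S : pred G) q (lam kap : R) :
  (forall z a, z \in X -> a \in A -> a - z \in W0) ->
  (0 < #|W0|)%N -> 0 < lam -> 0 < kap ->
  \sum_(z in X) \sum_(v in X) (~~ S (v - z))%:R * corr (ind R A) (v - z) ^+ q <=
    kap * \sum_(z in X) \sum_(v in X) corr (ind R A) (v - z) ^+ q ->
  2 * (lam * #|X|%:R) ^+ 2 * #|W0|%:R ^+ q <=
    \sum_(z in X) \sum_(v in X) corr (ind R A) (v - z) ^+ q ->
  exists A' : {set G}, [/\ A' \subset X, lam * #|X|%:R <= #|A'|%:R &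
    bad_pairs S A' A' <= 2 * kap * (#|A'|%:R * #|A'|%:R)].
Proof.
move=> subW W0gt lam0 kap0 le1 le2.
pose Aw (w : {ffun 'I_q -> G}) := [set z in X | [forall i, w i + z \in A]].
have tot : \sum_(z in X) \sum_(v in X) corr (ind R A) (v - z) ^+ q =
    \sum_w #|Aw w|%:R * #|Aw w|%:R.
  transitivity (\sum_(z in X) \sum_(v in X) 1 * corr (ind R A) (v - z) ^+ q).
    by apply: eq_bigr => z _; apply: eq_bigr => v _; rewrite mul1r.
  rewrite (sum_corr_set A X (fun _ _ => 1)); apply: eq_bigr => w _.
  by rewrite -/(Aw w) -natr_card_sum sumr_const mulr_natr.
have tbad : \sum_(z in X) \sum_(v in X)
    (~~ S (v - z))%:R * corr (ind R A) (v - z) ^+ q =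
    \sum_w bad_pairs S (Aw w) (Aw w).
  by rewrite (sum_corr_set A X (fun z v => (~~ S (v - z))%:R)).
pose W := ffun_on (mem W0) : {pred {ffun 'I_q -> G}}.
have out w : w \notin W -> Aw w = finset.set0.
  move=> wW; apply/setP => z; rewrite !inE; apply/negP => /andP[zX /forallP H].
  move/negP: wW; apply; apply/ffun_onP => i.
  by have := subW z _ zX (H i); rewrite addrK.
have restr (F : {set G} -> R) : F finset.set0 = 0 ->
    \sum_w F (Aw w) = \sum_(w | w \in W) F (Aw w).
  move=> F0; rewrite (bigID (mem W)) /= [X in _ + X]big1 ?addr0 // => w.
  by move=> /out ->.
rewrite tbad tot in le1; rewrite tot in le2.
rewrite (restr (fun A => #|A|%:R * #|A|%:R)) ?cards0 ?mul0r // in le1 le2.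
have bp0 : bad_pairs S finset.set0 finset.set0 = 0 by rewrite /bad_pairs big_set0.
rewrite (restr (fun A => bad_pairs S A A) bp0) in le1.
have cW : \sum_(w | w \in W) 1 = #|W0|%:R ^+ q :> R.
  by rewrite -natr_card_sum card_ffun_on card_ord natrX.
have [] := @exists_le _ (mem W)
  (fun w => bad_pairs S (Aw w) (Aw w) / (2 * kap) + (lam * #|X|%:R) ^+ 2 * 1)
  (fun w => #|Aw w|%:R * #|Aw w|%:R).
- have [x0 x0W] : exists x0, x0 \in W0 by apply/card_gt0P.
  by exists [ffun=> x0]; apply/ffun_onP => i; rewrite ffunE.
- rewrite big_split /= -mulr_suml -mulr_sumr cW.
  set U := \sum_(w | w \in W) bad_pairs _ _ _.
  set V := \sum_(w | w \in W) _ * _ in le1 le2 *.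
  have : U / (2 * kap) <= V / 2.
    rewrite ler_pdivrMr ?mulr_gt0 //; apply: le_trans le1 _; lra.
  lra.
move=> w wW Hw; exists (Aw w).
have b0 : 0 <= bad_pairs S (Aw w) (Aw w).
  by rewrite sumr_ge0 // => z _; rewrite sumr_ge0.
have b1 : 0 <= bad_pairs S (Aw w) (Aw w) / (2 * kap).
  by rewrite divr_ge0 // mulr_ge0 // ltW.
split; first by apply/fintype.subsetP => z; rewrite inE => /andP[].
  have l0 : 0 <= lam * #|X|%:R by rewrite mulr_ge0 // ltW.
  rewrite -ler_sqr ?nnegrE // [leRHS]expr2; lra.
rewrite mulrC -ler_pdivrMr ?mulr_gt0 //.
have := sqr_ge0 (lam * #|X|%:R); lra.
Qed.

(** Averaging over the translates of A that meet the small set X' replaces one of the two copies of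
    A. Differences then stay in a slight enlargement of X, and not in X - X, which may be larger by
    a factor exponential in the rank. *)
Lemma localize A X (X' Xp : {set G}) (S : pred G) (lam kap : R) :
  A \subset X -> 0 < lam -> 0 < kap -> (0 < #|X|)%N -> (0 < #|X'|)%N ->
  (forall a z, a \in X -> z \in X' -> a - z \in Xp) -> (#|Xp| <= 2 * #|X|)%N ->
  lam * #|X|%:R <= #|A|%:R ->
  bad_pairs S A A <= kap * (#|A|%:R * #|A|%:R) ->
  exists x (A1 : {set G}), [/\ A1 \subset X', lam / 4 * #|X'|%:R <= #|A1|%:R &
    bad_pairs (fun u => S (u - x)) A1 A <= 2 * kap * (#|A1|%:R * #|A|%:R)].
Proof.
move=> AX lam0 kap0 X0 X'0 subXp cXp dA badA.
have A0 : 0 < #|A|%:R :> R by apply: lt_le_trans dA; rewrite mulr_gt0 // ltr0n.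
pose A1 x := [set z in X' | z + x \in A].
have E1 : \sum_(x in Xp) #|A1 x|%:R = #|A|%:R * #|X'|%:R :> R.
  transitivity (\sum_x \sum_(z in X') ind R A (x + z)).
    rewrite [LHS]big_mkcond; apply: eq_bigr => x _.
    have -> : \sum_(z in X') ind R A (x + z) = #|A1 x|%:R.
      rewrite -sum1_card natr_sum (eq_bigl (fun z => (z \in X') && (z + x \in A))).
        rewrite [RHS]big_mkcondr; apply: eq_bigr => z _.
        by rewrite /ind addrC; case: ifP.
      by move=> z; rewrite !inE.
    case: ifP => // xXp; rewrite -[in LHS](mulr0n 1); congr (_%:R).
    apply/esym/eqP; rewrite cards_eq0; apply/eqP/setP => z; rewrite !inE.
    apply/negP => /andP[zX' zA]; move/negP: xXp; apply.
    by have := subXp _ _ (fintype.subsetP AX _ zA) zX'; rewrite addrC addKr.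
  by rewrite exchange_big /= (eq_bigr _ (fun z _ => card_shift A z)) sumr_const mulr_natr.
have E2 : \sum_(x in Xp) bad_pairs (fun u => S (u - x)) (A1 x) A <=
    bad_pairs S A A * #|X'|%:R.
  apply: (@le_trans _ _ (\sum_x bad_pairs (fun u => S (u - x)) (A1 x) A)).
    rewrite [leRHS](bigID (mem Xp)) /= lerDl sumr_ge0 // => x _.
    by rewrite sumr_ge0 // => z _; rewrite sumr_ge0.
  pose b (y : G) : R := \sum_(v in A) (~~ S (v - y))%:R.
  have -> : \sum_x bad_pairs (fun u => S (u - x)) (A1 x) A =
      \sum_x \sum_(z in X') ind R A (x + z) * b (x + z).
    apply: eq_bigr => x _; rewrite /bad_pairs.
    rewrite (eq_bigl (fun z => (z \in X') && (z + x \in A))); last by move=> z; rewrite !inE.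
    rewrite big_mkcondr; apply: eq_bigr => z _; rewrite /ind addrC.
    case: ifP => _; rewrite ?mul0r // mul1r.
    by apply: eq_bigr => v _; rewrite opprD [- x - z]addrC addrA.
  rewrite exchange_big /=.
  rewrite (eq_bigr (fun _ => bad_pairs S A A)) ?sumr_const ?mulr_natr //.
  by move=> z _; rewrite (sum_shift (fun y => ind R A y * b y)) sum_indM.
have [] := @exists_le _ (mem Xp)
  (fun x => bad_pairs (fun u => S (u - x)) (A1 x) A / (2 * kap * #|A|%:R) +
     lam / 4 * #|X'|%:R)
  (fun x => #|A1 x|%:R).
- have /card_gt0P[a aX] := X0; have /card_gt0P[z zX'] := X'0.
  by exists (a - z); apply: subXp.
- rewrite big_split /= -mulr_suml sumr_const E1 -[X in _ + X <= _]mulr_natr.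
  set U := \sum_(x in Xp) bad_pairs _ _ _ in E2 *.
  have : U / (2 * kap * #|A|%:R) <= #|A|%:R * #|X'|%:R / 2.
    rewrite ler_pdivrMr ?mulr_gt0 //; apply: le_trans E2 _.
    have := ler_wpM2r (ler0n R #|X'|) badA; lra.
  have : lam / 4 * #|X'|%:R * #|Xp|%:R <= lam / 4 * #|X'|%:R * (2 * #|X|%:R).
    rewrite ler_wpM2l //; last by rewrite -natrM ler_nat.
    by rewrite mulr_ge0 // divr_ge0 // ltW.
  have := ler_wpM2r (ler0n R #|X'|) dA; lra.
move=> x xXp Hx; exists x, (A1 x).
have b0 : 0 <= bad_pairs (fun u => S (u - x)) (A1 x) A.
  by rewrite sumr_ge0 // => z _; rewrite sumr_ge0.
have pos : 0 < 2 * kap * #|A|%:R by rewrite !mulr_gt0.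
have b1 : 0 <= bad_pairs (fun u => S (u - x)) (A1 x) A / (2 * kap * #|A|%:R).
  by rewrite divr_ge0 // ltW.
have l1 : 0 <= lam / 4 * #|X'|%:R by rewrite mulr_ge0 // divr_ge0 // ltW.
split; first by apply/fintype.subsetP => z; rewrite inE => /andP[].
  lra.
rewrite -mulrA [#|A1 x|%:R * _]mulrC !mulrA mulrC -ler_pdivrMr //; lra.
Qed.

End Sifting.

(** * The balanced function of a set relative to its host *)

Section BalancedFunction.
Variables (R : realType) (G : finZmodType).
Implicit Types (A B X : {set G}).

Definition cross A B (u : G) : R := \sum_y ind R A y * ind R B (y + u).

Lemma crossC A B u : cross B A u = cross A B (- u).
Proof.
rewrite /cross -(sum_shift _ (- u)); apply: eq_bigr => y _.
by rewrite subrK mulrC.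
Qed.

Lemma cross_le A B u : cross A B u <= #|A|%:R.
Proof.
rewrite -sum_ind; apply: ler_sum => y _.
by rewrite ler_piMr ?ind_ge0 ?ind_le1.
Qed.

Variables (A0 B0 : {set G}) (al : R).
Hypothesis symB : forall x, (- x \in B0) = (x \in B0).

Let f x := ind R A0 x - al * ind R B0 x.

Lemma corr_balanced u : corr f u =
  corr (ind R A0) u - al * (cross A0 B0 u + cross A0 B0 (- u)) + al ^+ 2 * cross B0 B0 u.
Proof.
rewrite -crossC /corr /cross mulrDr !mulr_sumr -big_split -sumrB -big_split /=.
by apply: eq_bigr => y _; rewrite /f; ring.
Qed.

Lemma conv_balanced u : conv f u =
  conv (ind R A0) u - 2 * al * cross A0 B0 (- u) + al ^+ 2 * cross B0 B0 (- u).
Proof.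
have indB y : ind R B0 (u - y) = ind R B0 (y - u) by rewrite /ind -symB opprB.
have sw : \sum_y ind R B0 y * ind R A0 (u - y) = cross A0 B0 (- u).
  rewrite /cross (reindex_inj (h := fun y => u - y)).
    by apply: eq_bigr => y _; rewrite subKr indB mulrC.
  by move=> x y /addrI /oppr_inj.
rewrite mulrDl mul1r mulrDl -{1}sw /conv /cross !mulr_sumr -big_split -sumrB -big_split /=.
by apply: eq_bigr => y _; rewrite /f !indB; ring.
Qed.

End BalancedFunction.

(** * Few progressions force a dense set of popular differences *)

Section Stage.
Variables (R : realType) (G : finZmodType).

(** [c0] is the autocorrelation expected of a random set of density [al]. Since differences of X
    nearly preserve B0, also as seen from A0, the cross terms of the balanced function are nearly
    constant. So where the convolution of A0 is at most c0/4 the balanced convolution is at most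
    -c0/2, and a proportion 2^(-P) of such pairs makes its P-th moment at least 4^(-P), in units of
    c0. The rest is [sum_conv_exp_le], [unbalance] and [sift]. *)
Lemma moment_sift (A0 B0 X W0 : {set G}) (P : nat) :
  let al : R := #|A0|%:R / #|B0|%:R in
  let c0 := al * #|A0|%:R in
  A0 \subset B0 -> (0 < #|A0|)%N -> (0 < #|X|)%N ->
  (forall x, (- x \in B0) = (x \in B0)) ->
  ~~ odd P -> (8 <= P)%N ->
  (forall z v, z \in X -> v \in X ->
     (63 / 64) * #|A0|%:R <= cross R A0 B0 (v - z) /\
     (63 / 64) * #|B0|%:R <= cross R B0 B0 (v - z)) ->
  (forall z a, z \in X -> a \in A0 -> a - z \in W0) -> (#|W0| <= 2 * #|B0|)%N ->
  (2 ^+ P)^-1 * #|X|%:R ^+ 2 <=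
    \sum_(z in X) \sum_(v in X) (conv (ind R A0) (v - z) <= c0 / 4)%R%:R :> R ->
  exists A' : {set G}, [/\ A' \subset X, (al / 2) ^+ (65 * P) * #|X|%:R <= #|A'|%:R &
    bad_pairs R (fun u => 65 / 64 * c0 <= corr (ind R A0) u) A' A' <=
      2 * (4 ^+ P)^-1 * (#|A'|%:R * #|A'|%:R)].
Proof.
move=> al c0 AB A0gt X0 symB evP P8 Hc subW cW Hmid.
have Agt : 0 < #|A0|%:R :> R by rewrite ltr0n.
have B0gt : (0 < #|B0|)%N by apply: leq_trans A0gt (subset_leq_card AB).
have Bgt : 0 < #|B0|%:R :> R by rewrite ltr0n.
have al0 : 0 < al by rewrite divr_gt0.
have c00 : 0 < c0 by rewrite mulr_gt0.
have alB : al * #|B0|%:R = #|A0|%:R by rewrite /al divfK // gt_eqF.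
have c0E : al ^+ 2 * #|B0|%:R = c0 by rewrite expr2 -mulrA alB.
pose f x := ind R A0 x - al * ind R B0 x.
pose Q (p : G * G) := (p.1 \in X) && (p.2 \in X).
pose g (p : G * G) := corr f (p.2 - p.1) / c0.
pose h (p : G * G) := corr (ind R A0) (p.2 - p.1) / c0.
have Qsum (F : G -> R) : \sum_(z in X) \sum_(v in X) F (v - z) =
    \sum_(p | Q p) F (p.2 - p.1) by rewrite pair_big.
have cQ : #|Q|%:R = #|X|%:R ^+ 2 :> R.
  rewrite (natr_card_sum R Q); have /= <- := Qsum (fun _ => 1).
  rewrite !sumr_const.
  by rewrite expr2 mulr_natr.
have main p : Q p -> [/\ -2 <= g p, 0 <= h p, 1 + g p - 32^-1 <= h p &
    conv (ind R A0) (p.2 - p.1) <= c0 / 4 -> conv f (p.2 - p.1) <= - (c0 / 2)].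
  case: p => z v /andP[/= zX vX]; rewrite /g /h /=.
  have [c1 b1] := Hc _ _ zX vX; have [c2 b2] := Hc _ _ vX zX.
  rewrite -[z - v]opprB in c2 b2; set u := v - z in c1 b1 c2 b2 *.
  have h0 : 0 <= corr (ind R A0) u.
    by rewrite sumr_ge0 // => y _; rewrite mulr_ge0 ?ind_ge0.
  have ca := @corr_balanced R G A0 B0 al u.
  have cv := conv_balanced A0 al symB u; rewrite -/f in ca cv.
  have l1 := cross_le R A0 B0 u; have l2 := cross_le R A0 B0 (- u).
  have l3 := cross_le R B0 B0 u; have l4 := cross_le R B0 B0 (- u).
  have m1 := ler_wpM2l (ltW al0) l1; have m2 := ler_wpM2l (ltW al0) l2.
  have n1 := ler_wpM2l (ltW al0) c1; have n2 := ler_wpM2l (ltW al0) c2.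
  have s0 : 0 <= al ^+ 2 by rewrite sqr_ge0.
  have m3 := ler_wpM2l s0 l3; have m4 := ler_wpM2l s0 l4.
  have n3 := ler_wpM2l s0 b1; have n4 := ler_wpM2l s0 b2.
  rewrite c0E in m3 m4.
  have E3 : al ^+ 2 * (63 / 64 * #|B0|%:R) = 63 / 64 * c0 by rewrite -c0E; ring.
  have E1 : al * (63 / 64 * #|A0|%:R) = 63 / 64 * c0 by rewrite /c0; ring.
  rewrite E3 in n3 n4; rewrite E1 in n1 n2; rewrite -/c0 in m1 m2.
  split.
  - rewrite ler_pdivlMr // ca; lra.
  - by rewrite divr_ge0 // ltW.
  - rewrite -(ler_pM2r c00) mulrBl mulrDl !divfK ?gt_eqF //; lra.
  - rewrite cv; lra.
have Po : 0 <= \sum_(p | Q p) g p ^+ P.-1.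
  have /= <- := Qsum (fun u => (corr f u / c0) ^+ P.-1).
  under eq_bigr do under eq_bigr do rewrite exprMn.
  under eq_bigr do rewrite -mulr_suml.
  rewrite -mulr_suml mulr_ge0 ?sum_corr_exp_ge0 // exprn_ge0 // invr_ge0 ltW //.
have Pe : (4 ^+ P)^-1 * #|Q|%:R <= \sum_(p | Q p) g p ^+ P.
  apply: (@le_trans _ _ (\sum_(p | Q p) (conv f (p.2 - p.1) / c0) ^+ P)); last first.
    have /= <- := Qsum (fun u => (corr f u / c0) ^+ P).
    have /= <- := Qsum (fun u => (conv f u / c0) ^+ P).
    under eq_bigr do under eq_bigr do rewrite exprMn.
    under [leRHS]eq_bigr do under eq_bigr do rewrite exprMn.
    under eq_bigr do rewrite -mulr_suml.
    under [leRHS]eq_bigr do rewrite -mulr_suml.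
    rewrite -!mulr_suml ler_wpM2r ?sum_conv_exp_le // exprn_ge0 // invr_ge0 ltW //.
  apply: (@le_trans _ _ (\sum_(p | Q p) (2 ^+ P)^-1 *
      (conv (ind R A0) (p.2 - p.1) <= c0 / 4)%R%:R)).
    rewrite -mulr_sumr; have /= <- := Qsum (fun u => (conv (ind R A0) u <= c0 / 4)%R%:R).
    have -> : (4 ^+ P)^-1 = (2 ^+ P)^-1 * (2 ^+ P)^-1 :> R.
      by rewrite -invfM -exprMn -natrM.
    by rewrite -mulrA cQ ler_wpM2l // invr_ge0 exprn_ge0.
  apply: ler_sum => p Qp; have [_ _ _] := main _ Qp.
  have ev : 0 <= (conv f (p.2 - p.1) / c0) ^+ P by rewrite exprn_even_ge0.
  case: (_ <= _) => [/(_ isT) H|_]; last by rewrite mulr0.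
  rewrite mulr1 -exprVn.
  have -> : (conv f (p.2 - p.1) / c0) ^+ P = (- (conv f (p.2 - p.1) / c0)) ^+ P.
    by rewrite [RHS]exprNn -signr_odd (negbTE evP) expr0 mul1r.
  apply: lerXn2r; rewrite ?nnegrE // -?mulNr.
    by rewrite divr_ge0 ?ltW //; lra.
  by rewrite ler_pdivlMr //; lra.
have [U1 U2] := @unbalance R _ Q g h P evP P8
  (fun p Qp => let: And4 a _ _ _ := main p Qp in a)
  (fun p Qp => let: And4 _ a _ _ := main p Qp in a)
  (fun p Qp => let: And4 _ _ a _ := main p Qp in a) Po Pe.
have [q Eq] : exists q, q = (65 * P)%N by exists (65 * P)%N.
rewrite -Eq in U1 U2 *.
have q1 : (1 <= q)%N by rewrite Eq muln_gt0 /= (leq_trans _ P8).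
have Sh : \sum_(z in X) \sum_(v in X) corr (ind R A0) (v - z) ^+ q =
    c0 ^+ q * \sum_(p | Q p) h p ^+ q.
  rewrite (Qsum (fun u => corr (ind R A0) u ^+ q)) mulr_sumr; apply: eq_bigr => p _.
  by rewrite /h -exprMn [c0 * _]mulrC divfK ?gt_eqF.
have e4 : 0 < 4 ^+ P :> R by rewrite exprn_gt0.
have cq0 : 0 < c0 ^+ q by rewrite exprn_gt0.
(* With lam = (al/2)^q, |W0| <= 2 |B0| and al^2 |B0| = c0, the size condition of [sift] asks for 2
   |X|^2 (c0/2)^q, well below the moment 4^P |X|^2 c0^q at hand. *)
apply: (@sift R G A0 X W0 _ q).
- exact: subW.
- have /card_gt0P[z zX] := X0; have /card_gt0P[a aA] := A0gt.
  by apply/card_gt0P; exists (a - z); apply: subW.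
- by rewrite exprn_gt0 // divr_gt0.
- by rewrite invr_gt0.
- rewrite Sh (Qsum (fun u => (~~ (65 / 64 * c0 <= corr (ind R A0) u)%R)%:R *
      corr (ind R A0) u ^+ q)) [leRHS]mulrCA.
  apply: le_trans (ler_wpM2l (ltW cq0) U2).
  rewrite mulr_sumr [leRHS]big_mkcondr /=; apply: ler_sum => p _.
  rewrite -ltNge /h ltr_pdivrMr //; case: ifP => _; last by rewrite mul0r.
  by rewrite mul1r -exprMn [c0 * _]mulrC divfK ?gt_eqF.
rewrite Sh; apply: le_trans (ler_wpM2l (ltW cq0) U1); rewrite cQ.
have W2 : #|W0|%:R <= 2 * #|B0|%:R :> R by rewrite -natrM ler_nat.
have Wq : #|W0|%:R ^+ q <= (2 * #|B0|%:R) ^+ q :> R.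
  by apply: lerXn2r; rewrite ?nnegrE // mulr_ge0.
apply: (@le_trans _ _ (2 * ((al / 2) ^+ q * #|X|%:R) ^+ 2 * (2 * #|B0|%:R) ^+ q)).
  by rewrite ler_wpM2l // mulr_ge0 // sqr_ge0.
have -> : 2 * ((al / 2) ^+ q * #|X|%:R) ^+ 2 * (2 * #|B0|%:R) ^+ q =
    2 * #|X|%:R ^+ 2 * ((al / 2) ^+ 2 * (2 * #|B0|%:R)) ^+ q.
  rewrite [(_ * #|X|%:R) ^+ 2]exprMn [((al / 2) ^+ 2 * _) ^+ q]exprMn -!exprM [(2 * q)%N]mulnC; ring.
have -> : (al / 2) ^+ 2 * (2 * #|B0|%:R) = c0 * 2^-1 by rewrite -c0E; field.
rewrite exprMn; have X2 : 0 <= #|X|%:R ^+ 2 :> R by rewrite sqr_ge0.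
have t1 : (2^-1) ^+ q <= 2^-1 :> R by rewrite -{2}[2^-1]expr1 ler_wiXn2l //; lra.
have : 1 <= 4 ^+ P :> R by rewrite exprn_ege1 //; lra.
have cX : 0 <= c0 ^+ q * #|X|%:R ^+ 2 by rewrite mulr_ge0 // ltW.
have := ler_wpM2l cX t1; nra.
Qed.

End Stage.

(** * Almost periods *)

Section Hoeffding.
Variable R : realType.

(** From exp(-x) >= 1 - x one gets exp(x) (1 - x) <= 1, while (1 + x + 2 x^2)(1 - x) = 1 + x^2 (1 -
    2 x) >= 1. *)
Lemma expR_le_quadratic (x : R) : x <= 2^-1 -> expR x <= 1 + x + 2 * x ^+ 2.
Proof.
move=> x1; have e0 := expR_gt0 x; have en := expR_gt0 (- x).
have e1 : expR x * expR (- x) = 1 by rewrite -expRD subrr expR0.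
have := expR_ge1Dx (- x) => l1.
have l2 : expR x * (1 - x) <= 1 by have := ler_wpM2l (ltW e0) l1; rewrite e1.
have l3 : 1 <= (1 + x + 2 * x ^+ 2) * (1 - x).
  have : 0 <= x ^+ 2 * (1 - 2 * x) by rewrite mulr_ge0 ?sqr_ge0 //; lra.
  by lra.
have p : 0 < 1 - x by lra.
by rewrite -(ler_pM2r p); exact: le_trans l2 l3.
Qed.

Variable G : finType.
Implicit Types A : {set G}.

Lemma sum_ffun_on A (F : G -> R) k :
  \sum_(w : {ffun 'I_k -> G} | w \in ffun_on (mem A)) \prod_i F (w i) =
  (\sum_(v in A) F v) ^+ k.
Proof.
rewrite [X in X ^+ k]big_mkcond exp_sum big_mkcond; apply: eq_bigr => w _.
case: ifP => [/ffun_onP H|/negbT H].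
  by apply: eq_bigr => i _; rewrite (H i).
have : ~~ [forall i, w i \in A].
  by apply: contra H => /forallP H; apply/ffun_onP.
by rewrite negb_forall => /existsP[i /negbTE Hi]; rewrite (bigD1 i) //= Hi mul0r.
Qed.

(** Chernoff's method with t = eps/4, in counting form over the tuples of A^k; the exponent per
    sample is - t eps + 2 t^2 = - eps^2/8. *)
Lemma upper_tail A (Y : G -> R) (mu eps : R) k :
  (forall v, v \in A -> 0 <= Y v <= 1) -> \sum_(v in A) Y v = mu * #|A|%:R ->
  0 <= mu <= 1 -> 0 < eps <= 1 ->
  \sum_(w : {ffun 'I_k -> G} | w \in ffun_on (mem A))
     (k%:R * (mu + eps) < \sum_i Y (w i))%R%:R <=
  expR (- (k%:R * eps ^+ 2 / 8)) * #|A|%:R ^+ k.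
Proof.
move=> Y01 sumY mu01 e01; pose t := eps / 4.
have t0 : 0 < t by rewrite /t; lra.
apply: (@le_trans _ _ (\sum_(w : {ffun 'I_k -> G} | w \in ffun_on (mem A))
    \prod_i expR (t * (Y (w i) - mu - eps)))).
  apply: ler_sum => w _.
  have -> : \prod_i expR (t * (Y (w i) - mu - eps)) =
      expR (t * (\sum_i Y (w i) - k%:R * (mu + eps))).
    rewrite -expR_sum -mulr_sumr; congr (expR (t * _)).
    under eq_bigr do rewrite -addrA -opprD.
    by rewrite sumrB sumr_const card_ord mulr_natl.
  case: ltP => H; last exact: expR_ge0.
  have -> : true%:R = expR 0 :> R by rewrite expR0.
  by rewrite ler_expR mulr_ge0 //; [exact: ltW|rewrite subr_ge0 ltW].
rewrite (sum_ffun_on A (fun v => expR (t * (Y v - mu - eps)))); set S := \sum_(v in A) _.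
have S0 : 0 <= S by rewrite sumr_ge0 // => v _; exact: expR_ge0.
have key : S <= expR (- (eps ^+ 2 / 8)) * #|A|%:R.
  have -> : S = expR (- (t * eps)) * \sum_(v in A) expR (t * (Y v - mu)).
    rewrite mulr_sumr; apply: eq_bigr => v _; rewrite -expRD; congr expR; ring.
  have -> : - (eps ^+ 2 / 8) = - (t * eps) + 2 * t ^+ 2.
    by rewrite /t expr2; field.
  rewrite expRD -mulrA ler_wpM2l ?expR_ge0 //.
  apply: (@le_trans _ _ (\sum_(v in A) (1 + t * (Y v - mu) + 2 * t ^+ 2))).
    apply: ler_sum => v vA; have := Y01 _ vA => Yv.
    have sq : (t * (Y v - mu)) ^+ 2 <= t ^+ 2.
      by rewrite exprMn ler_piMr ?sqr_ge0 // expr2; nra.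
    apply: le_trans (expR_le_quadratic _) _; first by rewrite /t; nra.
    by lra.
  rewrite 2!big_split /= -mulr_sumr sumrB !sumr_const sumY.
  rewrite -[mu *+ _]mulr_natr -[_ * t ^+ 2 *+ _]mulr_natr.
  have := expR_ge1Dx (2 * t ^+ 2) => ex.
  have := ler_wpM2r (ler0n R #|A|) ex; lra.
apply: (@le_trans _ _ ((expR (- (eps ^+ 2 / 8)) * #|A|%:R) ^+ k)).
  apply: lerXn2r; rewrite ?nnegrE // mulr_ge0 //; exact: expR_ge0.
rewrite exprMn -expRM_natl le_eqVlt; apply/orP; left; apply/eqP.
by congr (expR _ * _); ring.
Qed.

Lemma two_tails A (Y : G -> R) (mu eps : R) k :
  (0 < k)%N ->
  (forall v, v \in A -> 0 <= Y v <= 1) -> \sum_(v in A) Y v = mu * #|A|%:R ->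
  0 <= mu <= 1 -> 0 < eps <= 1 ->
  \sum_(w : {ffun 'I_k -> G} | w \in ffun_on (mem A))
     (eps < `|mu - (\sum_i Y (w i)) / k%:R|)%R%:R <=
  2 * expR (- (k%:R * eps ^+ 2 / 8)) * #|A|%:R ^+ k.
Proof.
move=> k0 Y01 sumY mu01 e01.
have kR : 0 < k%:R :> R by rewrite ltr0n.
have up := @upper_tail A Y mu eps k Y01 sumY mu01 e01.
have sumY' : \sum_(v in A) (1 - Y v) = (1 - mu) * #|A|%:R.
  by rewrite sumrB sumY sumr_const mulrBl mul1r.
have lo := @upper_tail A (fun v => 1 - Y v) (1 - mu) eps k.
have {}lo := lo (fun v vA => ltac:(have := Y01 v vA; lra)) sumY'
  ltac:(lra) e01.
apply: le_trans (_ : _ <= _ + _) _; last by rewrite -mulrA mulr_natl mulr2n; apply: lerD up lo.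
rewrite -big_split /=; apply: ler_sum => w _.
have -> : \sum_i (1 - Y (w i)) = k%:R - \sum_i Y (w i).
  by rewrite sumrB sumr_const card_ord.
set Z := \sum_i Y (w i).
have EZ : Z = (Z / k%:R) * k%:R by rewrite divfK // gt_eqF.
case: (ltP eps) => H; last by rewrite addr_ge0.
have [H1|H1] := leP 0 (mu - Z / k%:R).
  rewrite ger0_norm // in H.
  have -> : k%:R * (1 - mu + eps) < k%:R - Z by rewrite {1}EZ; nra.
  by rewrite lerDr.
rewrite ltr0_norm // in H.
have -> : k%:R * (mu + eps) < Z by rewrite {1}EZ; nra.
by rewrite lerDl.
Qed.

End Hoeffding.

(** * Almost periods by random sampling *)

Section AlmostPeriods.
Variables (R : realType) (G : finZmodType).
Implicit Types (A B X T : {set G}) (S : pred G).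

Definition hits A S (x : G) : R := (\sum_(v in A) (S (v + x))%:R) / #|A|%:R.

Lemma hits_ge0 A S x : 0 <= hits A S x.
Proof. by rewrite divr_ge0 // sumr_ge0. Qed.

Lemma hits_le1 A S x : hits A S x <= 1.
Proof.
have [A0|A0] := eqVneq #|A| 0; first by rewrite /hits A0 invr0 mulr0.
rewrite ler_pdivrMr ?ltr0n ?lt0n // mul1r -sum1_card natr_sum.
by apply: ler_sum => v _; case: (S _).
Qed.

(* Croot-Sisask: many shifts of a random sample of A are again good samples, and
   two good samples differing by a shift make that shift an almost period. *)
Lemma croot_sisask (A X Xp B Om : {set G}) S (lam eps : R) k :
  (0 < k)%N -> (0 < #|X|)%N -> (0 < #|B|)%N -> (0 < #|Om|)%N -> 0 < lam -> 0 < eps <= 1 ->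
  (forall v b, v \in A -> b \in B -> v + b \in Xp) -> (#|Xp| <= 2 * #|X|)%N ->
  lam * #|X|%:R <= #|A|%:R ->
  exists (T : {set G}) (U : G -> R), [/\ T \subset B, (forall x, 0 <= U x <= 1),
    2^-1 * (lam / 2) ^+ k * #|B|%:R <= #|T|%:R &
    forall t, t \in T -> \sum_(x in Om) (eps < `|hits A S x - U (x - t)|)%R%:R <=
      4 * expR (- (k%:R * eps ^+ 2 / 8)) * #|Om|%:R].
Proof.
move=> k0 X0 B0 Om0 lam0 e01 subXp cXp dA.
have kR : 0 < k%:R :> R by rewrite ltr0n.
have XR : 0 < #|X|%:R :> R by rewrite ltr0n.
have OmR : 0 < #|Om|%:R :> R by rewrite ltr0n.
have AR : 0 < #|A|%:R :> R by apply: lt_le_trans dA; rewrite mulr_gt0.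
set th := expR _; have th0 : 0 < th by exact: expR_gt0.
pose smp (w : {ffun 'I_k -> G}) x : R := (\sum_i (S (w i + x))%:R) / k%:R.
pose bad (w : {ffun 'I_k -> G}) : R :=
  \sum_(x in Om) (eps < `|hits A S x - smp w x|)%R%:R.
pose W := ffun_on (mem A) : {pred {ffun 'I_k -> G}}.
have cW : \sum_(w | w \in W) 1 = #|A|%:R ^+ k :> R.
  by rewrite -natr_card_sum card_ffun_on card_ord natrX.
have sumbad : \sum_(w | w \in W) bad w <= 2 * th * #|A|%:R ^+ k * #|Om|%:R.
  rewrite exchange_big /=; apply: (@le_trans _ _ (\sum_(x in Om) 2 * th * #|A|%:R ^+ k)).
    apply: ler_sum => x _; apply: (@two_tails R G A (fun v => (S (v + x))%:R)) => //.
    - by move=> v _; case: (S _); rewrite /= ?lexx ?ler01.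
    - by rewrite /hits divfK // gt_eqF.
    - by rewrite hits_ge0 hits_le1.
  by rewrite sumr_const mulr_natr.
(* Markov: the mean of [bad] is at most 2 th |Om|, so at least half of all samples are good. *)
pose good (w : {ffun 'I_k -> G}) := (w \in W) && (bad w <= 4 * th * #|Om|%:R).
have cgood : 2^-1 * #|A|%:R ^+ k <= \sum_(w | good w) 1 :> R.
  have pos : 0 < 4 * th * #|Om|%:R by rewrite !mulr_gt0.
  have : \sum_(w | (w \in W) && ~~ (bad w <= 4 * th * #|Om|%:R)) (4 * th * #|Om|%:R)
      <= \sum_(w | w \in W) bad w.
    rewrite [leRHS](bigID (fun w => bad w <= 4 * th * #|Om|%:R)) /=.
    rewrite -[leLHS]add0r; apply: lerD.
      by rewrite sumr_ge0 // => w _; rewrite sumr_ge0.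
    by apply: ler_sum => w /andP[_]; rewrite -ltNge => /ltW.
  move=> /le_trans /(_ sumbad).
  have -> : \sum_(w | (w \in W) && ~~ (bad w <= 4 * th * #|Om|%:R)) (4 * th * #|Om|%:R)
     = (#|A|%:R ^+ k - \sum_(w | good w) 1) * (4 * th * #|Om|%:R).
    rewrite -cW [X in X - _](bigID (fun w => bad w <= 4 * th * #|Om|%:R)) /= addrAC subrr add0r.
    by rewrite mulr_suml; apply: eq_bigr => w _; rewrite mul1r.
  move=> H; suff : (#|A|%:R ^+ k - \sum_(w | good w) 1) <= 2^-1 * #|A|%:R ^+ k :> R by lra.
  by rewrite -(ler_pM2r pos); apply: le_trans H _; lra.
pose Wp := ffun_on (mem Xp) : {pred {ffun 'I_k -> G}}.
have cWp : \sum_(w | w \in Wp) 1 = #|Xp|%:R ^+ k :> R.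
  by rewrite -natr_card_sum card_ffun_on card_ord natrX.
pose sh (u : {ffun 'I_k -> G}) t : {ffun 'I_k -> G} := [ffun i => u i - t].
(* Each pair of t in B and a good sample w arises from exactly one u, namely w + t, and this lies in
   Xp^k. Averaging over Xp^k gives a u with many t, and the sample mean at this u serves as [U]. *)
pose Tu u := [set t in B | good (sh u t)].
have sumT : \sum_(u | u \in Wp) #|Tu u|%:R = #|B|%:R * \sum_(w | good w) 1 :> R.
  transitivity (\sum_(t in B) \sum_u (good (sh u t))%:R : R).
    rewrite exchange_big /= big_mkcond; apply: eq_bigr => u _.
    have -> : \sum_(t in B) (good (sh u t))%:R = #|Tu u|%:R :> R.
      rewrite -sum1_card natr_sum (eq_bigl (fun t => (t \in B) && good (sh u t))).
        by rewrite [RHS]big_mkcondr; apply: eq_bigr => t _; case: ifP.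
      by move=> t; rewrite !inE.
    case: ifP => // uWp; rewrite -[LHS](mulr0n 1); congr (_%:R).
    apply/esym/eqP; rewrite cards_eq0; apply/eqP/setP => t; rewrite !inE.
    apply/negP => /andP[tB /andP[/ffun_onP H _]]; move/negP: uWp; apply.
    apply/ffun_onP => i; have := subXp _ _ (H i) tB.
    by rewrite ffunE subrK.
  rewrite -sum1_card natr_sum mulr_suml; apply: eq_bigr => t tB; rewrite mul1r.
  rewrite [RHS]big_mkcond (reindex_inj (h := fun u : {ffun 'I_k -> G} => [ffun i => u i + t])).
    apply: eq_bigr => u _; have -> : sh [ffun i => u i + t] t = u.
      by apply/ffunP => i; rewrite !ffunE addrK.
    by case: ifP.
  move=> u1 u2 /ffunP E; apply/ffunP => i; move: (E i); rewrite !ffunE.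
  exact: addIr.
have [] := @exists_le R _ (mem Wp) (fun u => (2^-1 * (lam / 2) ^+ k * #|B|%:R) * 1)
  (fun u => #|Tu u|%:R).
- have /card_gt0P[b bB] := B0.
  have /card_gt0P[v vA] : (0 < #|A|)%N by rewrite -(ltr0n R).
  exists [ffun=> v + b]; apply/ffun_onP => i; rewrite ffunE; exact: subXp.
- rewrite -mulr_sumr cWp sumT.
  have Xq : #|Xp|%:R ^+ k <= (2 / lam * #|A|%:R) ^+ k :> R.
    apply: lerXn2r; rewrite ?nnegrE //; first by rewrite mulr_ge0 // divr_ge0 // ltW.
    apply: (@le_trans _ _ (2 * #|X|%:R)); first by rewrite -natrM ler_nat.
    rewrite -mulrA ler_wpM2l // mulrC ler_pdivlMr // mulrC //.
  apply: (@le_trans _ _ (2^-1 * (lam / 2) ^+ k * #|B|%:R * (2 / lam * #|A|%:R) ^+ k)).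
    by rewrite ler_wpM2l // !mulr_ge0 ?exprn_ge0 ?invr_ge0 // divr_ge0 // ltW.
  have -> : 2^-1 * (lam / 2) ^+ k * #|B|%:R * (2 / lam * #|A|%:R) ^+ k =
     #|B|%:R * (2^-1 * #|A|%:R ^+ k).
    have -> : 2^-1 * (lam / 2) ^+ k * #|B|%:R * (2 / lam * #|A|%:R) ^+ k =
     #|B|%:R * (2^-1 * ((lam / 2) ^+ k * (2 / lam * #|A|%:R) ^+ k)) by ring.
    rewrite -exprMn; congr (_ * (_ * _ ^+ k)); field; lra.
  by rewrite ler_wpM2l.
move=> u uWp Hu; exists (Tu u), (fun y => smp u y); split.
- by apply/fintype.subsetP => t; rewrite inE => /andP[].
- move=> x; rewrite divr_ge0 ?sumr_ge0 //= ler_pdivrMr // mul1r.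
  apply: (@le_trans _ _ (\sum_(i < k) 1)); last by rewrite sumr_const card_ord.
  by apply: ler_sum => i _; case: (S _).
- by rewrite mulr1 in Hu.
move=> t; rewrite inE => /andP[tB /andP[_ H]]; apply: le_trans H.
rewrite le_eqVlt; apply/orP; left; apply/eqP/eq_bigr => x _.
suff -> : smp (sh u t) x = smp u (x - t) by [].
by congr (_ / _); apply: eq_bigr => i _; rewrite ffunE addrAC addrA.
Qed.

Variables (A1 T Om : {set G}) (phi U : G -> R) (eps th : R).
Hypothesis phi01 : forall x, 0 <= phi x <= 1.
Hypothesis U01 : forall x, 0 <= U x <= 1.
Hypothesis eps0 : 0 <= eps.
Hypothesis A1gt : (0 < #|A1|)%N.
Hypothesis Tgt : (0 < #|T|)%N.
Hypothesis goodT : forall t, t \in T ->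
  \sum_(x in Om) (eps < `|phi x - U (x - t)|)%R%:R <= th.

Definition avg1 (f : G -> R) (s : G) : R := (\sum_(z in A1) f (s - z)) / #|A1|%:R.

(** The points s - z are distinct, at most th of them are exceptional, and each exceptional one
    costs at most 1. *)
Lemma avg1_approx s t : t \in T -> (forall z, z \in A1 -> s - z \in Om) ->
  `|avg1 phi s - avg1 U (s - t)| <= eps + th / #|A1|%:R.
Proof.
move=> tT sOm; have AR : 0 < #|A1|%:R :> R by rewrite ltr0n.
rewrite -mulrBl normrM (ger0_norm (x := _^-1)) ?invr_ge0 // ler_pdivrMr //.
rewrite mulrDl divfK ?gt_eqF // -sumrB.
apply: (le_trans (ler_norm_sum _ _ _)).
apply: (@le_trans _ _ (\sum_(z in A1)
   (eps + (eps < `|phi (s - z) - U (s - z - t)|)%R%:R))).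
  apply: ler_sum => z _; rewrite [s - t - z]addrAC.
  have := phi01 (s - z); have := U01 (s - z - t); set a := phi _; set b := U _ => b01 a01.
  have [|H] := leP `|a - b| eps; first by rewrite addr0.
  move/andP: a01 => [a0 a1]; move/andP: b01 => [b0 b1]; have e0 := eps0.
  by rewrite ler_norml (_ : true%:R = 1 :> R) //; apply/andP; split; lra.
rewrite big_split sumr_const /= -[eps *+ _]mulr_natr lerD2l.
apply: le_trans (goodT tT).
rewrite (reindex_inj (h := fun z => s - z)) /=; last by move=> x y /addrI /oppr_inj.
rewrite (eq_bigr (fun z => (eps < `|phi z - U (z - t)|)%R%:R)); last first.
  by move=> z _; rewrite subKr.
rewrite [leLHS]big_mkcond [leRHS]big_mkcond; apply: ler_sum => x _.
case: ifP => [/sOm|_]; first by rewrite subKr => ->.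
by case: ifP.
Qed.

Definition avT (f : G -> R) (s : G) : R :=
  (\sum_(a in T) \sum_(b in T) f (s + a - b)) / (#|T|%:R * #|T|%:R).

Lemma avT_lower (f : G -> R) s c :
  (forall a b, a \in T -> b \in T -> c <= f (s + a - b)) -> c <= avT f s.
Proof.
move=> H; have TR : 0 < #|T|%:R :> R by rewrite ltr0n.
rewrite ler_pdivlMr ?mulr_gt0 // mulrA mulrAC.
apply: (@le_trans _ _ (\sum_(a in T) \sum_(b in T) c)).
  by rewrite !sumr_const -!mulrnA !mulr_natr -mulrnA.
by apply: ler_sum => a aT; apply: ler_sum => b bT; apply: H.
Qed.

(** The averages of phi at s and at s + a - b are both compared with that of U at s - b, through the
    shift b for the former and a for the latter. One averaging step thus costs twice the error of
    [avg1_approx]. [D j] is the region reached after j steps. *)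
Lemma iter_avT_lower (D : nat -> {set G}) l :
  (forall j s a b, s \in D j -> a \in T -> b \in T -> s + a - b \in D j.+1) ->
  (forall j s z, (j <= l)%N -> s \in D j -> z \in A1 -> s - z \in Om) ->
  forall n j s, (j + n <= l)%N -> s \in D j ->
  avg1 phi s - n%:R * (2 * (eps + th / #|A1|%:R)) <= iter n avT (avg1 phi) s.
Proof.
move=> DS DOm; elim=> [|n IH] j s jn sD; first by rewrite mul0r subr0.
rewrite iterS; apply: avT_lower => a b aT bT.
have sD1 := DS _ _ _ _ sD aT bT.
have jn1 : (j.+1 + n <= l)%N by rewrite addSnnS.
have := IH _ _ jn1 sD1.
have h1 : (j <= l)%N by apply: leq_trans jn; rewrite leq_addr.
have h2 : (j.+1 <= l)%N by apply: leq_trans jn1; rewrite leq_addr.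
have B1 := avg1_approx bT (fun z => DOm _ _ z h1 sD).
have B2 := avg1_approx aT (fun z => DOm _ _ z h2 sD1).
have E : s + a - b - a = s - b by rewrite addrAC addrK.
rewrite E in B2; rewrite -natr1.
move: B1 B2; rewrite !ler_norml; lra.
Qed.

End AlmostPeriods.

(** * Fourier analysis on Z/q *)

Section Characters.
Variables (R : realType) (n : nat).
Local Notation q := n.+2.
Local Notation G := 'I_n.+2.

Lemma one_sub_cos_le (x : R) : 0 <= x -> 1 - cos x <= x.
Proof.
move=> x0; have [|c _ H] := @MVT_segment R cos (fun y => - sin y) 0 x x0.
  by apply/continuous_subspaceT => y; exact: continuous_cos.
move: H; rewrite cos0 subr0 => H.
have := sin_le1 c; nra.
Qed.

Definition angle (k : nat) : R := (pi *+ 2) * (k%:R / q%:R).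
Definition ec (a : G) : R := cos (angle a).
Definition es (a : G) : R := sin (angle a).

Lemma angle_mod k : angle k = angle (k %% q)%N + (pi *+ 2) *+ (k %/ q).
Proof.
rewrite /angle {1}(divn_eq k q) natrD natrM.
rewrite -[pi *+ 2 *+ _]mulr_natr -mulrDr; congr (_ * _).
by rewrite mulrDl mulfK ?pnatr_eq0 // addrC.
Qed.

Lemma cos_angle_mod k : cos (angle (k %% q)%N) = cos (angle k).
Proof. by rewrite [in RHS]angle_mod (periodicn (@cosD2pi R)). Qed.

Lemma sin_angle_mod k : sin (angle (k %% q)%N) = sin (angle k).
Proof. by rewrite [in RHS]angle_mod (periodicn (@sinD2pi R)). Qed.

Lemma angleD k l : angle (k + l)%N = angle k + angle l.
Proof. by rewrite /angle -mulrDr -mulrDl -natrD. Qed.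

Lemma ecD (a b : G) : ec (a + b) = ec a * ec b - es a * es b.
Proof. by rewrite /ec /es -cosD -angleD /= cos_angle_mod. Qed.

Lemma esD (a b : G) : es (a + b) = es a * ec b + ec a * es b.
Proof. by rewrite /ec /es -sinD -angleD /= sin_angle_mod. Qed.

Lemma ec0 : ec 0 = 1.
Proof. by rewrite /ec /angle mul0r mulr0 cos0. Qed.

Lemma es0 : es 0 = 0.
Proof. by rewrite /es /angle mul0r mulr0 sin0. Qed.

Lemma ec2es2 a : ec a ^+ 2 + es a ^+ 2 = 1.
Proof. exact: cos2Dsin2. Qed.

Lemma ecN a : ec (- a) = ec a.
Proof.
have := ecD a (- a); have := esD a (- a); rewrite subrr ec0 es0 => h1 h2.
have h3 := ec2es2 a; rewrite !expr2 in h3.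
have -> : ec (- a) = (ec a * ec a + es a * es a) * ec (- a) by rewrite h3 mul1r.
have -> : (ec a * ec a + es a * es a) * ec (- a) =
  ec a * (ec a * ec (- a) - es a * es (- a)) + es a * (es a * ec (- a) + ec a * es (- a)).
  by ring.
by rewrite -h1 -h2; ring.
Qed.

Lemma esN a : es (- a) = - es a.
Proof.
have := ecD a (- a); have := esD a (- a); rewrite subrr ec0 es0 ecN => h1 h2.
have h3 := ec2es2 a; rewrite !expr2 in h3.
have -> : es (- a) = (ec a * ec a + es a * es a) * es (- a) by rewrite h3 mul1r.
have -> : (ec a * ec a + es a * es a) * es (- a) =
  ec a * (es a * ec a + ec a * es (- a)) - es a * (ec a * ec a - es a * es (- a)).
  by ring.
by rewrite -h1 -h2; ring.
Qed.

Lemma ecB a b : ec (a - b) = ec a * ec b + es a * es b.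
Proof. by rewrite ecD ecN esN; ring. Qed.

Lemma esB a b : es (a - b) = es a * ec b - ec a * es b.
Proof. by rewrite esD ecN esN; ring. Qed.

Lemma ec_le1 a : ec a <= 1. Proof. exact: cos_le1. Qed.

Lemma ec_geN1 a : -1 <= ec a. Proof. exact: cos_geN1. Qed.

(** For a nonzero the half angle lies strictly between 0 and pi, so its sine is positive and the
    cosine of the double angle is not 1. *)
Lemma ec_eq1 a : ec a = 1 -> a = 0.
Proof.
move=> H; apply/eqP; apply: contraTT (oner_neq0 R); rewrite negbK => a0.
have a1 : (0 < nat_of_ord a)%N by rewrite lt0n; apply: contra a0 => /eqP E; apply/eqP/val_inj.
pose y : R := pi * (a%:R / q%:R).
have y0 : 0 < y < pi.
  have aq : 0 < (a%:R / q%:R : R) < 1.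
    by rewrite divr_gt0 ?ltr0n //= ltr_pdivrMr ?ltr0n // mul1r ltr_nat ltn_ord.
  have := pi_gt0 R; rewrite /y; move/andP: aq => [q0 q1] p0.
  by apply/andP; split; [rewrite mulr_gt0|rewrite gtr_pMr].
have : ec a = cos (y *+ 2) by rewrite /ec /angle /y [pi *+ 2 * _]mulrnAl.
have := sin_gt0_pi y0; have := cos2Dsin2 y; rewrite H cos_mulr2n mulr2n => h1 h2 h3.
have s2 : sin y ^+ 2 = 0 by lra.
by have := exprn_gt0 2 h2; rewrite s2 ltxx.
Qed.

(** 1 - cos is half the squared distance of a point of the unit circle from 1, so this is the
    triangle inequality, squared. *)
Lemma ec_parallelogram a b : 1 - ec (a + b) <= 2 * (1 - ec a) + 2 * (1 - ec b).
Proof.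
rewrite ecD; have := ec2es2 a; have := ec2es2 b; rewrite !expr2.
have := sqr_ge0 (es a - es b); have := sqr_ge0 (ec a + ec b - 2); rewrite !expr2.
lra.
Qed.

Definition nrm (a : G) : nat := minn a (q - a).

Lemma ec_nrm a : 1 - ec a <= 8 * (nrm a)%:R / q%:R.
Proof.
have pi4 : pi <= 4 :> R by have [/andP[_ h] _] := pihalf_02_cos_pihalf R; lra.
have b k : 1 - cos (angle k) <= 8 * k%:R / q%:R.
  have k0 : 0 <= k%:R / q%:R :> R by rewrite divr_ge0.
  apply: (le_trans (one_sub_cos_le _)).
    by rewrite /angle mulr_ge0 // mulrn_wge0 // pi_ge0.
  by rewrite /angle -mulrA ler_wpM2r // mulr2n; lra.
rewrite /nrm /minn; case: ifP => _; first exact: b.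
have -> : ec a = cos (angle (q - a)); last exact: b.
by rewrite -ecN /ec -[RHS]cos_angle_mod.
Qed.

(** Replacing g by g + 1 rotates the vector (C, S) of cosine and sine sums by the angle of x, so the
    vector vanishes unless that rotation is trivial. *)
Lemma sum_ec (x : G) : \sum_(g : G) ec (g * x) = if x == 0 then q%:R else 0.
Proof.
have [->|x0] := eqVneq x 0.
  under eq_bigr do rewrite mulr0 ec0.
  by rewrite sumr_const card_ord.
set C := \sum_(g : G) _; pose S := \sum_(g : G) es (g * x).
have h1 : C = C * ec x - S * es x.
  rewrite {1}/C (reindex_inj (addIr (1 : G))) /= !mulr_suml -sumrB.
  by apply: eq_bigr => g _; rewrite mulrDl mul1r ecD.
have h2 : S = S * ec x + C * es x.
  rewrite {1}/S (reindex_inj (addIr (1 : G))) /= !mulr_suml -big_split.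
  by apply: eq_bigr => g _; rewrite mulrDl mul1r esD.
have e1 : 1 - ec x != 0.
  by rewrite subr_eq0 eq_sym; apply: contra x0 => /eqP /ec_eq1 ->.
have h3 := ec2es2 x; rewrite !expr2 in h3.
have : (2 * (1 - ec x)) * C = 0.
  have E1 : C * (1 - ec x) = - S * es x by rewrite mulrBr mulr1 {1}h1; ring.
  have E2 : S * (1 - ec x) = C * es x by rewrite mulrBr mulr1 {1}h2; ring.
  have -> : 2 * (1 - ec x) * C = C * ((ec x * ec x + es x * es x) + 1 - 2 * ec x) by rewrite h3; ring.
  have -> : C * ((ec x * ec x + es x * es x) + 1 - 2 * ec x) =
     (C * (1 - ec x)) * (1 - ec x) + (C * es x) * es x by ring.
  by rewrite E1 -E2; ring.
by move/eqP; rewrite !mulf_eq0 pnatr_eq0 (negbTE e1) /= => /eqP.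
Qed.

Implicit Types (f : G -> R) (T : {set G}).

Definition fc f (g : G) : R := \sum_x f x * ec (g * x).
Definition fs f (g : G) : R := \sum_x f x * es (g * x).
Definition energy f g : R := fc f g ^+ 2 + fs f g ^+ 2.

Lemma energy_ge0 f g : 0 <= energy f g.
Proof. by rewrite addr_ge0 ?sqr_ge0. Qed.

Lemma parseval f : \sum_g energy f g = q%:R * \sum_x f x ^+ 2.
Proof.
transitivity (\sum_g \sum_x \sum_y f x * f y * ec (g * (x - y))).
  apply: eq_bigr => g _; rewrite /energy !expr2 /fc /fs !mulr_suml -big_split /=.
  apply: eq_bigr => x _; rewrite !mulr_sumr -big_split /=; apply: eq_bigr => y _.
  by rewrite mulrBr ecB; ring.
rewrite exchange_big mulr_sumr; apply: eq_bigr => x _ /=.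
rewrite exchange_big (bigD1 x) //= [X in _ + X]big1 => [|y yx].
  by rewrite -mulr_sumr sum_ec subrr eqxx addr0 expr2 mulrC.
by rewrite -mulr_sumr sum_ec subr_eq0 eq_sym (negbTE yx) mulr0.
Qed.

(** The squared modulus of the normalized Fourier transform of T; as the Fourier multiplier of [avT]
    it is real and lies in [0, 1]. *)
Definition spec T (g : G) : R :=
  (\sum_(a in T) \sum_(b in T) ec (g * (a - b))) / (#|T|%:R * #|T|%:R).

Lemma spec_ge0 T g : 0 <= spec T g.
Proof.
rewrite divr_ge0 ?mulr_ge0 //.
have -> : \sum_(a in T) \sum_(b in T) ec (g * (a - b)) =
    (\sum_(a in T) ec (g * a)) ^+ 2 + (\sum_(a in T) es (g * a)) ^+ 2.
  rewrite !expr2 !mulr_suml -big_split /=; apply: eq_bigr => x _.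
  rewrite !mulr_sumr -big_split /=; apply: eq_bigr => y _.
  by rewrite mulrBr ecB.
by rewrite addr_ge0 ?sqr_ge0.
Qed.

Lemma spec_le1 T g : spec T g <= 1.
Proof.
have [T0|T0] := eqVneq #|T| 0; first by rewrite /spec T0 mulr0 invr0 mulr0 ler01.
rewrite ler_pdivrMr ?mulr_gt0 ?ltr0n ?lt0n // mul1r mulr_natr -sumr_const.
apply: ler_sum => a _; rewrite -sum1_card natr_sum; apply: ler_sum => b _.
exact: ec_le1.
Qed.

Lemma sum_es_sub T g : \sum_(a in T) \sum_(b in T) es (g * (a - b)) = 0.
Proof.
set S := \sum_(a in T) _; suff : S = - S by lra.
rewrite {1}/S exchange_big /= /S -sumrN; apply: eq_bigr => a _.
by rewrite -sumrN; apply: eq_bigr => b _; rewrite -opprB mulrN esN.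
Qed.

Lemma avT_transform T f (h : G -> R) :
  \sum_x avT T f x * h x =
  (\sum_(a in T) \sum_(b in T) \sum_x f x * h (x - (a - b))) / (#|T|%:R * #|T|%:R).
Proof.
transitivity (\sum_x (\sum_(a in T) \sum_(b in T) f (x + a - b) * h x) / (#|T|%:R * #|T|%:R)).
  apply: eq_bigr => x _; rewrite /avT mulrAC; congr (_ / _).
  by rewrite mulr_suml; apply: eq_bigr => a _; rewrite mulr_suml.
rewrite -mulr_suml; congr (_ / _); rewrite exchange_big; apply: eq_bigr => a _ /=.
rewrite exchange_big; apply: eq_bigr => b _ /=.
rewrite -(sum_shift _ (- (a - b))); apply: eq_bigr => x _.
by rewrite -[x - (a - b) + a - b]addrA subrK.
Qed.

Lemma fc_avT T f g : fc (avT T f) g = spec T g * fc f g.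
Proof.
rewrite /fc (avT_transform T f (fun x => ec (g * x))) /spec [RHS]mulrAC; congr (_ / _).
have -> : \sum_(a in T) \sum_(b in T) \sum_x f x * ec (g * (x - (a - b))) =
   \sum_(a in T) \sum_(b in T) ((ec (g * (a - b))) * fc f g + es (g * (a - b)) * fs f g).
  apply: eq_bigr => a _; apply: eq_bigr => b _.
  rewrite /fc /fs !mulr_sumr -big_split /=; apply: eq_bigr => x _.
  by rewrite mulrBr ecB; ring.
under eq_bigr do rewrite big_split -!mulr_suml /=.
by rewrite big_split -!mulr_suml /= sum_es_sub mul0r addr0.
Qed.

Lemma fs_avT T f g : fs (avT T f) g = spec T g * fs f g.
Proof.
rewrite /fs (avT_transform T f (fun x => es (g * x))) /spec [RHS]mulrAC; congr (_ / _).
have -> : \sum_(a in T) \sum_(b in T) \sum_x f x * es (g * (x - (a - b))) =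
   \sum_(a in T) \sum_(b in T) ((ec (g * (a - b))) * fs f g - es (g * (a - b)) * fc f g).
  apply: eq_bigr => a _; apply: eq_bigr => b _.
  rewrite /fc /fs !mulr_sumr -sumrB /=; apply: eq_bigr => x _.
  by rewrite mulrBr esB; ring.
under eq_bigr do rewrite sumrB -!mulr_suml /=.
by rewrite sumrB -!mulr_suml /= sum_es_sub mul0r subr0.
Qed.

Lemma energy_iter_avT T f g l :
  energy (iter l (avT T) f) g = spec T g ^+ (2 * l) * energy f g.
Proof.
elim: l => [|l IH]; first by rewrite muln0 expr0 mul1r.
have E h : energy (avT T h) g = spec T g ^+ 2 * energy h g.
  by rewrite /energy fc_avT fs_avT; ring.
by rewrite iterS E IH mulrA -exprD mulnS.
Qed.

Lemma energy_shift_sub f s g :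
  energy (fun x => f (x + s) - f x) g = (2 - 2 * ec (g * s)) * energy f g.
Proof.
have c1 : fc (fun x => f (x + s) - f x) g =
    fc f g * (ec (g * s) - 1) + fs f g * es (g * s).
  rewrite /fc /fs; under eq_bigr do rewrite mulrBl.
  rewrite sumrB -(sum_shift (fun x => f (x + s) * _) (- s)) !mulr_suml -sumrB -big_split /=.
  by apply: eq_bigr => x _; rewrite subrK mulrBr ecB; ring.
have c2 : fs (fun x => f (x + s) - f x) g =
    fs f g * (ec (g * s) - 1) - fc f g * es (g * s).
  rewrite /fc /fs; under eq_bigr do rewrite mulrBl.
  rewrite sumrB -(sum_shift (fun x => f (x + s) * _) (- s)) !mulr_suml -!sumrB /=.
  by apply: eq_bigr => x _; rewrite subrK mulrBr esB; ring.
rewrite /energy c1 c2; have h3 := ec2es2 (g * s).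
have -> : 2 - 2 * ec (g * s) =
  ec (g * s) ^+ 2 + es (g * s) ^+ 2 + 1 - 2 * ec (g * s) by rewrite h3; ring.
by ring.
Qed.

Lemma smooth_shift_l2 T f l s (eta : R) :
  (forall g, spec T g ^+ (2 * l) * (2 - 2 * ec (g * s)) <= eta) ->
  \sum_x (iter l (avT T) f (x + s) - iter l (avT T) f x) ^+ 2 <= eta * \sum_x f x ^+ 2.
Proof.
move=> H; have qR : 0 < q%:R :> R by rewrite ltr0n.
rewrite -(ler_pM2l qR) -parseval mulrCA -parseval mulr_sumr.
apply: ler_sum => g _; rewrite energy_shift_sub energy_iter_avT mulrA [_ * spec _ _ ^+ _]mulrC.
by rewrite ler_wpM2r ?energy_ge0.
Qed.

End Characters.

(** * Riesz products and a relative form of Chang's theorem *)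

Section Chang.
Variables (R : realType) (n : nat).
Local Notation q := n.+2.
Local Notation G := 'I_n.+2.
Local Notation ec := (@ec R n).
Local Notation es := (@es R n).
Implicit Types (f w : G -> R) (B T : {set G}).

Definition avB B f (x : G) : R := (\sum_(y in B) f (x + y)) / #|B|%:R.
Definition specB B (g : G) : R := (\sum_(y in B) ec (g * y)) / #|B|%:R.

Lemma sum_sym B (h : G -> R) : (forall x, (- x \in B) = (x \in B)) ->
  \sum_(y in B) h (- y) = \sum_(y in B) h y.
Proof.
move=> symB; rewrite [RHS](reindex_inj (@oppr_inj _)) /=.
by apply: eq_bigl => y; rewrite symB.
Qed.

(** Symmetry of B cancels the sine terms, so the multiplier is real. The phase [th] covers cosine
    and sine coefficients together and lets a product of two waves be again a sum of waves. *)
Lemma avB_wave B f g th : (forall x, (- x \in B) = (x \in B)) ->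
  \sum_x avB B f x * ec (g * x + th) = specB B g * \sum_x f x * ec (g * x + th).
Proof.
move=> symB; have es0 : \sum_(y in B) es (g * y) = 0.
  have := sum_sym (fun y => es (g * y)) symB.
  under eq_bigr do rewrite mulrN esN.
  by rewrite sumrN; lra.
transitivity ((\sum_x \sum_(y in B) f (x + y) * ec (g * x + th)) / #|B|%:R).
  rewrite mulr_suml; apply: eq_bigr => x _.
  by rewrite /avB mulrAC -mulr_suml.
rewrite /specB [RHS]mulrAC; congr (_ / _); rewrite exchange_big /=.
transitivity (\sum_(y in B) (ec (g * y) * (\sum_x f x * ec (g * x + th)) +
   es (g * y) * (\sum_x f x * es (g * x + th)))).
  apply: eq_bigr => y _; rewrite !mulr_sumr -big_split /= -(sum_shift _ (- y)).
  apply: eq_bigr => x _; rewrite subrK mulrBr addrAC ecB; ring.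
by rewrite big_split -!mulr_suml /= es0 mul0r addr0.
Qed.

Lemma iter_avB_wave B f g th m : (forall x, (- x \in B) = (x \in B)) ->
  \sum_x iter m (avB B) f x * ec (g * x + th) =
  specB B g ^+ m * \sum_x f x * ec (g * x + th).
Proof.
move=> symB; elim: m => [|m IH]; first by rewrite expr0 mul1r.
by rewrite iterS avB_wave // IH exprS mulrA.
Qed.

Lemma specB0 B : (0 < #|B|)%N -> specB B 0 = 1.
Proof.
move=> B0; rewrite /specB; under eq_bigr do rewrite mul0r ec0.
by rewrite sumr_const divff // pnatr_eq0 -lt0n.
Qed.

Lemma sum_iter_avB B f m : (forall x, (- x \in B) = (x \in B)) -> (0 < #|B|)%N ->
  \sum_x iter m (avB B) f x = \sum_x f x.
Proof.
move=> symB B0; have := iter_avB_wave f 0 0 m symB.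
under eq_bigr do rewrite mul0r addr0 ec0 mulr1.
rewrite specB0 // expr1n mul1r => ->.
by apply: eq_bigr => x _; rewrite mul0r addr0 ec0 mulr1.
Qed.

Lemma iter_avB_ge0 B f m : (forall x, 0 <= f x) -> forall x, 0 <= iter m (avB B) f x.
Proof.
by move=> f0; elim: m => [|m IH] x //; rewrite iterS divr_ge0 // sumr_ge0.
Qed.

Lemma iter_avB_one B (D : nat -> {set G}) m : (0 < #|B|)%N ->
  (forall j x y, x \in D j.+1 -> y \in B -> x + y \in D j) ->
  forall x, x \in D m -> iter m (avB B) (ind R (D 0)) x = 1.
Proof.
move=> B0 DS; elim: m => [|m IH] x xD; first by rewrite /= /ind xD.
rewrite iterS /avB (eq_bigr (fun _ => 1)) => [|y yB]; last by rewrite IH // DS.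
by rewrite sumr_const divff // pnatr_eq0 -lt0n.
Qed.

Definition riesz (L : seq (G * G)) (x : G) : R :=
  \prod_(p <- L) (1 + ec (p.1 * x + p.2) / 16).

(** All sums of e_l l over l in L with coefficients e_l in {-1, 0, 1}: the frequencies that occur in
    a Riesz product. *)
Fixpoint combos (L : seq G) : seq G :=
  if L is l :: L' then
    combos L' ++ [seq l + s | s <- combos L'] ++ [seq s - l | s <- combos L']
  else [:: 0].

(* Weaker than dissociativity: each element only has to avoid W modulo the
   combinations of those after it in the list. *)
Fixpoint dissoc (W : pred G) (L : seq G) : bool :=
  if L is l :: L' then dissoc W L' && all (fun s => ~~ W (l + s)) (combos L') else true.

Lemma riesz_ge0 L x : 0 <= riesz L x.
Proof.
rewrite /riesz prodr_ge0 // => p _.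
by have := ec_geN1 R (p.1 * x + p.2); lra.
Qed.

(** Multiplying a wave by one more factor of the product leaves the wave and adds two with
    frequencies g + l and g - l, of weight 1/32 each; the growth 1 + 2/32 is bounded by 2. *)
Lemma riesz_wave (W : pred G) w (kap : R) L g th :
  (forall g th, ~~ W g -> `|\sum_x w x * ec (g * x + th)| <= kap) ->
  all (fun s => ~~ W (g + s)) (combos (unzip1 L)) ->
  `|\sum_x w x * (ec (g * x + th) * riesz L x)| <= kap * 2 ^+ size L.
Proof.
move=> Hw; elim: L g th => [|[l t] L IH] g th /=.
  rewrite addr0 andbT => Wg; rewrite expr0 mulr1.
  rewrite (eq_bigr (fun x => w x * ec (g * x + th))); first exact: Hw.
  by move=> x _; rewrite /riesz big_nil mulr1.
rewrite !all_cat !all_map => /and3P[h1 h2 h3].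
have b1 := IH g th h1.
have {}h2 : all (fun s => ~~ W (g + l + s)) (combos (unzip1 L)).
  by apply: sub_all h2 => s /=; rewrite addrA.
have {}h3 : all (fun s => ~~ W (g - l + s)) (combos (unzip1 L)).
  by apply: sub_all h3 => s /=; rewrite -addrA [- l + s]addrC.
have b2 := IH _ (th + t) h2; have b3 := IH _ (th - t) h3.
have -> : \sum_x w x * (ec (g * x + th) * riesz ((l, t) :: L) x) =
  \sum_x w x * (ec (g * x + th) * riesz L x) +
  32^-1 * \sum_x w x * (ec ((g + l) * x + (th + t)) * riesz L x) +
  32^-1 * \sum_x w x * (ec ((g - l) * x + (th - t)) * riesz L x).
  rewrite !mulr_sumr -!big_split /=; apply: eq_bigr => x _.
  have -> : riesz ((l, t) :: L) x = (1 + ec (l * x + t) / 16) * riesz L x.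
    by rewrite /riesz big_cons.
  have e1 : (g + l) * x + (th + t) = (g * x + th) + (l * x + t) by ring.
  have e2 : (g - l) * x + (th - t) = (g * x + th) - (l * x + t) by ring.
  by rewrite e1 e2; move: (g * x + th) (l * x + t) => a b; rewrite ecD ecB; field.
move: b1 b2 b3; rewrite exprS !ler_norml.
set k := kap * _; have -> : kap * (2 * 2 ^+ size L) = 2 * k by rewrite /k; ring.
move=> /andP[? ?] /andP[? ?] /andP[? ?]; apply/andP; split; lra.
Qed.

Lemma riesz_sum (W : pred G) w (kap : R) L :
  (forall g th, ~~ W g -> `|\sum_x w x * ec (g * x + th)| <= kap) -> 0 <= kap ->
  dissoc W (unzip1 L) ->
  \sum_x w x * riesz L x <= \sum_x w x + kap * 2 ^+ size L.
Proof.
move=> Hw k0; elim: L => [|[l t] L IH] /=.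
  move=> _; rewrite expr0 mulr1 (eq_bigr w) ?lerDl // => x _.
  by rewrite /riesz big_nil mulr1.
move=> /andP[/IH {}IH dl].
have := riesz_wave t Hw dl; rewrite ler_norml => /andP[_ b].
have -> : \sum_x w x * riesz ((l, t) :: L) x =
  \sum_x w x * riesz L x + 16^-1 * \sum_x w x * (ec (l * x + t) * riesz L x).
  rewrite !mulr_sumr -!big_split /=; apply: eq_bigr => x _.
  by rewrite /riesz big_cons /=; field.
have p0 : 0 <= kap * 2 ^+ size L by rewrite mulr_ge0 // exprn_ge0.
rewrite exprS; lra.
Qed.

Lemma one_add_ge_exp (y : R) : `|y| <= 16^-1 -> expR (y - 3 * y ^+ 2) <= 1 + y.
Proof.
rewrite ler_norml => /andP[y1 y2].
have y3 : 0 <= y ^+ 2 by rewrite sqr_ge0.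
have y4 : y ^+ 2 <= 16^-1 * 16^-1 by rewrite expr2; nra.
apply: le_trans (expR_le_quadratic _) _; first by lra.
have -> : 1 + (y - 3 * y ^+ 2) + 2 * (y - 3 * y ^+ 2) ^+ 2 =
  1 + y - y ^+ 2 * (3 - 2 * (1 - 3 * y) ^+ 2) by ring.
rewrite lerBlDr lerDl mulr_ge0 // expr2; nra.
Qed.

(** Jensen's inequality for the exponential. A factor 1 + y with y = cos/16 is at least exp(y - 3
    y^2), and the mean over T of this exponent is at least 1/64 - 3/256 = 1/256. *)
Lemma riesz_lower (T : {set G}) L :
  (forall p, p \in L -> 4^-1 * #|T|%:R <= \sum_(x in T) ec (p.1 * x + p.2)) ->
  #|T|%:R * expR ((size L)%:R / 256) <= \sum_(x in T) riesz L x.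
Proof.
move=> HL.
pose Z x := \sum_(p <- L) (ec (p.1 * x + p.2) / 16 - 3 / 256).
have ZL x : expR (Z x) <= riesz L x.
  rewrite /Z /riesz expR_sum; apply: ler_prod => p _; rewrite expR_ge0 /=.
  have := ec_geN1 R (p.1 * x + p.2); have := ec_le1 R (p.1 * x + p.2).
  set c := ec _ => c1 c2; apply: (@le_trans _ _ (expR (c / 16 - 3 * (c / 16) ^+ 2))).
    by rewrite ler_expR expr2; nra.
  by apply: one_add_ge_exp; rewrite ler_norml; apply/andP; split; lra.
have sZ : #|T|%:R * ((size L)%:R / 256) <= \sum_(x in T) Z x.
  rewrite exchange_big /=.
  have -> : #|T|%:R * ((size L)%:R / 256) = \sum_(p <- L) #|T|%:R / 256 :> R.
    by rewrite big_const_seq count_predT iter_addr_0 -mulr_natr; field.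
  rewrite !big_seq; apply: ler_sum => p pL; rewrite sumrB -mulr_suml sumr_const.
  by rewrite -[_ *+ _]mulr_natr; have := HL _ pL; lra.
set m := _ / 256 in sZ *.
apply: (@le_trans _ _ (\sum_(x in T) expR m * (1 + (Z x - m)))).
  rewrite -mulr_sumr mulrC ler_wpM2l ?expR_ge0 //.
  rewrite big_split sumrB !sumr_const /= -[m *+ _]mulr_natl; lra.
apply: ler_sum => x _; apply: le_trans (ZL x).
have -> : expR (Z x) = expR m * expR (Z x - m) by rewrite -expRD; congr expR; ring.
by rewrite ler_wpM2l ?expR_ge0 // expR_ge1Dx.
Qed.

(** [spec] is an average over b in T of cosine sums with phase - g b; some b does at least as well
    as the average. *)
Lemma spec_phase T g : (0 < #|T|)%N -> 4^-1 <= spec R T g ->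
  exists th, 4^-1 * #|T|%:R <= \sum_(x in T) ec (g * x + th).
Proof.
move=> T0; have TR : 0 < #|T|%:R :> R by rewrite ltr0n.
rewrite /spec ler_pdivlMr ?mulr_gt0 // exchange_big /= => H.
have [] := @exists_le R _ (mem T) (fun _ => 4^-1 * #|T|%:R)
   (fun b => \sum_(x in T) ec (g * (x - b))).
- by have /card_gt0P[b bT] := T0; exists b.
- by apply: le_trans H; rewrite sumr_const -[_ *+ _]mulr_natr mulrA.
move=> b _ Hb; exists (- (g * b)); apply: le_trans Hb _.
by rewrite le_eqVlt; apply/orP; left; apply/eqP/eq_bigr => x _; rewrite mulrBr.
Qed.

(** Tested against a weight that covers T, a Riesz product on m0 large frequencies of T that are
    dissociated modulo the large spectrum of B would have total at most 4 K, yet its sum over T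
    alone is at least |T| exp(m0/256). The length thus depends on the density of T relative to K and
    not to the whole group. *)
Lemma chang T B (D : nat -> {set G}) m0 (K : R) :
  (forall x, (- x \in B) = (x \in B)) -> (0 < #|B|)%N -> (0 < #|T|)%N ->
  (forall j x y, x \in D j.+1 -> y \in B -> x + y \in D j) ->
  T \subset D m0 -> #|D 0|%:R <= 2 * K ->
  4 * K < #|T|%:R * expR (m0%:R / 256) ->
  exists L : seq G, (size L <= m0)%N /\
    forall g, 4^-1 <= spec R T g -> exists2 s, s \in combos L & 2^-1 < `|specB B (g + s)|.
Proof.
move=> symB B0 T0 DS TD cD0 small.
pose W (g : G) := 2^-1 < `|specB B g|.
(* This weight is 1 on [D m0], which contains T, and has total mass |D 0|. Each of the m0 averagings
   halves the coefficients outside W, which pays for the factor 2^m0 in [riesz_sum]. *)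
pose w := iter m0 (avB B) (ind R (D 0)).
have Hw g th : ~~ W g -> `|\sum_x w x * ec (g * x + th)| <= 2 * K * 2^-1 ^+ m0.
  rewrite -leNgt => sg; rewrite /w iter_avB_wave // normrM mulrC.
  apply: ler_pM => //.
    apply: le_trans cD0; rewrite -sum_ind; apply: (le_trans (ler_norm_sum _ _ _)).
    apply: ler_sum => x _; rewrite normrM ger0_norm ?ind_ge0 // ler_piMr ?ind_ge0 //.
    by rewrite ler_norml ec_geN1 ec_le1.
  by rewrite normrX; apply: lerXn2r; rewrite ?nnegrE // invr_ge0.
have [[L [sL HL]]|[L [sL dL HL]]] : (exists L : seq G, (size L <= m0)%N /\
    forall g, 4^-1 <= spec R T g -> exists2 s, s \in combos L & W (g + s)) \/
  (exists L : seq (G * G), [/\ size L = m0, dissoc W (unzip1 L) &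
    forall p, p \in L -> 4^-1 * #|T|%:R <= \sum_(x in T) ec (p.1 * x + p.2)]).
(* Greedy construction: either the current list already covers the large frequencies of T, or an
   uncovered one extends it. *)
- elim: (m0) => [|j [[L [sL HL]]|[L [sL dL HL]]]].
  + by right; exists [::].
  + by left; exists L; split => //; exact: leqW.
  have [/forallP cov|] := boolP [forall g, (4^-1 <= spec R T g) ==>
      has (fun s => W (g + s)) (combos (unzip1 L))].
    left; exists (unzip1 L); rewrite size_map sL; split => // g gT.
    by have := cov g; rewrite gT /= => /hasP[s]; exists s.
  rewrite negb_forall => /existsP[g]; rewrite negb_imply => /andP[gT ng].
  have [th Hth] := spec_phase T0 gT.
  right; exists ((g, th) :: L); split => /=; first by rewrite sL.
    by rewrite dL /=; rewrite -all_predC in ng.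
  by move=> p; rewrite inE => /predU1P[->|/HL].
- by exists L.
exfalso.
have K0 : 0 <= K by have := ler0n R #|D 0|; lra.
have k0 : 0 <= 2 * K * 2^-1 ^+ m0 by rewrite !mulr_ge0 // exprn_ge0.
have up := riesz_sum Hw k0 dL.
have lo := riesz_lower HL; rewrite sL in up lo.
have sw : \sum_x w x <= 2 * K by rewrite /w sum_iter_avB // sum_ind.
have mid : \sum_(x in T) riesz L x <= \sum_x w x * riesz L x.
  rewrite big_mkcond; apply: ler_sum => x _; case: ifP => [xT|_].
    by rewrite /w (iter_avB_one B0 DS (fintype.subsetP TD _ xT)) mul1r.
  by rewrite mulr_ge0 ?riesz_ge0 // /w iter_avB_ge0 // => y; exact: ind_ge0.
have E : 2 * K * 2^-1 ^+ m0 * 2 ^+ m0 = 2 * K.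
  by rewrite -mulrA -exprMn mulVf ?expr1n ?mulr1.
rewrite E in up; lra.
Qed.

(** Moving B by s or by - s changes its cosine sum by at most |Bout| - |Bin|. The mean of the two
    changes has no sine term and equals that sum times 1 - cos, so a large coefficient forces
    [ec (g * s)] near 1. *)
Lemma specB_shift B (Bin Bout : {set G}) g s :
  (0 < #|B|)%N -> Bin \subset B -> B \subset Bout ->
  (forall x, x \in Bin -> x + s \in B /\ x - s \in B) ->
  (forall x, x \in B -> x + s \in Bout /\ x - s \in Bout) ->
  2^-1 < `|specB B g| ->
  1 - ec (g * s) <= 2 * ((#|Bout|%:R - #|Bin|%:R) / #|B|%:R).
Proof.
move=> B0 BinB BBout hin hout sg; have BR : 0 < #|B|%:R :> R by rewrite ltr0n.
set dl := #|Bout|%:R - #|Bin|%:R.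
have key t : (t = s \/ t = - s) ->
   `|\sum_(x in B) ec (g * x) - \sum_(x in B) ec (g * (x + t))| <= dl.
  move=> Ht; have h1 x : x \in Bin -> x - t \in B.
    by case: Ht => -> /hin[]; rewrite ?opprK.
  have h2 x : x - t \in B -> x \in Bout.
    by case: Ht => ->; [move=> /hout[+ _]; rewrite subrK|rewrite opprK => /hout[_]; rewrite addrK].
  rewrite -!sum_indM -(sum_shift (fun x => ind R B x * ec (g * (x + t))) (- t)) -sumrB.
  apply: (le_trans (ler_norm_sum _ _ _)).
  rewrite /dl -!(sum_ind R) -sumrB; apply: ler_sum => x _.
  rewrite subrK -mulrBl normrM.
  have e1 : `|ec (g * x)| <= 1 by rewrite ler_norml ec_geN1 ec_le1.
  apply: (@le_trans _ _ (`|ind R B x - ind R B (x - t)|)); first by rewrite ler_piMr.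
  rewrite /ind; have [xi|xi] := boolP (x \in Bin).
    have xB := fintype.subsetP BinB _ xi.
    by rewrite xB (h1 _ xi) (fintype.subsetP BBout _ xB) subrr normr0.
  rewrite subr0; have [xo|xo] := boolP (x \in Bout).
    by case: (x \in B); case: (x - t \in B); rewrite ?subrr ?subr0 ?sub0r ?normrN ?normr0 ?normr1.
  have -> : (x \in B) = false by apply: contraNF xo => /(fintype.subsetP BBout).
  have -> : (x - t \in B) = false by apply: contraNF xo => /h2.
  by rewrite subrr normr0.
have k1 := key s (or_introl erefl); have k2 := key (- s) (or_intror erefl).
have E : (specB B g * #|B|%:R) * (1 - ec (g * s)) =
  2^-1 * (\sum_(x in B) ec (g * x) - \sum_(x in B) ec (g * (x + s))) +
  2^-1 * (\sum_(x in B) ec (g * x) - \sum_(x in B) ec (g * (x - s))).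
  rewrite /specB divfK ?gt_eqF // -!sumrB !mulr_sumr mulr_suml -big_split /=.
  by apply: eq_bigr => x _; rewrite [g * (x + s)]mulrDr [g * (x - s)]mulrBr ecD ecB; field.
have c0 : 0 <= 1 - ec (g * s) by have := ec_le1 R (g * s); lra.
have : `|specB B g| * #|B|%:R * (1 - ec (g * s)) <= dl.
  have -> : `|specB B g| * #|B|%:R * (1 - ec (g * s)) =
      `|(specB B g * #|B|%:R) * (1 - ec (g * s))|.
    by rewrite !normrM (ger0_norm c0) (ger0_norm (ltW BR)).
  rewrite E; move: k1 k2; rewrite !ler_norml => /andP[? ?] /andP[? ?].
  by apply/andP; split; lra.
have p : 0 <= #|B|%:R * (1 - ec (g * s)) by rewrite mulr_ge0 // ltW.
rewrite mulrA ler_pdivlMr // => H.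
have := ler_wpM2r p (ltW sg); rewrite !mulrA; lra.
Qed.

End Chang.

(** * Bohr sets *)

Section Bohr.
Variable n : nat.
Local Notation q := n.+2.
Local Notation G := 'I_n.+2.
Local Notation nrm := (@nrm n).
Implicit Types (L : seq G).

Lemma val_add (a b : G) : nat_of_ord (a + b) = if (a + b < q)%N then (a + b)%N else (a + b - q)%N.
Proof.
have ha := ltn_ord a; have hb := ltn_ord b.
have -> : nat_of_ord (a + b) = ((a + b) %% q)%N by [].
case: ifP => H; first by rewrite modn_small.
have -> : (a + b = (a + b - q) + q)%N by lia.
by rewrite modnDr modn_small; lia.
Qed.

Lemma val_opp (a : G) : nat_of_ord (- a) = if a == 0%N :> nat then 0%N else (q - a)%N.
Proof.
have ha := ltn_ord a.
have -> : nat_of_ord (- a) = ((q - a) %% q)%N by [].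
case: ifP => [/eqP ->|H]; first by rewrite subn0 modnn.
by rewrite modn_small; lia.
Qed.

Lemma nrm0 : nrm 0 = 0%N. Proof. by rewrite /nrm min0n. Qed.

Lemma nrmN (a : G) : nrm (- a) = nrm a.
Proof.
have ha := ltn_ord a; rewrite /nrm val_opp.
by case: ifP => [/eqP ->|H]; rewrite ?min0n //; lia.
Qed.

Lemma nrmD (a b : G) : (nrm (a + b)%R <= nrm a + nrm b)%N.
Proof.
have ha := ltn_ord a; have hb := ltn_ord b; rewrite /nrm val_add.
by case: ifP => H; lia.
Qed.

Lemma nrm_leq (a : G) : (nrm a <= q)%N.
Proof. by have ha := ltn_ord a; rewrite /nrm; lia. Qed.

Lemma nrm_sub_le (a b : G) (h : nat) : (a <= b + h)%N -> (b <= a + h)%N -> (nrm (a - b)%R <= h)%N.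
Proof.
have ha := ltn_ord a; have hb := ltn_ord b => h1 h2.
rewrite /nrm val_add val_opp.
by case: ifP => [/eqP E|E]; case: ifP => H; lia.
Qed.

(* The radius r is not normalized: it corresponds to the usual width r / q. *)
Definition bohr L (r : nat) : {set G} := [set x | all (fun g => nrm (g * x)%R <= r)%N L].

Lemma bohr_mono L r r' x : (r <= r')%N -> x \in bohr L r -> x \in bohr L r'.
Proof.
by move=> rr'; rewrite !inE; apply: sub_all => g h; exact: leq_trans rr'.
Qed.

Lemma bohr_sub L r r' : (r <= r')%N -> bohr L r \subset bohr L r'.
Proof. by move=> rr'; apply/fintype.subsetP => x; exact: bohr_mono. Qed.

Lemma bohr0 L r : 0 \in bohr L r.
Proof. by rewrite inE; apply/allP => g _; rewrite mulr0 nrm0. Qed.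

Lemma bohr_card_gt0 L r : (0 < #|bohr L r|)%N.
Proof. by apply/card_gt0P; exists 0; exact: bohr0. Qed.

Lemma bohrN L r x : (- x \in bohr L r) = (x \in bohr L r).
Proof. by rewrite !inE; apply: eq_all => g; rewrite mulrN nrmN. Qed.

Lemma bohrD L r s x y : x \in bohr L r -> y \in bohr L s -> x + y \in bohr L (r + s)%N.
Proof.
rewrite !inE => /allP hx /allP hy; apply/allP => g gL; rewrite mulrDr.
by apply: leq_trans (nrmD _ _) (leq_add (hx _ gL) (hy _ gL)).
Qed.

Lemma bohrB L r s x y : x \in bohr L r -> y \in bohr L s -> x - y \in bohr L (r + s)%N.
Proof. by move=> hx hy; apply: bohrD => //; rewrite bohrN. Qed.

Lemma bohr_full L r : (q <= r)%N -> bohr L r = [set: G].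
Proof.
move=> qr; apply/setP => x; rewrite !inE; apply/allP => g _.
by apply: leq_trans (nrm_leq _) qr.
Qed.

Lemma bohr_nil r : bohr [::] r = [set: G].
Proof. by apply/setP => x; rewrite !inE. Qed.

Lemma bohr_cat L L' r x : (x \in bohr (L ++ L') r) = (x \in bohr L r) && (x \in bohr L' r).
Proof. by rewrite !inE all_cat. Qed.

(** Shifting by r turns the interval [-r, r] around 0, which wraps modulo q, into an interval of
    representatives. *)
Lemma val_addn_le (a : G) r : (nrm a <= r)%N -> (nat_of_ord (a + r%:R)%R <= 2 * r)%N.
Proof.
have ha := ltn_ord a; have hr := ltn_ord (a + r%:R)%R.
have [qr|rq] := leqP q r; first by lia.
have vr : nat_of_ord (r%:R : G) = r by rewrite Zp_nat /= modn_small.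
by rewrite val_add vr /nrm; case: ifP => H; lia.
Qed.

Lemma divn_eq_close (a b h : nat) : (a %/ h.+1 = b %/ h.+1)%N -> (a <= b + h)%N.
Proof.
move=> E; rewrite {1}(divn_eq a h.+1) E; apply: leq_add; first exact: leq_trunc_div.
by rewrite -ltnS ltn_pmod.
Qed.

(** For each frequency the shifted values lie in [0, 2 r], which four cells of length floor(r/2) + 1
    cover. Points in the same cells for all frequencies differ by an element of the Bohr set of half
    the radius. *)
Lemma bohr_half_card L r : (#|bohr L r| <= 4 ^ size L * #|bohr L (r %/ 2)|)%N.
Proof.
pose h := (r %/ 2).+1; pose d := size L.
pose cell (x : G) : {ffun 'I_d -> 'I_4} :=
  [ffun i : 'I_d => inord (nat_of_ord (nth 0 L i * x + r%:R)%R %/ h)].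
rewrite -sum1_card (partition_big cell predT) //=.
apply: (@leq_trans (\sum_(c : {ffun 'I_d -> 'I_4}) #|bohr L (r %/ 2)|)); last first.
  by rewrite sum_nat_const card_ffun !card_ord.
apply: leq_sum => c _; rewrite sum1dep_card.
have [-> //|/card_gt0P[y0]] := posnP #|[set x | (x \in bohr L r) && (cell x == c)]|.
rewrite inE => /andP[y0B /eqP y0c].
have inj : injective (fun x : G => x - y0) by exact: addIr.
rewrite -(card_imset _ inj); apply: subset_leq_card; apply/fintype.subsetP => z.
move=> /imsetP[x]; rewrite inE => /andP[xB /eqP xc] ->.
rewrite inE; apply/(all_nthP 0) => i iL.
have := congr1 (fun f : {ffun 'I_d -> 'I_4} => nat_of_ord (f (Ordinal iL))) (etrans xc (esym y0c)).
rewrite !ffunE /=.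
move: xB y0B; rewrite !inE => /all_nthP -/(_ 0 i iL) hx /all_nthP -/(_ 0 i iL) hy.
have vx := val_addn_le hx; have vy := val_addn_le hy.
set a := nth 0 L i * x + r%:R in vx *; set b := nth 0 L i * y0 + r%:R in vy *.
have lt4 (v : nat) : (v <= 2 * r)%N -> (v %/ h < 4)%N.
  by move=> hv; rewrite ltn_divLR // /h; lia.
rewrite !inordK ?lt4 // => E.
have -> : nth 0 L i * (x - y0) = a - b by rewrite /a /b; ring.
by apply: nrm_sub_le; exact: divn_eq_close.
Qed.

Lemma bohr_card_lower L i : (q <= 4 ^ (size L * i) * #|bohr L (q %/ 2 ^ i)|)%N.
Proof.
elim: i => [|i IH].
  by rewrite muln0 expn0 divn1 bohr_full // cardsT card_ord mul1n.
apply: (leq_trans IH); rewrite mulnS expnD [(4 ^ _ * 4 ^ _)%N]mulnC -mulnA leq_mul2l.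
by rewrite expnSr divnMA bohr_half_card orbT.
Qed.

Lemma succ_expn_ge m : (0 < m)%N -> (2 * m ^ m <= m.+1 ^ m)%N.
Proof.
case: m => // m _.
have H k : (m.+1 ^ k.+1 + k.+1 * m.+1 ^ k <= m.+2 ^ k.+1)%N.
  elim: k => [|k IH]; first by rewrite !expn1 expn0; lia.
  rewrite [(m.+2 ^ _)%N]expnS [(m.+1 ^ k.+2)%N]expnS.
  have := leq_mul (leqnn m.+2) IH; rewrite expnS; set x := (m.+1 ^ k)%N; nia.
by have := H m; rewrite expnS; lia.
Qed.

(** Existence of regular radii. If each of the 2 (d + 1) m steps of length 2 u from r/2 upwards
    increased the size by more than the factor 1 + 1/m, the total growth would reach 4^(d + 1),
    since (1 + 1/m)^m >= 2; [bohr_half_card] allows only 4^d. *)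
Lemma bohr_regular L r u m : (0 < m)%N -> (8 * (size L).+1 * m * u <= r)%N ->
  exists rho, [/\ (r %/ 2 + u <= rho)%N, (rho + u <= r)%N &
    (m * #|bohr L (rho + u)| <= m.+1 * #|bohr L (rho - u)|)%N].
Proof.
move=> m0 hu; set d := size L in hu.
pose N := (2 * d.+1 * m)%N; pose t i := (r %/ 2 + 2 * u * i)%N.
have tN : (t N <= r)%N.
  have : (2 * u * N = 4 * d.+1 * m * u)%N by rewrite /N; lia.
  have : (8 * d.+1 * m * u = 2 * (4 * d.+1 * m * u))%N by lia.
  by rewrite /t; set X := (2 * u * N)%N; set Y := (4 * d.+1 * m * u)%N; lia.
have [/existsP[i Hi]|] := boolP [exists i : 'I_N,
    (m * #|bohr L (t i.+1)| <= m.+1 * #|bohr L (t i)|)%N].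
  exists (t i + u)%N; have ti : (t i.+1 = t i + u + u)%N by rewrite /t; lia.
  split; first by rewrite /t; lia.
    rewrite -ti; apply: leq_trans tN; rewrite /t leq_add2l leq_mul2l.
    by rewrite ltn_ord orbT.
  by rewrite -ti addnK.
rewrite negb_exists => /forallP H.
have ind k : (k <= N)%N ->
    (m.+1 ^ k * #|bohr L (t 0)| <= m ^ k * #|bohr L (t k)|)%N.
  elim: k => [|k IH] kN; first by rewrite !expn0.
  have := H (Ordinal kN); rewrite -ltnNge /= => lt1.
  have {IH} := IH (ltnW kN) => IH.
  rewrite !expnS -!mulnA.
  apply: (@leq_trans (m.+1 * (m ^ k * #|bohr L (t k)|))); first by rewrite leq_mul2l IH orbT.
  by rewrite mulnCA [leqRHS]mulnCA leq_mul2l ltnW ?orbT.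
exfalso.
have := ind N (leqnn N); rewrite {1}/t muln0 addn0.
have B1 : (#|bohr L (t N)| <= 4 ^ d * #|bohr L (r %/ 2)|)%N.
  by apply: leq_trans (subset_leq_card (bohr_sub L tN)) (bohr_half_card L r).
move=> B2.
have p1 : (0 < #|bohr L (r %/ 2)|)%N by exact: bohr_card_gt0.
have B3 : (m.+1 ^ N <= m ^ N * 4 ^ d)%N.
  rewrite -(leq_pmul2r p1) -mulnA; apply: leq_trans B2 _.
  by rewrite leq_mul2l B1 orbT.
have B4 : (4 ^ d.+1 * m ^ N <= m.+1 ^ N)%N.
  have -> : (4 ^ d.+1 * m ^ N = (2 * m ^ m) ^ (2 * d.+1))%N.
    by rewrite expnMn -[((m ^ m) ^ _)%N]expnM [(2 ^ (2 * _))%N]expnM /N [(2 * _ * m)%N]mulnC.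
  have -> : (m.+1 ^ N = (m.+1 ^ m) ^ (2 * d.+1))%N by rewrite -expnM /N mulnC.
  by rewrite leq_exp2r ?succ_expn_ge.
have : (4 ^ d.+1 * m ^ N <= 4 ^ d * m ^ N)%N by rewrite [leqRHS]mulnC; apply: leq_trans B4 B3.
rewrite leq_pmul2r ?expn_gt0 ?m0 // leq_exp2l //; lia.
Qed.

Lemma combos_nrm L r (x s : G) : (forall l, l \in L -> (nrm (l * x)%R <= r)%N) ->
  s \in combos L -> (nrm (s * x)%R <= size L * r)%N.
Proof.
elim: L s => [|l L IH] s /= H.
  by rewrite inE => /eqP ->; rewrite mul0r nrm0.
have {}IH s' : s' \in combos L -> (nrm (s' * x)%R <= size L * r)%N.
  by apply: IH => l' l'L; apply: H; rewrite inE l'L orbT.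
have hl : (nrm (l * x)%R <= r)%N by apply: H; rewrite inE eqxx.
rewrite mulSn !mem_cat => /or3P[/IH h|/mapP[s' /IH h ->]|/mapP[s' /IH h ->]].
- exact: leq_trans h (leq_addl _ _).
- by rewrite mulrDl; apply: leq_trans (nrmD _ _) (leq_add hl h).
- rewrite mulrBl; apply: leq_trans (nrmD _ _) _; rewrite nrmN addnC.
  exact: leq_add hl h.
Qed.

Hypothesis oddq : odd q.
Definition half : G := (q.+1./2)%:R.

Lemma half2 : half + half = 1.
Proof.
rewrite /half -natrD addnn; have -> : (q.+1./2.*2 = q + 1)%N.
  by move: oddq => /=; lia.
have q0 : (q%:R : G) = 0 by apply: val_inj; rewrite Zp_nat /= modnn.
by rewrite natrD q0 add0r.
Qed.

(** Halving the frequencies dilates the Bohr set by 2, which gives a Bohr set made of the doubled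
    points 2y. *)
Definition halve L := [seq g * half | g <- L].

Lemma bohr_halve L r x : (x + x \in bohr (halve L) r) = (x \in bohr L r).
Proof.
rewrite !inE all_map; apply: eq_all => g /=.
have -> : g * half * (x + x) = g * x * (half + half) by ring.
by rewrite half2 mulr1.
Qed.

Lemma bohr_halve_dbl L r x : x \in bohr (halve L) r -> exists2 y, y \in bohr L r & x = y + y.
Proof.
have E : x = x * half + x * half by rewrite -mulrDr half2 mulr1.
by rewrite {1}E bohr_halve; exists (x * half).
Qed.

Lemma dbl_inj : injective (fun x : G => x + x).
Proof.
move=> x y /= E; rewrite -[x]mulr1 -[y]mulr1 -half2.
have -> : x * (half + half) = (x + x) * half by ring.
by rewrite E; ring.
Qed.

Lemma size_halve L : size (halve L) = size L. Proof. exact: size_map. Qed.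

End Bohr.

(** * Averages over two sets *)

Section DoubleMean.
Variables (R : realType) (G : finZmodType).
Implicit Types (A B T : {set G}) (f : G -> R).

Definition mean2 A1 A2 f (s : G) : R :=
  (\sum_(z in A1) \sum_(v in A2) f (v - z + s)) / (#|A1|%:R * #|A2|%:R).

Lemma avT_ext T f f' : f =1 f' -> avT T f =1 avT T f'.
Proof.
by move=> E s; congr (_ / _); apply: eq_bigr => a _; apply: eq_bigr => b _; rewrite E.
Qed.

Lemma avT_mean2 A1 A2 T f : avT T (mean2 A1 A2 f) =1 mean2 A1 A2 (avT T f).
Proof.
move=> s; rewrite /avT /mean2.
transitivity ((\sum_(a in T) \sum_(b in T) \sum_(z in A1) \sum_(v in A2)
   f (v - z + (s + a - b))) / (#|T|%:R * #|T|%:R) / (#|A1|%:R * #|A2|%:R)).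
  rewrite mulrAC; congr (_ / _); rewrite mulr_suml; apply: eq_bigr => a _.
  by rewrite mulr_suml.
congr (_ / _).
transitivity ((\sum_(z in A1) \sum_(v in A2) \sum_(a in T) \sum_(b in T)
   f (v - z + (s + a - b))) / (#|T|%:R * #|T|%:R)).
  congr (_ / _).
  under eq_bigr do rewrite exchange_big.
  rewrite exchange_big; apply: eq_bigr => z _ /=.
  under eq_bigr do rewrite exchange_big.
  by rewrite exchange_big.
rewrite mulr_suml; apply: eq_bigr => z _; rewrite mulr_suml; apply: eq_bigr => v _.
by congr (_ / _); apply: eq_bigr => a _; apply: eq_bigr => b _; rewrite !addrA.
Qed.

Lemma iter_avT_ext T f f' l : f =1 f' -> iter l (avT T) f =1 iter l (avT T) f'.
Proof. by move=> E; elim: l => [|l IH] //; rewrite !iterS; apply: avT_ext. Qed.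

Lemma iter_avT_mean2 A1 A2 T f l :
  iter l (avT T) (mean2 A1 A2 f) =1 mean2 A1 A2 (iter l (avT T) f).
Proof.
elim: l => [|l IH] // s; rewrite !iterS (avT_ext T IH); exact: avT_mean2.
Qed.

Lemma avg1_hits A1 A2 (S : pred G) :
  avg1 A1 (hits R A2 S) =1 mean2 A1 A2 (fun x => (S x)%:R).
Proof.
move=> s; rewrite /avg1 /hits /mean2 -mulr_suml -mulrA -invfM [#|A2|%:R * _]mulrC.
congr (_ / _); apply: eq_bigr => z _; apply: eq_bigr => v _.
by rewrite addrCA addrC.
Qed.

(** For each fixed z, Cauchy-Schwarz over v in A2, in the form - F <= del/2 + F^2/(2 del). Only the
    size of A2 enters. *)
Lemma mean2_shift A1 A2 f s (del : R) : 0 < del ->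
  (0 < #|A1|)%N -> (0 < #|A2|)%N ->
  \sum_x (f (x + s) - f x) ^+ 2 <= del ^+ 2 * #|A2|%:R ->
  mean2 A1 A2 f 0 - del <= mean2 A1 A2 f s.
Proof.
move=> d0 A10 A20 H.
have a1 : 0 < #|A1|%:R :> R by rewrite ltr0n.
have a2 : 0 < #|A2|%:R :> R by rewrite ltr0n.
have p : 0 < #|A1|%:R * #|A2|%:R :> R by rewrite mulr_gt0.
rewrite lerBlDr -(ler_pM2r p) mulrDl !divfK ?gt_eqF // addrC -lerBlDr -sumrB.
apply: (@le_trans _ _ (\sum_(z in A1) del * #|A2|%:R)); last first.
  by rewrite sumr_const -[_ *+ _]mulr_natl mulrCA.
apply: ler_sum => z _; rewrite -sumrB.
pose F x := f (x + s) - f x.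
apply: (@le_trans _ _ (\sum_(v in A2) (del / 2 + (F (v - z)) ^+ 2 / (2 * del)))).
  apply: ler_sum => v _; rewrite addr0 /F; set a := f _; set b := f _.
  have e0 : 0 <= ((b - a) + del) ^+ 2 / (2 * del) by rewrite divr_ge0 ?sqr_ge0 // mulr_ge0 // ltW.
  have E : ((b - a) + del) ^+ 2 / (2 * del) =
      (b - a) ^+ 2 / (2 * del) + (b - a) + del / 2 by field; lra.
  lra.
rewrite big_split sumr_const -mulr_suml /=.
have h : \sum_(v in A2) F (v - z) ^+ 2 <= del ^+ 2 * #|A2|%:R.
  apply: le_trans H; rewrite -(sum_shift (fun x => F x ^+ 2) (- z)).
  rewrite [leRHS](bigID (mem A2)) /= lerDl sumr_ge0 // => x _; exact: sqr_ge0.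
have : (\sum_(v in A2) F (v - z) ^+ 2) / (2 * del) <= del * #|A2|%:R / 2.
  rewrite ler_pdivrMr ?mulr_gt0 //; apply: le_trans h _; rewrite expr2; lra.
rewrite -[_ *+ _]mulr_natr; lra.
Qed.

(** [avT] is an average of translates, so a lower bound on a translate of B for the averaged
    function is inherited by f on some translate of B. *)
Lemma iter_avT_extract T B f l (c : R) : (0 < #|T|)%N -> forall y,
  c <= \sum_(s in B) iter l (avT T) f (y + s) ->
  exists y', c <= \sum_(s in B) f (y' + s).
Proof.
move=> T0; have TR : 0 < #|T|%:R :> R by rewrite ltr0n.
elim: l => [|l IH] y H; first by exists y.
have Tp : 0 < #|T|%:R * #|T|%:R :> R by rewrite mulr_gt0.
move: H; rewrite iterS /avT -mulr_suml ler_pdivlMr // exchange_big /=.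
under eq_bigr do rewrite exchange_big /=.
move=> H; have [] := @exists_le R _ (mem T) (fun _ => c * #|T|%:R)
   (fun a => \sum_(b in T) \sum_(s in B) iter l (avT T) f (y + s + a - b)).
- by have /card_gt0P[b bT] := T0; exists b.
- by apply: le_trans H; rewrite sumr_const -[_ *+ _]mulr_natr mulrA.
move=> a _ Ha; have [] := @exists_le R _ (mem T) (fun _ => c)
   (fun b => \sum_(s in B) iter l (avT T) f (y + s + a - b)).
- by have /card_gt0P[b bT] := T0; exists b.
- by apply: le_trans Ha; rewrite sumr_const -[_ *+ _]mulr_natr.
move=> b _ Hb; apply: (IH (y + a - b)); apply: le_trans Hb _.
rewrite le_eqVlt; apply/orP; left; apply/eqP/eq_bigr => s _; congr (iter _ _ _ _).
by rewrite [y + s + a]addrAC [y + a + s - b]addrAC.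
Qed.

Lemma mean2_extract A1 A2 B f (c : R) y : (0 < #|A1|)%N -> (0 < #|A2|)%N ->
  c <= \sum_(s in B) mean2 A1 A2 f (y + s) ->
  exists y', c <= \sum_(s in B) f (y' + s).
Proof.
move=> A10 A20; have a1 : 0 < #|A1|%:R :> R by rewrite ltr0n.
have a2 : 0 < #|A2|%:R :> R by rewrite ltr0n.
have p : 0 < #|A1|%:R * #|A2|%:R :> R by rewrite mulr_gt0.
rewrite /mean2 -mulr_suml ler_pdivlMr // exchange_big /=.
under eq_bigr do rewrite exchange_big /=.
move=> H; have [] := @exists_le R _ (mem A1) (fun _ => c * #|A2|%:R)
   (fun z => \sum_(v in A2) \sum_(s in B) f (v - z + (y + s))).
- by have /card_gt0P[b bT] := A10; exists b.
- by apply: le_trans H; rewrite sumr_const -[_ *+ _]mulr_natr mulrAC mulrA.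
move=> z _ Hz; have [] := @exists_le R _ (mem A2) (fun _ => c)
   (fun v => \sum_(s in B) f (v - z + (y + s))).
- by have /card_gt0P[b bT] := A20; exists b.
- by apply: le_trans Hz; rewrite sumr_const -[_ *+ _]mulr_natr.
move=> v _ Hv; exists (v - z + y); apply: le_trans Hv _.
by rewrite le_eqVlt; apply/orP; left; apply/eqP/eq_bigr => s _; rewrite addrA.
Qed.

End DoubleMean.

(** * From almost periods to a dense translate of a Bohr set *)

Section Smoothing.
Variables (R : realType) (n : nat).
Local Notation q := n.+2.
Local Notation G := 'I_n.+2.

(** Total shrinking of the margin over the five scales of [bohr_almost_period]. Each 8 (rank + 1) m
    pays for a regular radius with ratio 1 + 1/m; 2 (l + 1) leaves room for l differences of almost
    periods, m0 for the averagings of the weight, and 2^(a + 30) m0 for combinations of m0 new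
    frequencies. *)
Definition loss (d a l m0 : nat) : nat :=
  (4 * (8 * d.+1) * (2 * l.+1) * (8 * d.+1) * m0 * (8 * d.+1 * 2 ^ (a + 30))
   * (2 ^ (a + 30) * m0) * (8 * (d + m0).+1 * 1024))%N.

Lemma expRN_nat_le (N : nat) : expR (- N%:R) <= (2 ^+ N)^-1 :> R.
Proof.
rewrite expRN lef_pV2 ?posrE ?expR_gt0 ?exprn_gt0 //.
have -> : N%:R = N%:R * 1 :> R by rewrite mulr1.
rewrite expRM_natl; apply: lerXn2r; rewrite ?nnegrE ?expR_ge0 //.
by have := expR_ge1Dx (1 : R); lra.
Qed.

Lemma natr_le_exp2 (l : nat) : l%:R <= 2 ^+ l :> R.
Proof. by rewrite -natrX ler_nat ltnW // ltn_expl. Qed.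

Lemma exp2_13 : 4 * (2 ^+ 13)^-1 <= 2000^-1 :> R.
Proof. by have -> : 2 ^+ 13 = 8192 :> R; [ring|lra]. Qed.

Lemma exp2_16 : 4 <= 2 ^+ 16 :> R.
Proof. by have -> : 4 = 2 ^+ 2 :> R; [ring|rewrite ler_eXn2l ?ltr1n]. Qed.

Lemma exp2_11 : (2 ^+ 11)^-1 <= 2000^-1 :> R.
Proof. by have -> : 2 ^+ 11 = 2048 :> R; [ring|lra]. Qed.

Lemma exp2_30 : 2 ^+ 30 = 64 * 2 ^+ 24 :> R.
Proof. by have -> : 64 = 2 ^+ 6 :> R; [ring|rewrite -exprD]. Qed.

Lemma low_spec_bound (T : {set G}) (g s : G) (a l : nat) :
  l = (a + 10)%N -> spec R T g < 4^-1 ->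
  spec R T g ^+ (2 * l) * (2 - 2 * ec R (g * s)) <= (2 ^+ a * 2 ^+ 24)^-1.
Proof.
move=> El sg; have s0 := spec_ge0 R T g.
have e2 : 2 - 2 * ec R (g * s) <= 4 by have := ec_geN1 R (g * s); lra.
have e0 : 0 <= 2 - 2 * ec R (g * s) by have := ec_le1 R (g * s); lra.
apply: (@le_trans _ _ (4^-1 ^+ (2 * l) * 4)).
  apply: ler_pM => //; first by rewrite exprn_ge0.
  by apply: lerXn2r; rewrite ?nnegrE // ltW.
have -> : 4^-1 ^+ (2 * l) = (2 ^+ a * 2 ^+ 24)^-1 * (2 ^+ (3 * a + 16))^-1 :> R.
  have -> : 4^-1 = (2 ^+ 2)^-1 :> R by rewrite -natrX.
  by rewrite exprVn -invfM -exprM -!exprD; congr (_ ^-1); congr (_ ^+ _); rewrite El; clear; lia.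
rewrite -mulrA ler_piMr ?invr_ge0 ?mulr_ge0 ?exprn_ge0 //.
rewrite ler_pdivrMl ?exprn_gt0 // mulr1 exprD.
have a1 : 1 <= 2 ^+ (3 * a) :> R by rewrite exprn_ege1 // ler1n.
apply: (@le_trans _ _ (1 * 2 ^+ 16)); first by rewrite mul1r exp2_16.
by rewrite ler_wpM2r // exprn_ge0.
Qed.

Lemma high_spec_bound (T : {set G}) (g s sig : G) (a l m3 : nat) :
  m3%:R = 2 ^+ a * 2 ^+ 30 :> R ->
  1 - ec R ((g + sig) * s) <= 2 / m3%:R -> 1 - ec R (- (sig * s)) <= 8 / m3%:R ->
  spec R T g ^+ (2 * l) * (2 - 2 * ec R (g * s)) <= (2 ^+ a * 2 ^+ 24)^-1.
Proof.
move=> m3E sh ss; have s0 := spec_ge0 R T g.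
have m3R : 0 < m3%:R :> R by rewrite m3E mulr_gt0 // exprn_gt0.
have par := ec_parallelogram R ((g + sig) * s) (- (sig * s)).
have E : (g + sig) * s + - (sig * s) = g * s by ring.
rewrite E in par.
have e0 : 0 <= 2 - 2 * ec R (g * s) by have := ec_le1 R (g * s); lra.
apply: (@le_trans _ _ (2 - 2 * ec R (g * s))).
  by rewrite ler_piMl // exprn_ile1 // spec_le1.
have bd : 2 - 2 * ec R (g * s) <= 40 / m3%:R.
  have -> : 40 / m3%:R = 4 * (2 / m3%:R) + 4 * (8 / m3%:R) :> R by field; rewrite gt_eqF.
  lra.
apply: le_trans bd _; rewrite m3E ler_pdivrMr ?mulr_gt0 ?exprn_gt0 //.
rewrite ler_pdivlMl ?mulr_gt0 ?exprn_gt0 // exp2_30.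
have p24 : 0 <= 2 ^+ a * 2 ^+ 24 :> R by rewrite mulr_ge0 // exprn_ge0.
rewrite [2 ^+ a * (64 * _)]mulrCA; move: (2 ^+ a * 2 ^+ 24) p24 => X; lra.
Qed.

(* The scales r1 >> r2 >> r3 >> r4 >> r5 host, in turn, the set A, its localized
   copy A1, the almost periods T, the weight of the Riesz product argument, and
   the new Bohr set. *)
Lemma bohr_almost_period (L : seq G) (A : {set G}) (S : pred G) (r1 u1 a l k m0 : nat) (kap : R) :
  l = (a + 10)%N -> k%:R = 2 ^+ 29 * l%:R ^+ 2 * (2 * l + 20)%N%:R :> R ->
  m0 = (256 * (4 + a.+1 * k))%N ->
  (u1 <= q)%N -> (#|bohr L (r1 + u1)| <= 2 * #|bohr L r1|)%N ->
  A \subset bohr L r1 ->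
  4 * (2 ^+ a)^-1 * #|bohr L r1|%:R <= #|A|%:R :> R ->
  0 < kap <= 1024^-1 -> bad_pairs R S A A <= kap * (#|A|%:R * #|A|%:R) ->
  exists (L' : seq G) (r' u' : nat) (y : G),
    [/\ (size L' <= size L + m0)%N,
        (1024 * #|bohr L' (r' + u')| <= 1025 * #|bohr L' r'|)%N,
        (u1 %/ loss (size L) a l m0 <= u')%N, (u' <= q)%N &
        199 / 200 * #|bohr L' r'|%:R <= \sum_(s in bohr L' r') (S (y + s))%:R :> R].
Proof.
move=> El Ek Em u1q cX AX dA kap01 badA.
have [d Ed] : exists d, d = size L by exists (size L).
have lam0 : 0 < (2 ^+ a)^-1 :> R by rewrite invr_gt0 exprn_gt0.
have l0 : (0 < l)%N by rewrite El addn_gt0 orbT.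
have lR : 0 < l%:R :> R by rewrite ltr0n.
have k0 : (0 < k)%N.
  by rewrite -(ltr0n R) Ek !mulr_gt0 ?exprn_gt0 // ltr0n addn_gt0 orbT.
have m00 : (0 < m0)%N by rewrite Em muln_gt0.
have [m3 Em3] : exists m3, m3 = (2 ^ (a + 30))%N by exists (2 ^ (a + 30))%N.
have m30 : (0 < m3)%N by rewrite Em3 expn_gt0.
rewrite /loss -Em3 -Ed !divnMA.
set u2 := (u1 %/ 4 %/ 8 %/ d.+1)%N.
set u3 := (u2 %/ 2 %/ l.+1 %/ 8 %/ d.+1)%N.
set u4 := (u3 %/ m0 %/ 8 %/ d.+1 %/ m3)%N.
set u5 := (u4 %/ m3 %/ m0 %/ 8 %/ (d + m0).+1 %/ 1024)%N.
have [r2 [r2a r2b r2c]] : exists rho, [/\ (u1 %/ 4 %/ 2 + u2 <= rho)%N, (rho + u2 <= u1 %/ 4)%N &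
    (1 * #|bohr L (rho + u2)| <= 2 * #|bohr L (rho - u2)|)%N].
  apply: bohr_regular => //; rewrite -Ed muln1 mulnC /u2 -divnMA; exact: leq_trunc_div.
have [r3 [r3a r3b r3c]] : exists rho, [/\ (u2 %/ 2 %/ l.+1 %/ 2 + u3 <= rho)%N,
    (rho + u3 <= u2 %/ 2 %/ l.+1)%N & (1 * #|bohr L (rho + u3)| <= 2 * #|bohr L (rho - u3)|)%N].
  by apply: bohr_regular => //; rewrite -Ed muln1 mulnC /u3 -[(_ %/ 8 %/ _)%N]divnMA leq_trunc_div.
have [r4 [r4a r4b r4c]] : exists rho, [/\ (u3 %/ m0 %/ 2 + u4 <= rho)%N,
    (rho + u4 <= u3 %/ m0)%N & (m3 * #|bohr L (rho + u4)| <= m3.+1 * #|bohr L (rho - u4)|)%N].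
  apply: bohr_regular => //; rewrite -Ed mulnC /u4.
  by rewrite -[(_ %/ 8 %/ _)%N]divnMA -[(_ %/ (8 * _) %/ _)%N]divnMA leq_trunc_div.
rewrite mul1n in r2c; rewrite mul1n in r3c.
have r2u1 : (r2 <= u1)%N.
  by apply: leq_trans (leq_div u1 4); apply: leq_trans r2b; exact: leq_addr.
have c2 : (#|bohr L (r2 + u2)| <= 2 * #|bohr L r2|)%N.
  apply: leq_trans r2c _; rewrite leq_mul2l /=; apply: subset_leq_card.
  by apply: bohr_sub; exact: leq_subr.
have c3 : (#|bohr L (r3 + u3)| <= 2 * #|bohr L r3|)%N.
  apply: leq_trans r3c _; rewrite leq_mul2l /=; apply: subset_leq_card.
  by apply: bohr_sub; exact: leq_subr.
have [||x0 [A1 [A1X' dA1 badA1]]] := @localize R _ A (bohr L r1) (bohr L r2) (bohr L (r1 + u1)) S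
  (4 * (2 ^+ a)^-1) kap AX _ (proj1 (andP kap01)) (bohr_card_gt0 L r1) (bohr_card_gt0 L r2) _ cX dA badA.
- by rewrite mulr_gt0.
- by move=> x z xX zX'; apply: bohr_mono (bohrB xX zX'); rewrite leq_add2l.
have X'R : 0 < #|bohr L r2|%:R :> R by rewrite ltr0n bohr_card_gt0.
have XR : 0 < #|bohr L r1|%:R :> R by rewrite ltr0n bohr_card_gt0.
have lamE : 4 * (2 ^+ a)^-1 / 4 = (2 ^+ a)^-1 :> R by field; rewrite expf_neq0.
rewrite lamE in dA1.
have A1R : 0 < #|A1|%:R :> R by apply: lt_le_trans dA1; rewrite mulr_gt0.
have AR : 0 < #|A|%:R :> R by apply: lt_le_trans dA; rewrite !mulr_gt0.
have A10 : (0 < #|A1|)%N by rewrite -(ltr0n R).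
have A0 : (0 < #|A|)%N by rewrite -(ltr0n R).
have dA' : (2 ^+ a)^-1 * #|bohr L r1|%:R <= #|A|%:R :> R.
  by have := mulr_gt0 lam0 XR; lra.
(* The cut-off is satisfied by all differences between A1 and A, and it makes the l2 norm of [s1]
   comparable to |A|, as [mean2_shift] needs. *)
pose S1 : pred G := fun u => S (u - x0) && (u \in bohr L (r1 + u1)).
pose s1 (x : G) : R := (S1 x)%:R.
have psi0 : 1 - 2 * kap <= mean2 A1 A s1 0.
  rewrite ler_pdivlMr ?mulr_gt0 //.
  have -> : \sum_(z in A1) \sum_(v in A) s1 (v - z + 0) =
     #|A1|%:R * #|A|%:R - bad_pairs R (fun u => S (u - x0)) A1 A.
    have -> : #|A1|%:R * #|A|%:R = \sum_(z in A1) \sum_(v in A) 1 :> R.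
      by rewrite !sumr_const mulr_natl.
    rewrite /bad_pairs -sumrB; apply: eq_bigr => z zA1; rewrite -sumrB.
    apply: eq_bigr => v vA; rewrite addr0 /s1 /S1.
    have -> : v - z \in bohr L (r1 + u1).
      apply: bohr_mono (bohrB (fintype.subsetP AX _ vA) (fintype.subsetP A1X' _ zA1)).
      by rewrite leq_add2l.
    by rewrite andbT; case: (S _); rewrite ?subr0 ?subrr.
  lra.
have r3l : (2 * l.+1 * r3 <= u2)%N.
  have h : (r3 <= u2 %/ (2 * l.+1))%N by rewrite divnMA; apply: leq_trans r3b; exact: leq_addr.
  by apply: leq_trans (leq_trunc_div u2 (2 * l.+1)); rewrite mulnC leq_mul2r h orbT.
have r3u1 : (r3 <= u1)%N.
  apply: leq_trans (_ : u2 <= _)%N; first by apply: leq_trans r3l; exact: leq_pmull.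
  by apply: leq_trans (leq_div u1 4); apply: leq_trans r2b; exact: leq_addl.
(* The l averaging steps will cost l * 2 (eps + eps) = 4 / 2^13 in total. The value of k is chosen
   so that k eps^2 / 8 = 2 l + 20, which makes the share of exceptional points at most eps too. *)
have [eps Eeps] : exists eps : R, eps = (2 ^+ 13 * l%:R)^-1 by exists (2 ^+ 13 * l%:R)^-1.
have eps0 : 0 < eps by rewrite Eeps invr_gt0 mulr_gt0 // exprn_gt0.
have epsl : eps * l%:R = (2 ^+ 13)^-1 by rewrite Eeps invfM divfK ?gt_eqF.
have eps1 : eps <= 1.
  rewrite Eeps invf_le1 ?mulr_gt0 ?exprn_gt0 //.
  by rewrite mulr_ege1 ?exprn_ege1 ?ler1n //; lra.
have [||T [U [TB U01 cT goodT]]] := @croot_sisask R _ A (bohr L r1) (bohr L (r1 + u1))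
   (bohr L r3) (bohr L (r2 + u2)) S1 (2 ^+ a)^-1 eps k k0 (bohr_card_gt0 L r1)
   (bohr_card_gt0 L r3) (bohr_card_gt0 L _) lam0 _ _ cX dA'.
- by rewrite eps0.
- move=> v b vA bB; apply: bohr_mono (bohrD (fintype.subsetP AX _ vA) bB).
  by rewrite leq_add2l.
have Bl : 0 < #|bohr L r3|%:R :> R by rewrite ltr0n bohr_card_gt0.
have cT' : (2 * 2 ^+ (a.+1 * k))^-1 * #|bohr L r3|%:R <= #|T|%:R :> R.
  apply: le_trans cT; rewrite le_eqVlt; apply/orP; left; apply/eqP; congr (_ * _).
  have E : (2 ^+ a)^-1 / 2 = (2 ^+ a.+1)^-1 :> R by rewrite exprS invfM mulrC.
  by rewrite E exprVn -exprM invfM.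
have TR : 0 < #|T|%:R :> R.
  by apply: lt_le_trans cT'; rewrite mulr_gt0 // invr_gt0 mulr_gt0 // exprn_gt0.
have T0 : (0 < #|T|)%N by rewrite -(ltr0n R).
set th := 4 * expR _ * _ in goodT.
have thA1 : th / #|A1|%:R <= eps.
  have Eexp : k%:R * eps ^+ 2 / 8 = (2 * l + 20)%N%:R.
    by rewrite Ek Eeps; field; rewrite gt_eqF.
  have ex : expR (- (k%:R * eps ^+ 2 / 8)) <= (2 ^+ (2 * l + 20))^-1.
    by rewrite Eexp; exact: expRN_nat_le.
  have Om : #|bohr L (r2 + u2)|%:R <= 2 * (2 ^+ a * #|A1|%:R) :> R.
    apply: (@le_trans _ _ (2 * #|bohr L r2|%:R)); first by rewrite -natrM ler_nat.
    by rewrite ler_pM2l // -ler_pdivrMl ?exprn_gt0.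
  rewrite ler_pdivrMr // /th; apply: (@le_trans _ _
    (4 * (2 ^+ (2 * l + 20))^-1 * (2 * (2 ^+ a * #|A1|%:R)))).
    by apply: ler_pM => //; rewrite ?mulr_ge0 ?expR_ge0 // ler_pM2l.
  have -> : 4 * (2 ^+ (2 * l + 20))^-1 * (2 * (2 ^+ a * #|A1|%:R)) =
     (2 ^+ 3 * 2 ^+ a * (2 ^+ (2 * l + 20))^-1) * #|A1|%:R :> R by ring.
  rewrite ler_pM2r // Eeps ler_pdivrMr ?exprn_gt0 // ler_pdivlMl ?mulr_gt0 ?exprn_gt0 //.
  have -> : 2 ^+ (2 * l + 20) = 2 ^+ 13 * 2 ^+ l * (2 ^+ 3 * 2 ^+ (l + 4)) :> R.
    by rewrite -!exprD; congr (_ ^+ _); clear; lia.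
  apply: ler_pM; rewrite ?mulr_ge0 ?exprn_ge0 //.
    by rewrite ler_pM2l ?exprn_gt0 // natr_le_exp2.
  rewrite ler_pM2l ?exprn_gt0 // ler_eXn2l ?ltr1n // El; clear; lia.
have phi01 x : 0 <= hits R A S1 x <= 1 by rewrite hits_ge0 hits_le1.
have low := @iter_avT_lower R _ A1 T (bohr L (r2 + u2)) (hits R A S1) U eps th phi01 U01
  (ltW eps0) A10 T0 goodT (fun j => bohr L (j * (2 * r3))%N) l.
have {low} low : mean2 A1 A s1 0 - 2000^-1 <=
    iter l (avT T) (mean2 A1 A s1) 0.
  have E0 : mean2 A1 A s1 0 = avg1 A1 (hits R A S1) 0.
    exact: esym (avg1_hits R A1 A S1 0).
  have E1 : iter l (avT T) (mean2 A1 A s1) 0 =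
      iter l (avT T) (avg1 A1 (hits R A S1)) 0.
    exact: esym (iter_avT_ext T l (@avg1_hits R _ A1 A S1) 0).
  rewrite E0 E1.
  apply: le_trans (low _ _ l 0%N 0 _ _).
  - rewrite lerD2l lerN2.
    apply: (@le_trans _ _ (l%:R * (2 * (eps + eps)))).
      by rewrite ler_pM2l // ler_pM2l // lerD2l.
    have -> : l%:R * (2 * (eps + eps)) = 4 * (eps * l%:R) by ring.
    by rewrite epsl; exact: exp2_13.
  - move=> j s x y sD xT yT; rewrite -addrA; apply: bohr_mono (bohrD sD
      (bohrB (fintype.subsetP TB _ xT) (fintype.subsetP TB _ yT))).
    by rewrite (mulSnr j) leq_add2l mul2n addnn.
  - move=> j s z jl sD zA1; apply: bohr_mono (bohrB sD (fintype.subsetP A1X' _ zA1)).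
    rewrite addnC leq_add2l; apply: leq_trans r3l.
    by rewrite mulnCA mulnA leq_mul2r leq_mul2l /= ltnW ?orbT.
  - by rewrite add0n.
  - by rewrite mul0n bohr0.
have r4m : (m0 * r4 <= u3)%N.
  have h : (r4 <= u3 %/ m0)%N by apply: leq_trans r4b; exact: leq_addr.
  by apply: leq_trans (leq_trunc_div u3 m0); rewrite mulnC leq_mul2r h orbT.
(* Decreasing from the radius r3 + m0 r4 to r3, one averaging over [bohr L r4] at a time; past m0
   the family is empty, so that its inclusion property holds for every j. *)
pose D j := if (j <= m0)%N then bohr L (r3 + (m0 - j) * r4)%N else finset.set0.
have [||||L1 [sL1 HL1]] := @chang R n T (bohr L r4) D m0 #|bohr L r3|%:R
   (bohrN L r4) (bohr_card_gt0 L r4) T0.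
- move=> j x y; rewrite /D; case: ifP => [jm xD yB|_]; last by rewrite inE.
  rewrite ltnW //; apply: bohr_mono (bohrD xD yB).
  by rewrite -addnA leq_add2l -mulSnr subnSK.
- by rewrite /D leqnn subnn mul0n addn0.
- rewrite /D leq0n subn0 -natrM ler_nat; apply: leq_trans c3.
  by apply: subset_leq_card; apply: bohr_sub; rewrite leq_add2l.
(* Origin of m0: exp(m0/256) >= 2^(4 + (a + 1) k) outweighs the density 2^(-1 - (a + 1) k) of T by a
   factor 8, and 8 > 4. *)
- have -> : m0%:R / 256 = (4 + a.+1 * k)%N%:R :> R.
    by rewrite Em natrM mulrC mulKf // pnatr_eq0.
  have e2 : 2 ^+ (4 + a.+1 * k) <= expR (4 + a.+1 * k)%N%:R :> R.
    have := expRN_nat_le (4 + a.+1 * k); rewrite expRN lef_pV2 //.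
      by rewrite posrE expR_gt0.
    by rewrite posrE exprn_gt0.
  apply: lt_le_trans (ler_pM _ _ cT' e2); last 2 first.
  + by rewrite mulr_ge0 // invr_ge0 mulr_ge0 // exprn_ge0.
  + by rewrite exprn_ge0.
  have -> : (2 * 2 ^+ (a.+1 * k))^-1 * #|bohr L r3|%:R * 2 ^+ (4 + a.+1 * k) =
      8 * #|bohr L r3|%:R :> R.
    by rewrite exprD; field; rewrite expf_neq0.
  by clear -Bl; lra.
have [r5 [r5a r5b r5c]] : exists rho, [/\ (u4 %/ m3 %/ m0 %/ 2 + u5 <= rho)%N,
    (rho + u5 <= u4 %/ m3 %/ m0)%N &
    (1024 * #|bohr (L ++ L1) (rho + u5)| <= 1025 * #|bohr (L ++ L1) (rho - u5)|)%N].
  apply: bohr_regular => //; apply: leq_trans (leq_trunc_div (u4 %/ m3 %/ m0) (8 * (d + m0).+1 * 1024)).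
  rewrite mulnC [leqRHS]mulnC.
  have -> : (u4 %/ m3 %/ m0 %/ (8 * (d + m0).+1 * 1024))%N = u5 by rewrite /u5 !divnMA.
  rewrite [leqRHS]mulnC leq_mul2l; apply/orP; right.
  by rewrite leq_mul2r leq_mul2l /= ltnS size_cat -Ed leq_add2l sL1.
have u4q : (u4 <= q)%N.
  apply: leq_trans u1q; apply: leq_trans (_ : u3 <= _)%N.
    by rewrite /u4; do 3 (apply: leq_trans (leq_div _ _) _); exact: leq_div.
  by rewrite /u3 /u2; do 6 (apply: leq_trans (leq_div _ _) _); exact: leq_div.
have r5u4 : (r5 <= u4)%N.
  apply: (@leq_trans (u4 %/ m3 %/ m0)); first by apply: leq_trans r5b; exact: leq_addr.
  by rewrite -divnMA; exact: leq_div.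
exists (L ++ L1), r5, u5.
suff [y Hy] : exists y, 199 / 200 * #|bohr (L ++ L1) r5|%:R <=
    \sum_(s in bohr (L ++ L1) r5) (S (y + s))%:R :> R.
  exists y; split => //.
  - by rewrite size_cat -Ed leq_add2l.
  - apply: leq_trans r5c _; rewrite leq_mul2l /=; apply: subset_leq_card.
    by apply: bohr_sub; exact: leq_subr.
  - apply: leq_trans u4q; apply: (@leq_trans (u4 %/ m3 %/ m0)).
      by apply: leq_trans r5b; exact: leq_addl.
    by rewrite -divnMA; exact: leq_div.
have qR : 0 < q%:R :> R by rewrite ltr0n.
have m3R : 0 < m3%:R :> R by rewrite ltr0n.
have m3E : m3%:R = 2 ^+ a * 2 ^+ 30 :> R by rewrite Em3 natrX exprD.
(* A frequency with small [spec] is damped by the l averagings. For any other, g = (g + sig) - sig: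
   the first part is large on the regular set [bohr L r4], hence nearly trivial at s, and sig
   combines at most m0 new frequencies, each of them small at s. *)
have specbd s g : s \in bohr (L ++ L1) r5 ->
    spec R T g ^+ (2 * l) * (2 - 2 * ec R (g * s)) <= (2 ^+ a * 2 ^+ 24)^-1.
  rewrite bohr_cat => /andP[sL sL1'].
  have [sg|sg] := ltP (spec R T g) 4^-1; first exact: low_spec_bound.
  have [sig sigL Hsig] := HL1 _ sg.
  have sh : 1 - ec R ((g + sig) * s) <= 2 / m3%:R.
    have sU : s \in bohr L u4 by exact: bohr_mono sL.
    apply: (le_trans (specB_shift (bohr_card_gt0 L r4) (Bin := bohr L (r4 - u4))
      (Bout := bohr L (r4 + u4)) _ _ _ _ Hsig)).
    - by apply: bohr_sub; exact: leq_subr.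
    - by apply: bohr_sub; exact: leq_addr.
    - move=> x xB; have h : (r4 - u4 + u4 <= r4)%N.
        by rewrite subnK //; apply: leq_trans r4a; exact: leq_addl.
      by split; apply: bohr_mono h _; [apply: bohrD|apply: bohrB].
    - by move=> x xB; split; [apply: bohrD|apply: bohrB].
    rewrite ler_pM2l // ler_pdivrMr ?ltr0n ?bohr_card_gt0 // ler_pdivlMl //.
    have h1 : m3%:R * #|bohr L (r4 + u4)|%:R <= (m3%:R + 1) * #|bohr L (r4 - u4)|%:R :> R.
      by rewrite natr1 -!natrM ler_nat.
    have h2 : #|bohr L (r4 - u4)|%:R <= #|bohr L r4|%:R :> R.
      by rewrite ler_nat subset_leq_card // bohr_sub // leq_subr.
    by clear -h1 h2; lra.
  have ss : 1 - ec R (- (sig * s)) <= 8 / m3%:R.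
    rewrite ecN; apply: le_trans (ec_nrm R _) _.
    have nb : (nrm (sig * s)%R * m3 <= q)%N.
      have h : (nrm (sig * s)%R <= m0 * r5)%N.
        apply: leq_trans (leq_mul sL1 (leqnn r5)); apply: combos_nrm sigL => b bL1.
        by move: sL1'; rewrite inE => /allP; apply.
      apply: (@leq_trans (m0 * r5 * m3)); first by rewrite leq_mul2r h orbT.
      apply: leq_trans u4q.
      have h5 : (r5 <= u4 %/ (m3 * m0))%N by rewrite divnMA; apply: leq_trans r5b; exact: leq_addr.
      apply: leq_trans (leq_trunc_div u4 (m3 * m0)).
      by rewrite mulnC [leqRHS]mulnC mulnA leq_mul2l h5 orbT.
    have nbR : (nrm (sig * s)%R)%:R * m3%:R <= q%:R :> R by rewrite -natrM ler_nat.
    by rewrite -!mulrA ler_pM2l // ler_pdivrMr // ler_pdivlMl // mulrC.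
  exact: high_spec_bound m3E sh ss.
pose F := iter l (avT T) s1.
have sumS1 : \sum_x s1 x ^+ 2 <= 2 * (2 ^+ a * #|A|%:R) :> R.
  apply: (@le_trans _ _ #|bohr L (r1 + u1)|%:R).
    rewrite -(sum_ind R); apply: ler_sum => x _; rewrite /ind /s1 /S1.
    by case: (x \in _); case: (S _); rewrite ?expr1n ?expr0n.
  apply: (@le_trans _ _ (2 * #|bohr L r1|%:R)); first by rewrite -natrM ler_nat.
  by rewrite ler_pM2l // -ler_pdivrMl ?exprn_gt0.
have step s : s \in bohr (L ++ L1) r5 ->
    199 / 200 <= iter l (avT T) (mean2 A1 A s1) (0 + s).
  move=> sB; rewrite add0r iter_avT_mean2 -/F.
  rewrite iter_avT_mean2 -/F in low.
  have d0 : 0 < (2 ^+ 11)^-1 :> R by rewrite invr_gt0 exprn_gt0.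
  have d1 := exp2_11.
  have := @mean2_shift R _ A1 A F s (2 ^+ 11)^-1 d0 A10 A0.
  have -> : \sum_x (F (x + s) - F x) ^+ 2 <= (2 ^+ 11)^-1 ^+ 2 * #|A|%:R.
    apply: le_trans (smooth_shift_l2 s1 (fun g => specbd s g sB)) _.
    apply: (@le_trans _ _ ((2 ^+ a * 2 ^+ 24)^-1 * (2 * (2 ^+ a * #|A|%:R)))).
      by rewrite ler_pM2l // invr_gt0 mulr_gt0 // exprn_gt0.
    have -> : (2 ^+ a * 2 ^+ 24)^-1 * (2 * (2 ^+ a * #|A|%:R)) = (2 ^+ 23)^-1 * #|A|%:R :> R.
      have -> : 2 ^+ 24 = 2 * 2 ^+ 23 :> R by rewrite exprS.
      by field; rewrite !expf_neq0.
    rewrite ler_pM2r // exprVn -exprM lef_pV2 ?posrE ?exprn_gt0 //.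
    by rewrite ler_eXn2l ?ltr1n.
  move=> /(_ isT) H; move/andP: kap01 => [_ kap1]; clear -H kap1 d1 low psi0; lra.
have := @iter_avT_extract R _ T (bohr (L ++ L1) r5) (mean2 A1 A s1) l
  (199 / 200 * #|bohr (L ++ L1) r5|%:R) T0 0.
have -> : 199 / 200 * #|bohr (L ++ L1) r5|%:R <= \sum_(s in bohr (L ++ L1) r5)
    iter l (avT T) (mean2 A1 A s1) (0 + s) :> R.
  rewrite mulr_natr -sumr_const; apply: ler_sum => s; exact: step.
move=> /(_ isT)[y1 /(mean2_extract A10 A0)[y2 Hy2]].
exists (y2 - x0); apply: le_trans Hy2 _; apply: ler_sum => s _.
by rewrite /s1 /S1 [y2 - x0 + s]addrAC; case: (S _); case: (_ \in _).
Qed.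

End Smoothing.

(** * Density increment *)

Section Increment.
Variables (R : realType) (n : nat).
Local Notation q := n.+2.
Local Notation G := 'I_n.+2.
Implicit Types (L : seq G) (f : G -> R) (A B : {set G}).

Lemma bohr_cover L r u s f : (forall x, 0 <= f x) -> s \in bohr L u ->
  \sum_(t in bohr L r) f t <= \sum_(t in bohr L (r + u)) f (t + s).
Proof.
move=> f0 sB; rewrite (reindex_inj (addIr s)) /=.
rewrite big_mkcond [leRHS]big_mkcond; apply: ler_sum => t _.
case: ifP => [tB|_]; last by case: ifP.
by have := bohrB tB sB; rewrite addrK => ->.
Qed.

(** By regularity the two densities [F1] and [F2] average at least 1024/1025 al each, while the
    absence of an increment caps both at 401/400 al. Where their sum reaches its average, each is at
    least (2048/1025 - 401/400) al > 199/200 al. *)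
Lemma good_centre L r u (B0 B1 : {set G}) f x0 (al : R) :
  (forall x, 0 <= f x) -> 0 < al ->
  (1024 * #|bohr L (r + u)| <= 1025 * #|bohr L r|)%N ->
  al * #|bohr L r|%:R <= \sum_(s in bohr L r) f (x0 + s) ->
  (0 < #|B0|)%N -> (0 < #|B1|)%N -> B0 \subset bohr L u ->
  (forall y y', y \in B1 -> y' \in B1 -> y' - y \in bohr L u) ->
  (forall x, \sum_(s in B0) f (x + s) <= 401 / 400 * al * #|B0|%:R) ->
  (forall x, \sum_(s in B1) f (x + s) <= 401 / 400 * al * #|B1|%:R) ->
  exists c, 199 / 200 * al * #|B0|%:R <= \sum_(s in B0) f (c + s) /\
    199 / 200 * al * #|B1|%:R ^+ 2 <= \sum_(y in B1) \sum_(y' in B1) f (c + (y' - y)).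
Proof.
move=> f0 al0 reg dens B00 B10 B0u B1u up0 up1.
have b0 : 0 < #|B0|%:R :> R by rewrite ltr0n.
have b1 : 0 < #|B1|%:R :> R by rewrite ltr0n.
have br : 0 < #|bohr L r|%:R :> R by rewrite ltr0n bohr_card_gt0.
pose F1 t := (\sum_(s in B0) f (x0 + t + s)) / #|B0|%:R.
pose F2 t := (\sum_(y in B1) \sum_(y' in B1) f (x0 + t + (y' - y))) / #|B1|%:R ^+ 2.
have cov s : s \in bohr L u ->
    al * #|bohr L r|%:R <= \sum_(t in bohr L (r + u)) f (x0 + t + s).
  move=> sB; apply: le_trans dens _.
  apply: le_trans (bohr_cover r (f := fun t => f (x0 + t)) _ sB) _ => //.
  by rewrite le_eqVlt; apply/orP; left; apply/eqP/eq_bigr => t _; rewrite addrA.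
have S1 : al * #|bohr L r|%:R <= \sum_(t in bohr L (r + u)) F1 t.
  rewrite -mulr_suml exchange_big /= ler_pdivlMr // [leLHS]mulr_natr -sumr_const.
  by apply: ler_sum => s sB; apply: cov; exact: (fintype.subsetP B0u).
have S2 : al * #|bohr L r|%:R <= \sum_(t in bohr L (r + u)) F2 t.
  rewrite -mulr_suml exchange_big /= ler_pdivlMr ?exprn_gt0 // expr2 mulrA [leLHS]mulr_natr -sumr_const.
  apply: ler_sum => y yB; rewrite exchange_big /= [leLHS]mulr_natr -sumr_const.
  by apply: ler_sum => y' y'B; apply: cov; exact: B1u.
have [] := @exists_le R _ (mem (bohr L (r + u)))
  (fun _ => 2 * (1024 / 1025) * al) (fun t => F1 t + F2 t).
- by exists 0; exact: bohr0.
- rewrite big_split sumr_const /= -[_ *+ _]mulr_natr.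
  have regR : 1024 * #|bohr L (r + u)|%:R <= 1025 * #|bohr L r|%:R :> R.
    by rewrite -!natrM ler_nat.
  have := ler_wpM2l (ltW al0) regR; lra.
move=> t _ Ht; exists (x0 + t).
have U1 : F1 t <= 401 / 400 * al by rewrite ler_pdivrMr.
have U2 : F2 t <= 401 / 400 * al.
  rewrite ler_pdivrMr ?exprn_gt0 // expr2 mulrA [leRHS]mulr_natr -sumr_const.
  apply: ler_sum => y _; apply: le_trans (up1 (x0 + t - y)).
  rewrite le_eqVlt; apply/orP; left; apply/eqP/eq_bigr => y' _.
  by rewrite addrA addrAC.
split.
  have : 199 / 200 * al <= F1 t by lra.
  by rewrite ler_pdivlMr.
have : 199 / 200 * al <= F2 t by lra.
by rewrite ler_pdivlMr ?exprn_gt0.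
Qed.

(** A sparse f might concentrate near the boundary, so the small size of the boundary is not enough.
    The upper bound on translates of the small Bohr set, summed over the slightly thickened
    boundary, excludes this. *)
Lemma boundary_mass L r0 u0 r1 f (b : R) : (forall x, 0 <= f x) -> 0 <= b ->
  (8 * r1 <= u0)%N -> (u0 <= r0)%N ->
  (1024 * #|bohr L (r0 + u0)| <= 1025 * #|bohr L (r0 - u0)|)%N ->
  (forall x, \sum_(s in bohr L r1) f (x + s) <= b * #|bohr L r1|%:R) ->
  \sum_(x in bohr L r0 | x \notin bohr L (r0 - 4 * r1)) f x <= b / 1024 * #|bohr L r0|%:R.
Proof.
move=> f0 b0 r1u u0r0 reg up.
have B1 : 0 < #|bohr L r1|%:R :> R by rewrite ltr0n bohr_card_gt0.
pose E := bohr L (r0 + u0) :\: bohr L (r0 - u0).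
have cE : #|E|%:R <= 1024^-1 * #|bohr L r0|%:R :> R.
  have sub : bohr L (r0 - u0) \subset bohr L (r0 + u0).
    by apply: bohr_sub; apply: leq_trans (leq_subr _ _) (leq_addr _ _).
  have := cardsID (bohr L (r0 - u0)) (bohr L (r0 + u0)).
  rewrite (finset.setIidPr sub) -/E => EE.
  have EE' : #|bohr L (r0 + u0)|%:R = #|bohr L (r0 - u0)|%:R + #|E|%:R :> R.
    by rewrite -natrD EE.
  have regR : 1024 * #|bohr L (r0 + u0)|%:R <= 1025 * #|bohr L (r0 - u0)|%:R :> R.
    by rewrite -!natrM ler_nat.
  have sub2 : #|bohr L (r0 - u0)|%:R <= #|bohr L r0|%:R :> R.
    by rewrite ler_nat subset_leq_card // bohr_sub // leq_subr.
  lra.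
rewrite -(ler_pM2r B1).
apply: (@le_trans _ _ (\sum_(y in E) \sum_(s in bohr L r1) f (y + s))); last first.
  apply: (@le_trans _ _ (\sum_(y in E) b * #|bohr L r1|%:R)).
    by apply: ler_sum => y _; exact: up.
  rewrite sumr_const -[_ *+ _]mulr_natr.
  have := ler_wpM2l (mulr_ge0 b0 (ltW B1)) cE; lra.
rewrite exchange_big /= [leLHS]mulr_natr -sumr_const; apply: ler_sum => s sB.
rewrite (reindex_inj (addIr s)) /= big_mkcond [leRHS]big_mkcond; apply: ler_sum => y _.
case: ifP => [/andP[h1 h2]|_]; last by case: ifP.
suff -> : y \in E by [].
rewrite finset.in_setD; apply/andP; split.
  apply: contra h2 => h3; apply: bohr_mono (bohrD h3 sB).
  by clear -r1u u0r0; lia.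
have := bohrB h1 sB; rewrite addrK; apply: bohr_mono.
by clear -r1u u0r0; lia.
Qed.

End Increment.

(** * One round of the density increment *)

Section IncrementStep.
Variables (R : realType) (n : nat).
Local Notation q := n.+2.
Local Notation G := 'I_n.+2.
Hypothesis oddq : odd q.
Implicit Types (L : seq G) (A B : {set G}).

Definition ap_free A :=
  forall x y z, x \in A -> y \in A -> z \in A -> x + z = y + y -> x = y.

Lemma halveE L r : bohr (halve L) r = [set y + y | y in bohr L r].
Proof.
apply/setP => x; apply/idP/imsetP => [/(bohr_halve_dbl oddq)[y yB ->]|[y yB ->]].
  by exists y.
by rewrite bohr_halve.
Qed.

Lemma sum_halve L r (F : G -> R) :
  \sum_(z in bohr (halve L) r) F z = \sum_(y in bohr L r) F (y + y).
Proof. by rewrite halveE big_imset //= => x y _ _; exact: dbl_inj. Qed.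

Lemma card_halve L r : #|bohr (halve L) r| = #|bohr L r|.
Proof. by rewrite halveE card_imset //; exact: dbl_inj. Qed.

Lemma halve_sub L r z : z \in bohr (halve L) r -> z \in bohr L (r + r).
Proof. by move=> /(bohr_halve_dbl oddq)[y yB ->]; apply: bohrD. Qed.

Lemma sum_in_ind A B : \sum_(s in B) ind R A s = #|A :&: B|%:R.
Proof.
rewrite -sum1_card natr_sum [RHS](eq_bigl (fun s => (s \in B) && (s \in A))).
  by rewrite [RHS]big_mkcondr; apply: eq_bigr => s _; rewrite /ind; case: ifP.
by move=> s; rewrite inE andbC.
Qed.

(** A representation of 2b as a sum of two elements of A0 is a progression with middle term b, hence
    trivial. *)
Lemma conv_ap_free A A0 (b : G) : ap_free A -> A0 \subset A -> b \in A ->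
  conv (ind R A0) (b + b) <= 1.
Proof.
move=> apf A0A bA; rewrite /conv (bigD1 b) //= big1 => [|p pb].
  by rewrite addr0 mulr_ile1 ?ind_ge0 ?ind_le1.
apply/eqP; rewrite mulf_eq0 /ind !pnatr_eq0 !eqb0 -negb_and; apply: contraNN pb.
move=> /andP[pA p'A]; apply/eqP; apply: (apf p b (b + b - p)) => //.
- exact: (fintype.subsetP A0A).
- exact: (fintype.subsetP A0A).
- by rewrite addrC subrK.
Qed.

(** [moment_sift] with X the dilate by 2 of [bohr L r1]: differences in X are 2b with b = y' - y,
    and b falls in [At] for a proportion about [al] of the pairs. There the convolution is at most
    1, and the size of [bohr L r0] ensures 1 <= c0/4. *)
Lemma bohr_sift L r0 u0 r1 (At : {set G}) D (al : R) :
  let A0 := At :&: bohr L r0 in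
  let al0 : R := #|A0|%:R / #|bohr L r0|%:R in
  let c0 := al0 * #|A0|%:R in
  ap_free At -> (8 * r1 <= u0)%N -> (u0 <= r0)%N ->
  (1024 * #|bohr L (r0 + u0)| <= 1025 * #|bohr L (r0 - u0)|)%N ->
  (forall x, \sum_(s in bohr L r1) ind R At (x + s) <= 401 / 400 * al * #|bohr L r1|%:R) ->
  (2 ^+ D)^-1 <= al ->
  199 / 200 * al * #|bohr L r0|%:R <= #|A0|%:R ->
  199 / 200 * al * #|bohr L r1|%:R ^+ 2 <=
    \sum_(y in bohr L r1) \sum_(y' in bohr L r1) ind R At (y' - y) ->
  (4 ^ (D + 2) <= #|bohr L r0|)%N ->
  exists A' : {set G}, [/\ A' \subset bohr (halve L) r1,
    (al0 / 2) ^+ (65 * (2 * (D + 4))) * #|bohr (halve L) r1|%:R <= #|A'|%:R &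
    bad_pairs R (fun u => 65 / 64 * c0 <= corr (ind R A0) u) A' A' <=
      2 * (4 ^+ (2 * (D + 4)))^-1 * (#|A'|%:R * #|A'|%:R)].
Proof.
move=> A0 al0 c0 apf r1u u0r0 reg up1 alD lo0 lo1 big.
(* Even, at least 8, and large enough for 2^(-P) <= 199/200 al. *)
have [P EP] : exists P, P = (2 * (D + 4))%N by exists (2 * (D + 4))%N.
rewrite -EP.
have al_gt0 : 0 < al by apply: lt_le_trans alD; rewrite invr_gt0 exprn_gt0.
have B0 : 0 < #|bohr L r0|%:R :> R by rewrite ltr0n bohr_card_gt0.
have A0R : 0 < #|A0|%:R :> R by have := mulr_gt0 al_gt0 B0; clear -lo0; lra.
have A0gt : (0 < #|A0|)%N by rewrite -(ltr0n R).
have A0B : A0 \subset bohr L r0 by exact: finset.subsetIr.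
have A0At : A0 \subset At by exact: finset.subsetIl.
have inner : (bohr L (r0 - 4 * r1) \subset bohr L r0) by apply: bohr_sub; exact: leq_subr.
have regR : 1024 * #|bohr L (r0 + u0)|%:R <= 1025 * #|bohr L (r0 - u0)|%:R :> R.
  by rewrite -!natrM ler_nat.
have big0 : #|bohr L r0|%:R <= #|bohr L (r0 + u0)|%:R :> R.
  by rewrite ler_nat subset_leq_card // bohr_sub // leq_addr.
have sub4 : (r0 - u0 <= r0 - 4 * r1)%N by clear -r1u u0r0; lia.
have in1 : #|bohr L (r0 - u0)|%:R <= #|bohr L (r0 - 4 * r1)|%:R :> R.
  by rewrite ler_nat subset_leq_card // bohr_sub.
have in2 : #|bohr L (r0 - u0)|%:R <= #|bohr L r0|%:R :> R.
  by rewrite ler_nat subset_leq_card // bohr_sub // leq_subr.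
have bm : \sum_(x in bohr L r0 | x \notin bohr L (r0 - 4 * r1)) ind R At x <= 64^-1 * #|A0|%:R.
  have pos : 0 <= 401 / 400 * al by clear -al_gt0; lra.
  apply: le_trans (boundary_mass (ind_ge0 R At) pos r1u u0r0 reg up1) _.
  by clear -lo0 al_gt0 B0; move: (mulr_gt0 al_gt0 B0); lra.
have inA : 63 / 64 * #|A0|%:R <= \sum_y ind R A0 y * ind R (bohr L (r0 - 4 * r1)) y.
  have E : #|A0|%:R = \sum_y ind R A0 y * ind R (bohr L (r0 - 4 * r1)) y +
     \sum_(x in bohr L r0 | x \notin bohr L (r0 - 4 * r1)) ind R At x.
    rewrite -(sum_ind R) [X in _ + X]big_mkcond -big_split /=; apply: eq_bigr => x _.
    rewrite /ind inE; case: (boolP (x \in bohr L (r0 - 4 * r1))) => [xi|xi].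
      by rewrite (fintype.subsetP inner _ xi) /= andbT mulr1 addr0.
    rewrite mulr0 add0r andbT; case: (x \in bohr L r0); rewrite ?andbT ?andbF //.
  by clear -E bm; lra.
have XX u z v : z \in bohr (halve L) r1 -> v \in bohr (halve L) r1 -> u = v - z ->
    u \in bohr L (4 * r1).
  move=> zX vX ->; apply: bohr_mono (bohrB (halve_sub vX) (halve_sub zX)).
  by clear; lia.
have le4 : (r0 - 4 * r1 + 4 * r1 <= r0)%N by clear -r1u u0r0; lia.
apply: (@moment_sift R _ A0 (bohr L r0) (bohr (halve L) r1) (bohr L (r0 + u0)) P).
- exact: A0B.
- exact: A0gt.
- exact: bohr_card_gt0.
- exact: bohrN.
- by rewrite EP oddM.
- by rewrite EP; clear; lia.
- move=> z v zX vX; have uX := XX _ _ _ zX vX erefl; split.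
    apply: le_trans inA _; apply: ler_sum => y _; rewrite ler_wpM2l ?ind_ge0 //.
    rewrite /ind; case: (boolP (y \in bohr L (r0 - 4 * r1))) => // yi.
    by rewrite (bohr_mono le4 (bohrD yi uX)).
  apply: (@le_trans _ _ #|bohr L (r0 - 4 * r1)|%:R).
    by clear -regR big0 in1 B0; lra.
  rewrite -(sum_ind R); apply: ler_sum => y _.
  rewrite /ind; case: (boolP (y \in bohr L (r0 - 4 * r1))) => yi; last by rewrite mulr_ge0.
  by rewrite (fintype.subsetP inner _ yi) (bohr_mono le4 (bohrD yi uX)) mulr1.
- move=> z a zX aA0; apply: bohr_mono (bohrB (fintype.subsetP A0B _ aA0) (halve_sub zX)).
  by rewrite leq_add2l; clear -r1u; lia.
- rewrite -(ler_nat R) natrM; clear -regR in2 B0; lra.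
rewrite card_halve sum_halve.
have P2 : (2 ^+ P)^-1 <= 199 / 200 * al.
  apply: (@le_trans _ _ (2^-1 * (2 ^+ D)^-1)); last by clear -alD al_gt0; lra.
  rewrite -invfM -exprS lef_pV2 ?posrE ?exprn_gt0 // ler_eXn2l ?ltr1n // EP.
  by clear; lia.
have c04 : 1 <= c0 / 4.
  have al0D : (2 ^+ D.+1)^-1 <= al0.
    rewrite ler_pdivlMr //; apply: le_trans lo0; rewrite ler_pM2r // exprS invfM.
    by clear -alD al_gt0; lra.
  have c0E : c0 = al0 ^+ 2 * #|bohr L r0|%:R.
    by rewrite /c0 expr2 -mulrA [al0 * #|bohr _ _|%:R]divfK // gt_eqF.
  have sq : (2 ^+ D.+1)^-1 ^+ 2 <= al0 ^+ 2.
    by apply: lerXn2r; rewrite ?nnegrE ?invr_ge0 ?exprn_ge0 // divr_ge0.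
  have bigR : 4 ^+ (D + 2) <= #|bohr L r0|%:R :> R by rewrite -natrX ler_nat.
  have E1 : 1 = (2 ^+ D.+1)^-1 ^+ 2 * 4 ^+ (D + 2) / 4 :> R.
    have -> : (2 ^+ D.+1)^-1 ^+ 2 = (4 ^+ D.+1)^-1 :> R.
      by rewrite exprVn -exprM mulnC exprM; congr ((_ ^+ _)^-1); rewrite -natrX.
    by rewrite addn2 [4 ^+ D.+2]exprS; field; rewrite expf_neq0.
  rewrite [leLHS]E1 ler_pM2r // c0E; apply: (ler_pM _ _ sq bigR); last by rewrite exprn_ge0.
  by rewrite sqr_ge0.
apply: (@le_trans _ _ (199 / 200 * al * #|bohr L r1|%:R ^+ 2)).
  by rewrite ler_wpM2r // exprn_ge0.
apply: le_trans lo1 _; apply: ler_sum => y _; rewrite sum_halve; apply: ler_sum => y' _.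
have -> : y' + y' - (y + y) = (y' - y) + (y' - y) by ring.
rewrite /ind; case: (boolP (y' - y \in At)) => // yA.
by rewrite (le_trans (conv_ap_free apf A0At yA) c04).
Qed.

Definition loss2 (d a l m0 : nat) : nat :=
  (8 * d.+1 * 1024 * 8 * (8 * d.+1 * 1024) * loss d a l m0)%N.

(** By contradiction: if no admissible Bohr set offers an increment, all of their translates obey
    the upper bound that [good_centre] and [boundary_mass] require. The gain 65/64 survives the
    losses, (199/200)^2 (65/64) > 401/400, and a is chosen so that (al0/2)^(65 P) >= 4 / 2^a. *)
Lemma increment L r u x0 A (D a l k m0 : nat) (al : R) :
  a = ((D + 2) * (65 * (2 * (D + 4))) + 2)%N ->
  l = (a + 10)%N -> k%:R = 2 ^+ 29 * l%:R ^+ 2 * (2 * l + 20)%N%:R :> R ->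
  m0 = (256 * (4 + a.+1 * k))%N ->
  ap_free A -> (u <= q)%N ->
  (1024 * #|bohr L (r + u)| <= 1025 * #|bohr L r|)%N ->
  (2 ^+ D)^-1 <= al ->
  al * #|bohr L r|%:R <= \sum_(s in bohr L r) ind R A (x0 + s) ->
  (4 ^ (D + 2) <= #|bohr L (u %/ 2)|)%N ->
  exists (L' : seq G) (r' u' : nat) (x' : G),
    [/\ (size L' <= size L + m0)%N,
        (1024 * #|bohr L' (r' + u')| <= 1025 * #|bohr L' r'|)%N,
        (u %/ loss2 (size L) a l m0 <= u')%N, (u' <= q)%N &
        401 / 400 * al * #|bohr L' r'|%:R <= \sum_(s in bohr L' r') ind R A (x' + s)].
Proof.
move=> Ea El Ek Em apf uq reg alD dens big; apply: contrapT => noinc.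
have spread L' r' u' : (size L' <= size L + m0)%N ->
    (1024 * #|bohr L' (r' + u')| <= 1025 * #|bohr L' r'|)%N ->
    (u %/ loss2 (size L) a l m0 <= u')%N -> (u' <= q)%N ->
    forall x, \sum_(s in bohr L' r') ind R A (x + s) <= 401 / 400 * al * #|bohr L' r'|%:R.
  move=> h1 h2 h3 h4 x; rewrite leNgt; apply/negP => /ltW h5; apply: noinc.
  by exists L', r', u', x.
have al_gt0 : 0 < al by apply: lt_le_trans alD; rewrite invr_gt0 exprn_gt0.
have [d Ed] : exists d, d = size L by exists (size L).
have [ls Els] : exists ls, ls = loss d a l m0 by exists (loss d a l m0).
have losseq : (u %/ loss2 (size L) a l m0)%N =
   (u %/ 8 %/ d.+1 %/ 1024 %/ 8 %/ 8 %/ d.+1 %/ 1024 %/ ls)%N.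
  by rewrite /loss2 -Ed -Els !divnMA.
rewrite losseq in spread noinc.
set u0 := (u %/ 8 %/ d.+1 %/ 1024)%N in spread noinc losseq.
set u1 := (u0 %/ 8 %/ 8 %/ d.+1 %/ 1024)%N in spread noinc losseq.
have [r0 [r0a r0b r0c]] : exists rho, [/\ (u %/ 2 + u0 <= rho)%N, (rho + u0 <= u)%N &
    (1024 * #|bohr L (rho + u0)| <= 1025 * #|bohr L (rho - u0)|)%N].
  apply: bohr_regular => //; rewrite -Ed mulnC /u0.
  by rewrite -[(_ %/ 8 %/ _)%N]divnMA -[(_ %/ (8 * _) %/ _)%N]divnMA leq_trunc_div.
have [r1 [r1a r1b r1c]] : exists rho, [/\ (u0 %/ 8 %/ 2 + u1 <= rho)%N, (rho + u1 <= u0 %/ 8)%N &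
    (1024 * #|bohr L (rho + u1)| <= 1025 * #|bohr L (rho - u1)|)%N].
  apply: bohr_regular => //; rewrite -Ed mulnC /u1.
  by rewrite -[(_ %/ 8 %/ d.+1)%N]divnMA -[(_ %/ (8 * _) %/ _)%N]divnMA leq_trunc_div.
have u0u : (u0 <= u)%N by rewrite /u0; do 2 (apply: leq_trans (leq_div _ _) _); exact: leq_div.
have u1u0 : (u1 <= u0)%N by rewrite /u1; do 3 (apply: leq_trans (leq_div _ _) _); exact: leq_div.
have r1u0 : (8 * r1 <= u0)%N.
  have h : (r1 <= u0 %/ 8)%N by apply: leq_trans r1b; exact: leq_addr.
  by apply: leq_trans (leq_trunc_div u0 8); rewrite mulnC leq_mul2r h orbT.
have u0r0 : (u0 <= r0)%N by apply: leq_trans r0a; exact: leq_addl.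
have lsu1 : (u1 %/ ls <= u1)%N by exact: leq_div.
have szL : (size L <= size L + m0)%N by exact: leq_addr.
have up0 := spread L r0 u0 szL _ (leq_trans lsu1 u1u0) (leq_trans u0u uq).
have {}up0 := up0 (leq_trans r0c (leq_mul (leqnn _) (subset_leq_card (bohr_sub L (leq_subr u0 r0))))).
have up1 := spread L r1 u1 szL _ lsu1 (leq_trans u1u0 (leq_trans u0u uq)).
have r1c' := leq_trans r1c (leq_mul (leqnn 1025) (subset_leq_card (bohr_sub L (leq_subr u1 r1)))).
have {}up1 := up1 r1c'.
have r0u : (r0 <= u)%N by apply: leq_trans r0b; exact: leq_addr.
have r1u : (r1 + r1 <= u)%N by apply: leq_trans u0u; apply: leq_trans r1u0; clear; lia.
have [|c [lo0 lo1]] := good_centre (ind_ge0 R A) al_gt0 reg dens (bohr_card_gt0 L r0)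
   (bohr_card_gt0 L r1) (bohr_sub L r0u) _ up0 up1.
  by move=> y y' yB y'B; apply: bohr_mono (bohrB y'B yB).
pose At := [set x | c + x \in A].
have indAt x : ind R At x = ind R A (c + x) by rewrite /ind inE.
have apft : ap_free At.
  move=> x y z; rewrite !inE => xA yA zA E.
  have := apf _ _ _ xA yA zA; rewrite !addrA.
  have -> : c + x + c + z = c + y + c + y.
    by rewrite [c + x + c]addrAC [c + y + c]addrAC -![c + c + _ + _]addrA E.
  by move=> /(_ erefl) /addrI.
have up1t x : \sum_(s in bohr L r1) ind R At (x + s) <= 401 / 400 * al * #|bohr L r1|%:R.
  by under eq_bigr do rewrite indAt addrA; exact: up1.
pose A0 := At :&: bohr L r0.
have lo0t : 199 / 200 * al * #|bohr L r0|%:R <= #|A0|%:R.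
  by rewrite -sum_in_ind; under eq_bigr do rewrite indAt.
have lo1t : 199 / 200 * al * #|bohr L r1|%:R ^+ 2 <=
    \sum_(y in bohr L r1) \sum_(y' in bohr L r1) ind R At (y' - y).
  by under eq_bigr do under eq_bigr do rewrite indAt.
have big0 : (4 ^ (D + 2) <= #|bohr L r0|)%N.
  apply: leq_trans big _; apply: subset_leq_card; apply: bohr_sub.
  by apply: leq_trans r0a; exact: leq_addr.
have [A' [A'X dA' badA']] := bohr_sift apft r1u0 u0r0 r0c up1t alD lo0t lo1t big0.
rewrite -/A0 in dA' badA'.
have B0 : 0 < #|bohr L r0|%:R :> R by rewrite ltr0n bohr_card_gt0.
set al0 := #|A0|%:R / #|bohr L r0|%:R in dA' badA'.
have al0lo : 199 / 200 * al <= al0 by rewrite ler_pdivlMr.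
have al00 : 0 < al0 by clear -al0lo al_gt0; lra.
have A0R : 0 < #|A0|%:R :> R by have := mulr_gt0 al_gt0 B0; clear -lo0t; lra.
have A0gt : (0 < #|A0|)%N by rewrite -(ltr0n R).
have [||||||L' [r' [u' [y [sL' reg' u'1 u'q Sdens]]]]] := @bohr_almost_period R n (halve L) A'
  (fun u => 65 / 64 * (al0 * #|A0|%:R) <= corr (ind R A0) u) r1 u1 a l k m0
  (2 * (4 ^+ (2 * (D + 4)))^-1) El Ek Em.
- exact: leq_trans u1u0 (leq_trans u0u uq).
- rewrite !card_halve //; apply: (@leq_trans (1024 * #|bohr L (r1 + u1)| %/ 1024)%N).
    by rewrite mulKn.
  apply: leq_trans (leq_div2r _ r1c') _; apply: (@leq_trans (1024 * (2 * #|bohr L r1|) %/ 1024)).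
    by apply: leq_div2r; rewrite mulnA leq_mul2r orbT.
  by rewrite mulKn.
- exact: A'X.
- apply: le_trans dA'; rewrite ler_wpM2r //.
  have h2 : (2 ^+ (D + 2))^-1 <= al0 / 2.
    rewrite addn2 exprS exprS !invfM; clear -alD al0lo al_gt0; lra.
  apply: (@le_trans _ _ ((2 ^+ (D + 2))^-1 ^+ (65 * (2 * (D + 4))))); last first.
    by apply: lerXn2r; rewrite ?nnegrE ?invr_ge0 ?exprn_ge0 // ltW // divr_gt0.
  rewrite exprVn -exprM Ea exprD.
  by rewrite le_eqVlt; apply/orP; left; apply/eqP; field; rewrite expf_neq0.
- rewrite mulr_gt0 ?invr_gt0 ?exprn_gt0 //= ler_pdivrMr ?exprn_gt0 //.
  have -> : 4 = 2 ^+ 2 :> R by rewrite -natrX.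
  have -> : 1024^-1 = (2 ^+ 10)^-1 :> R by congr (_ ^-1); ring.
  rewrite ler_pdivlMl ?exprn_gt0 // -exprM -exprSr ler_eXn2l ?ltr1n //.
  by clear; lia.
- exact: badA'.
apply: noinc; set B' := bohr L' r' in Sdens reg' *.
have B'R : 0 < #|B'|%:R :> R by rewrite ltr0n bohr_card_gt0.
(* The autocorrelation summed over a translate of B' counts, over p in A0, the points of A0 in a
   translate of B' depending on p; some p does at least as well as the average. *)
have corrlow : 199 / 200 * (65 / 64) * al0 * #|A0|%:R * #|B'|%:R <=
    \sum_(s in B') corr (ind R A0) (y + s).
  have -> : 199 / 200 * (65 / 64) * al0 * #|A0|%:R * #|B'|%:R =
     (65 / 64 * (al0 * #|A0|%:R)) * (199 / 200 * #|B'|%:R) by ring.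
  have p : 0 <= 65 / 64 * (al0 * #|A0|%:R) by rewrite !mulr_ge0 // ltW.
  apply: le_trans (ler_wpM2l p Sdens) _; rewrite mulr_sumr; apply: ler_sum => s _.
  case: (boolP (65 / 64 * (al0 * #|A0|%:R) <= corr _ _)) => h; first by rewrite mulr1.
  by rewrite mulr0 sumr_ge0 // => z _; rewrite mulr_ge0 ?ind_ge0.
have [] := @exists_le R _ (mem A0) (fun _ => 199 / 200 * (65 / 64) * al0 * #|B'|%:R)
  (fun p => \sum_(s in B') ind R A0 (p + (y + s))).
- by apply/card_gt0P.
- rewrite sumr_const -[_ *+ _]mulr_natr mulrAC; apply: le_trans corrlow _.
  rewrite [leRHS]exchange_big /=; apply: ler_sum => s _.
  by rewrite /corr sum_indM.
move=> p _ Hp; exists L', r', u', (c + (p + y)); split => //.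
- by move: sL'; rewrite size_halve.
- by move: u'1; rewrite size_halve -Ed -Els.
apply: (@le_trans _ _ (199 / 200 * (65 / 64) * al0 * #|B'|%:R)).
  rewrite ler_pM2r //; clear -al0lo al_gt0; lra.
apply: le_trans Hp _; apply: ler_sum => s _.
rewrite -[c + (p + y) + s]addrA -[p + y + s]addrA -indAt /ind.
case: (boolP (_ \in A0)) => // h.
by rewrite (fintype.subsetP (finset.subsetIl At (bohr L r0)) _ h).
Qed.

End IncrementStep.

(** * Iterating the increment *)

Section Iteration.

(** The parameters of [increment] as functions of D: [depth] is a, [samples] is k as a function of
    l, [rank_gain] is m0. They stay fixed over all rounds, since the density only grows. *)
Definition depth (D : nat) := ((D + 2) * (65 * (2 * (D + 4))) + 2)%N.
Definition samples (l : nat) := (2 ^ 29 * l ^ 2 * (2 * l + 20))%N.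
Definition rank_gain (D : nat) :=
  (256 * (4 + (depth D).+1 * samples (depth D + 10)))%N.
Definition rounds (D : nat) := (400 * D.+1)%N.
Definition shrink (D : nat) :=
  (54 + 5 * (rounds D * rank_gain D).+1 + (depth D + 10).+1 + 2 * rank_gain D
   + 2 * (depth D + 30) + (rounds D * rank_gain D + rank_gain D).+1)%N.
(** Makes q at least 4^(D + 2) times the loss in [bohr_card_lower] at the largest rank and smallest
    radius met, so that each Bohr set used keeps 4^(D + 2) points. *)
Definition modulus_exp (D : nat) :=
  (2 * (D + 2 + rounds D * rank_gain D * (shrink D * rounds D + 1)))%N.

Lemma leq_exp2 m k : (m <= k)%N -> (m <= 2 ^ k)%N.
Proof. by move=> h; apply: leq_trans h _; rewrite ltnW // ltn_expl. Qed.

Lemma loss2_le_aux (d e a l m0 : nat) : (d <= e)%N ->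
  (loss2 d a l m0 <= 2 ^ (54 + 5 * e.+1 + l.+1 + 2 * m0 + 2 * (a + 30) + (e + m0).+1))%N.
Proof.
move=> de.
have d1 : (d.+1 <= 2 ^ e.+1)%N by exact: leq_exp2.
have l1 : (l.+1 <= 2 ^ l.+1)%N by exact: leq_exp2.
have m1 : (m0 <= 2 ^ m0)%N by exact: leq_exp2.
have dm : ((d + m0).+1 <= 2 ^ (e + m0).+1)%N by apply: leq_exp2; rewrite ltnS leq_add2r.
have k1 : (1024 <= 2 ^ 10)%N by [].
have k2 : (8 <= 2 ^ 3)%N by [].
have k3 : (4 <= 2 ^ 2)%N by [].
have b1 := leq_mul (leq_mul k2 d1) k1.
have b2 := leq_mul k2 d1.
have b3 := leq_mul b2 (leqnn (2 ^ (a + 30))).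
have b4 := leq_mul (leqnn (2 ^ (a + 30))) m1.
have b5 := leq_mul (leq_mul k2 dm) k1.
have b6 : (2 * l.+1 <= 2 ^ 1 * 2 ^ l.+1)%N by rewrite expn1 leq_mul2l l1.
have L0 := leq_mul (leq_mul (leq_mul (leq_mul (leq_mul (leq_mul (leq_mul k3 b2) b6) b2) m1) b3) b4) b5.
have := leq_mul (leq_mul (leq_mul b1 k2) b1) L0.
rewrite -/(loss d a l m0) -/(loss2 d a l m0) => H; apply: leq_trans H _.
rewrite -!expnD leq_exp2l //; clear; lia.
Qed.

Variables (R : realType) (n : nat).
Local Notation q := n.+2.
Local Notation G := 'I_n.+2.

Lemma growth (D : nat) : 2 ^+ D.+1 <= (401 / 400) ^+ rounds D :> R.
Proof.
have h : -1 <= 400^-1 :> R by lra.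
have E : 401 / 400 = 1 + 400^-1 :> R by lra.
have E2 : 1 + 400%:R * 400^-1 = 2 :> R by lra.
have b : 2 <= (401 / 400) ^+ 400 :> R by rewrite E -[leLHS]E2; exact: bernoulli.
have p := le_trans (ler0n R 2) b.
by rewrite /rounds exprM; apply: (lerXn2r _ _ _ b); rewrite nnegrE.
Qed.

(** A progression-free A would allow [rounds D] increments, and by [growth] the density would end at
    2 or more. The start is the Bohr set without frequencies, the whole group. *)
Theorem dense_set_has_ap (A : {set G}) (D : nat) : odd q ->
  (2 ^ modulus_exp D <= q)%N -> (q <= 2 ^ D * #|A|)%N -> ~ ap_free A.
Proof.
move=> oddq bigq dA apf.
have [a Ea] : exists a, a = depth D by exists (depth D).
have [l El] : exists l, l = (a + 10)%N by exists (a + 10)%N.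
have [k Ek] : exists k, k = samples l by exists (samples l).
have [m0 Em] : exists m0, m0 = rank_gain D by exists (rank_gain D).
have [J EJ] : exists J, J = rounds D by exists (rounds D).
have [e Ee] : exists e, e = shrink D by exists (shrink D).
have EkR : k%:R = 2 ^+ 29 * l%:R ^+ 2 * (2 * l + 20)%N%:R :> R.
  by rewrite Ek /samples natrM natrM !natrX.
have Em' : m0 = (256 * (4 + a.+1 * k))%N by rewrite Em /rank_gain -Ea -El -Ek.
have lossb d : (d <= J * m0)%N -> (loss2 d a l m0 <= 2 ^ e)%N.
  by move=> /(loss2_le_aux a l m0); rewrite Ee /shrink -Ea -El -Em -EJ.
pose al j : R := (401 / 400) ^+ j * (2 ^+ D)^-1.
have inv j : (j <= J)%N -> exists (L : seq G) (r u : nat) (x : G),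
    [/\ (size L <= j * m0)%N, (1024 * #|bohr L (r + u)| <= 1025 * #|bohr L r|)%N,
        (q %/ 2 ^ (e * j) <= u)%N, (u <= q)%N &
        al j * #|bohr L r|%:R <= \sum_(s in bohr L r) ind R A (x + s)].
  elim: j => [|j IH] jJ.
    exists [::], 0%N, q, 0; split => //.
    - by rewrite !bohr_nil leq_mul2r orbT.
    - by rewrite muln0 expn0 divn1.
    rewrite /al expr0 mul1r bohr_nil cardsT card_ord ler_pdivrMl ?exprn_gt0 //.
    have -> : \sum_(s in [set: G]) ind R A (0 + s) = #|A|%:R.
      rewrite (eq_bigl predT) => [|x]; last by rewrite inE.
      by rewrite -(sum_ind R); apply: eq_bigr => x _; rewrite add0r.
    by rewrite -natrX -natrM ler_nat.
  have [L [r [u [x [sL reg qu uq dens]]]]] := IH (ltnW jJ).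
  have alD : (2 ^+ D)^-1 <= al j.
    have h1 : 1 <= 401 / 400 :> R by clear; lra.
    by rewrite ler_peMl ?invr_ge0 ?exprn_ge0 // exprn_ege1.
  have sLJ : (size L <= J * m0)%N by apply: leq_trans sL _; rewrite leq_mul2r ltnW ?orbT.
  have big : (4 ^ (D + 2) <= #|bohr L (u %/ 2)|)%N.
    have qu2 : (q %/ 2 ^ (e * j).+1 <= u %/ 2)%N by rewrite expnSr divnMA leq_div2r.
    apply: leq_trans (subset_leq_card (bohr_sub L qu2)).
    have := bohr_card_lower L (e * j).+1.
    set X := #|bohr L _| => h.
    have Y0 : (0 < 4 ^ (size L * (e * j).+1))%N by rewrite expn_gt0.
    rewrite -(leq_pmul2l Y0); apply: leq_trans h; apply: leq_trans bigq.
    rewrite -expnD -[4%N]/(2 ^ 2)%N -expnM leq_exp2l // /modulus_exp leq_mul2l /=.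
    rewrite addnC leq_add2l -Em -EJ -Ee addn1; apply: leq_mul => //.
    by rewrite ltnS leq_mul2l ltnW ?orbT.
  have [L' [r' [u' [x' [sL' reg' uu' u'q dens']]]]] :=
    increment oddq Ea El EkR Em' apf uq reg alD dens big.
  exists L', r', u', x'; split => //.
  - by apply: leq_trans sL' _; rewrite mulSn addnC leq_add2l.
  - apply: leq_trans uu'; rewrite mulnS addnC expnD divnMA.
    apply: (@leq_trans (u %/ 2 ^ e)); first exact: leq_div2r.
    apply: leq_div2l; last exact: lossb.
    by rewrite /loss2 /loss !muln_gt0 !expn_gt0 Em' muln_gt0.
  - by move: dens'; rewrite /al exprS !mulrA.
have [L [r [u [x [_ _ _ _ dens]]]]] := inv J (leqnn J).
have BR : 0 < #|bohr L r|%:R :> R by rewrite ltr0n bohr_card_gt0.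
have : al J * #|bohr L r|%:R <= 1 * #|bohr L r|%:R.
  apply: le_trans dens _; rewrite mul1r -sum1_card natr_sum; apply: ler_sum => s _.
  exact: ind_le1.
rewrite ler_pM2r // leNgt => /negP; apply.
rewrite /al EJ ltr_pdivlMr ?exprn_gt0 // mul1r; apply: lt_le_trans (growth D).
by rewrite ltr_eXn2l ?ltr1n.
Qed.

End Iteration.

(** * From progressions to syndetic sets *)

Section PolynomialBounds.

(** With M >= 2 constants and sums are absorbed in the exponent, so a pure power suffices. *)
Definition poly_bounded (f : nat -> nat) :=
  exists C, forall M, (2 <= M)%N -> (f M <= M ^ C)%N.

Lemma pb_const c : poly_bounded (fun _ => c).
Proof.
exists c => M M2; apply: leq_trans (leq_exp2 (leqnn c)) _.
by case: c => [|c]; rewrite ?expn0 // leq_exp2r.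
Qed.

Lemma pb_id : poly_bounded id.
Proof. by exists 1%N => M _; rewrite expn1. Qed.

Lemma pb_add f g : poly_bounded f -> poly_bounded g -> poly_bounded (fun M => f M + g M)%N.
Proof.
move=> [C1 H1] [C2 H2]; exists (C1 + C2).+1 => M M2.
have M0 : (0 < M)%N by apply: leq_trans M2.
apply: leq_trans (leq_add (H1 _ M2) (H2 _ M2)) _.
apply: (@leq_trans (2 * M ^ (C1 + C2))); last by rewrite expnS leq_mul2r M2 orbT.
by rewrite mul2n -addnn leq_add // leq_pexp2l // ?leq_addr ?leq_addl.
Qed.

Lemma pb_mul f g : poly_bounded f -> poly_bounded g -> poly_bounded (fun M => f M * g M)%N.
Proof.
move=> [C1 H1] [C2 H2]; exists (C1 + C2)%N => M M2.
by rewrite expnD leq_mul ?H1 ?H2.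
Qed.

Lemma pb_succ f : poly_bounded f -> poly_bounded (fun M => (f M).+1).
Proof.
move=> /pb_add /(_ (pb_const 1)) [C H]; exists C => M /H; by rewrite addn1.
Qed.

(** The first 2 pays for embedding [0, K) in Z/(2K+1); (2 + 2 M) M bounds log2 of (3 M^2)^M through
    3 <= 2^2 and M <= 2^M. *)
Definition density_exp (M : nat) := (2 + (2 + 2 * M) * M)%N.

Lemma pb_total : poly_bounded (fun M => M + modulus_exp (density_exp M))%N.
Proof.
have hM := pb_id; have hc := pb_const.
have hD : poly_bounded density_exp :=
  pb_add (hc 2) (pb_mul (pb_add (hc 2) (pb_mul (hc 2) hM)) hM).
have hdep : poly_bounded (fun M => depth (density_exp M)) :=
  pb_add (pb_mul (pb_add hD (hc 2)) (pb_mul (hc 65) (pb_mul (hc 2) (pb_add hD (hc 4))))) (hc 2).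
have hl : poly_bounded (fun M => depth (density_exp M) + 10)%N := pb_add hdep (hc 10).
have hs : poly_bounded (fun M => samples (depth (density_exp M) + 10)).
  have [C H] := pb_mul (pb_mul (hc (2 ^ 29)%N) (pb_mul hl hl)) (pb_add (pb_mul (hc 2) hl) (hc 20)).
  by exists C => M /H; rewrite /samples -mulnn.
have hr : poly_bounded (fun M => rank_gain (density_exp M)) :=
  pb_mul (hc 256) (pb_add (hc 4) (pb_mul (pb_succ hdep) hs)).
have hJ : poly_bounded (fun M => rounds (density_exp M)) := pb_mul (hc 400) (pb_succ hD).
have hJr := pb_mul hJ hr.
have hsh : poly_bounded (fun M => shrink (density_exp M)) :=
  pb_add (pb_add (pb_add (pb_add (pb_add (hc 54) (pb_mul (hc 5) (pb_succ hJr))) (pb_succ hl))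
    (pb_mul (hc 2) hr)) (pb_mul (hc 2) (pb_add hdep (hc 30)))) (pb_succ (pb_add hJr hr)).
exact: pb_add hM (pb_mul (hc 2) (pb_add (pb_add hD (hc 2))
  (pb_mul hJr (pb_add (pb_mul hsh hJ) (hc 1))))).
Qed.

End PolynomialBounds.

(** * Serving all t at once *)

Section ProductTrick.

Lemma count_inj_le (K V : nat) (P Q : pred nat) (f : nat -> nat) : injective f ->
  (forall m, (m < K)%N -> Q m -> P (f m) && (f m < V)%N) ->
  (\sum_(m < K) Q m <= \sum_(s < V) P s)%N.
Proof.
move=> fI H.
have E (I : finType) (T : pred I) : (\sum_i T i = #|[set i | T i]|)%N.
  by rewrite -sum1dep_card [RHS]big_mkcond; apply: eq_bigr => i _; case: (T i).
rewrite (E _ (fun m : 'I_K => Q m)) (E _ (fun s : 'I_V => P s)).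
case: V H => [|V] H.
  suff -> : [set m : 'I_K | Q m] = finset.set0 by rewrite cards0.
  apply/setP => m; rewrite !inE; apply/negP => Qm.
  by have := H _ (ltn_ord m) Qm; rewrite andbF.
rewrite -(@card_in_imset _ _ (fun m : 'I_K => inord (f m) : 'I_V.+1)).
  apply: subset_leq_card; apply/fintype.subsetP => s /imsetP[m]; rewrite inE => Qm ->.
  by have /andP[h1 h2] := H _ (ltn_ord m) Qm; rewrite inE inordK.
move=> m m'; rewrite !inE => /(H _ (ltn_ord m))/andP[_ h] /(H _ (ltn_ord m'))/andP[_ h'].
by move=> /(congr1 val); rewrite /= !inordK // => /fI E'; exact: val_inj.
Qed.

(** The shifts for different t are independent: for fixed a, the tuples v that work for all t number
    a product of M counts, each at least |S cut to [1, N]|. That size is at least K/M, because every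
    m <= K has a multiple m t in S with t <= M. *)
Lemma syndetic_progression (R : realType) (S : pred nat) (M N : nat) :
  (0 < M)%N -> ~~ S 0%N ->
  (forall m, (0 < m)%N -> exists2 t, (0 < t <= M)%N & S (m * t)%N) ->
  (M * 2 ^ modulus_exp (density_exp M) <= N)%N ->
  exists x d : nat, [/\ (0 < d)%N, S x, S d, S (x + d)%N & S (x + 2 * d)%N] /\ (x + 2 * d <= N)%N.
Proof.
move=> M0 S0 synd bigN; apply: contrapT => noap.
pose P s := S s && (s <= N)%N.
pose cA := (\sum_(s < N.+1) P s)%N.
have [K EK] : exists K, K = (N %/ M)%N by exists (N %/ M)%N.
(* The true shift is v_t - M K. It ranges over [-M K, N], so for each a < K and t <= M every s <= N
   is hit by some v_t. *)
have [V EV] : exists V, V = (N + M * K + 1)%N by exists (N + M * K + 1)%N.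
have bigK : (2 ^ modulus_exp (density_exp M) <= K)%N by rewrite EK leq_divRL // mulnC.
have K0 : (0 < K)%N by apply: leq_trans bigK; rewrite expn_gt0.
have KM : (K * M <= N)%N by rewrite EK; exact: leq_trunc_div.
have NKM : (N < (K + 1) * M)%N by rewrite EK addn1 ltn_ceil.
have cAK : (K <= M * cA)%N.
  apply: (@leq_trans (\sum_(m < K) \sum_(t < M) P (m.+1 * t.+1)%N)).
    rewrite -{1}[K]card_ord -sum1_card; apply: leq_sum => m _.
    have [t /andP[t0 tM] St] := synd m.+1 isT.
    have tM' : (t.-1 < M)%N by rewrite prednK.
    rewrite (bigD1 (Ordinal tM')) //= prednK // /P St /=.
    have -> : (m.+1 * t <= N)%N by apply: leq_trans KM; apply: leq_mul.
    by rewrite leq_addr.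
  have -> : (M * cA = \sum_(t < M) cA)%N by rewrite sum_nat_const card_ord.
  rewrite exchange_big /=; apply: leq_sum => t _.
  apply: (@count_inj_le K N.+1 P (fun m => P (m.+1 * t.+1)%N) (fun m => m.+1 * t.+1)%N).
    by move=> m m' /eqP; rewrite eqn_mul2r /= eqSS => /eqP.
  by move=> m _ /= Pm; rewrite Pm; case/andP: Pm.
have cA0 : (0 < cA)%N by move: (leq_trans K0 cAK); rewrite muln_gt0 => /andP[].
(* The index t stands for t + 1. Where the subtraction truncates, the value is 0, which is not in
   S. *)
pose cond (v : {ffun 'I_M -> 'I_V}) a := [forall t : 'I_M, P (v t + t.+1 * a - M * K)%N].
have [v Hv] : exists v, (K * cA ^ M <= V ^ M * \sum_(a < K) cond v a)%N.
  have tot : (K * cA ^ M <= \sum_(v : {ffun 'I_M -> 'I_V}) \sum_(a < K) cond v a)%N.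
    have -> : (K * cA ^ M = \sum_(a < K) cA ^ M)%N by rewrite sum_nat_const card_ord.
    rewrite exchange_big /=; apply: leq_sum => a _.
    have -> : (\sum_(v : {ffun 'I_M -> 'I_V}) cond v a =
        \prod_(t < M) \sum_(x < V) P (x + t.+1 * a - M * K))%N.
      rewrite bigA_distr_bigA /=; apply: eq_bigr => v _; rewrite /cond.
      have [/forallP H|] := boolP [forall t : 'I_M, P (v t + t.+1 * a - M * K)%N].
        by rewrite big1 // => t _; rewrite H.
      by rewrite negb_forall => /existsP[t /negbTE Ht]; rewrite (bigD1 t) //= Ht.
    have -> : (cA ^ M = \prod_(t < M) cA)%N by rewrite prod_nat_const card_ord.
    apply: leq_prod => t _.
    have ta : (t.+1 * a <= M * K)%N by apply: leq_mul; [exact: ltn_ord|exact: ltnW].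
    apply: (@count_inj_le N.+1 V (fun x => P (x + t.+1 * a - M * K)%N) P
      (fun s => s + (M * K - t.+1 * a))%N); first exact: addIn.
    move=> s sN Ps /=; rewrite -addnA subnK // addnK Ps /= EV addn1 ltnS.
    by apply: leq_add; [exact: sN|exact: leq_subr].
  apply/existsP; apply: contraLR tot; rewrite negb_exists -ltnNge => /forallP H.
  have VM : (0 < V ^ M)%N by rewrite expn_gt0 EV addn1.
  rewrite -(ltn_pmul2l VM) big_distrr /=.
  have -> : (V ^ M * (K * cA ^ M) = \sum_(v : {ffun 'I_M -> 'I_V}) K * cA ^ M)%N.
    by rewrite sum_nat_const card_ffun !card_ord.
  have v0 : {ffun 'I_M -> 'I_V}.
    have V0 : (0 < V)%N by rewrite EV addn1.
    exact: [ffun=> Ordinal V0].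
  rewrite (bigD1 v0) // [X in (_ < X)%N](bigD1 v0) //=.
  apply: (@leq_trans (K * cA ^ M + \sum_(i | i != v0) V ^ M * \sum_(a < K) cond i a)%N).
    by rewrite -addSn leq_add2r ltnNge; exact: H.
  rewrite leq_add2l; apply: leq_sum => w _; apply: ltnW.
  by rewrite ltnNge; exact: H.
have VB : (V <= 3 * M ^ 2 * cA)%N.
  apply: (@leq_trans (3 * M * K)).
    have : (M <= K * M)%N by exact: leq_pmull.
    clear -EV NKM; rewrite EV; set X := (K * M)%N; rewrite (mulnC M K) -/X.
    by rewrite mulnDl -/X in NKM; rewrite -mulnA (mulnC M K) -/X; lia.
  by rewrite -mulnn -!mulnA leq_mul2l leq_mul2l cAK orbT.
set cnt := (\sum_(a < K) cond v a)%N in Hv.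
have Hcnt : (K <= (3 * M ^ 2) ^ M * cnt)%N.
  have c1 : (0 < cA ^ M)%N by rewrite expn_gt0 cA0.
  rewrite -(leq_pmul2r c1); apply: leq_trans Hv _.
  rewrite mulnAC leq_mul2r; apply/orP; right; rewrite -expnMn.
  by rewrite leq_exp2r.
(* An odd modulus above 2 (K - 1): an equation x + z = 2 y between elements of [0, K) modulo it
   already holds among the integers. *)
have [n En] : exists n, n.+2 = (2 * K + 1)%N by exists (2 * K - 1)%N; clear -K0; lia.
pose A : {set 'I_n.+2} := [set x : 'I_n.+2 | (x < K)%N && cond v x].
have cardA : (cnt <= #|A|)%N.
  have -> : (#|A| = \sum_(s < n.+2) ((s < K)%N && cond v s))%N.
    rewrite -sum1dep_card big_mkcond; apply: eq_bigr => i _; by case: (_ && _).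
  apply: (@count_inj_le K n.+2 (fun s => (s < K)%N && cond v s) (cond v) id) => // m mK -> /=.
  by rewrite mK En; clear -mK; lia.
have oddq : odd n.+2 by rewrite En oddD oddM.
apply: (@dense_set_has_ap R n A (density_exp M) oddq).
- by rewrite En; apply: leq_trans bigK _; clear; lia.
- rewrite [leqLHS]En; apply: (@leq_trans (2 ^ 2 * ((3 * M ^ 2) ^ M * cnt))).
    by apply: leq_trans (leq_mul (leqnn _) Hcnt); clear -K0; lia.
  rewrite /density_exp expnD -mulnA leq_mul2l /= expnM; apply: leq_mul cardA.
  rewrite leq_exp2r // expnD; apply: leq_mul => //.
  by rewrite [(2 * M)%N]mulnC expnM leq_exp2r // leq_exp2.
move=> x y z; rewrite !inE => /andP[xK cx] /andP[yK cy] /andP[zK cz] E.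
have Enat : (x + z = y + y :> nat)%N.
  have := congr1 (@nat_of_ord _) E; rewrite !val_add !ifT //; clear -En xK yK zK; lia.
apply: contrapT => xy.
have [a [m [m0 ca cb cc]]] : exists a m : nat,
    [/\ (0 < m)%N, cond v a, cond v (a + m)%N & cond v (a + 2 * m)%N].
  have [xy'|yx|xyE] := ltngtP (nat_of_ord x) (nat_of_ord y); last by case: xy; apply: val_inj.
    exists x, (y - x)%N; split => //; first by rewrite subn_gt0.
      by rewrite subnKC // ltnW.
    by have -> : (x + 2 * (y - x) = z)%N by clear -xy' Enat; lia.
  exists z, (y - z)%N; have zy : (z < y)%N by clear -yx Enat; lia.
  split => //; first by rewrite subn_gt0.
    by rewrite subnKC // ltnW.
  by have -> : (z + 2 * (y - z) = x)%N by clear -zy Enat; lia.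
(* Only now, with m known, is t chosen; the coordinate v_t then carries the progression of
   difference m t. *)
have [t /andP[t0 tM] St] := synd m m0.
have tM' : (t.-1 < M)%N by rewrite prednK.
move: ca cb cc; rewrite /cond => /forallP/(_ (Ordinal tM')) /= pa.
move=> /forallP/(_ (Ordinal tM')) /= pb /forallP/(_ (Ordinal tM')) /= pc.
rewrite prednK // in pa pb pc.
move/andP: pa => [Sa _]; move/andP: pb => [Sb _]; move/andP: pc => [Sc cN].
set w := (nat_of_ord (v _)) in Sa Sb Sc cN.
have pos : (M * K < w + t * a)%N.
  by rewrite ltnNge -subn_eq0; apply: contra S0 => /eqP e0; rewrite e0 in Sa.
have e1 : (w + t * (a + m) - M * K = w + t * a - M * K + m * t)%N.
  by rewrite mulnDr (mulnC t m); clear -pos; set X := (m * t)%N; set Y := (t * a)%N in pos *; lia.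
have e2 : (w + t * (a + 2 * m) - M * K = w + t * a - M * K + 2 * (m * t))%N.
  rewrite mulnDr mulnCA (mulnC t m); clear -pos; set X := (m * t)%N; set Y := (t * a)%N in pos *; lia.
apply: noap; exists (w + t * a - M * K)%N, (m * t)%N; split; last by rewrite -e2.
by split => //; rewrite ?muln_gt0 ?m0 // -?e1 -?e2.
Qed.

End ProductTrick.

(** Put s = sqrt(log log N). As log M >= 1/2, the hypothesis gives s >= 2 (C + 1) log M >= 1, so s
    <= s^2 and C log M <= log log N. Hence M^C <= log N, and 2 <= e finishes. *)
Lemma tower_bound (R : realType) (C M N : nat) : (2 <= M)%N ->
  (M%:R : R) <= expR ((2 * C.+1%:R)^-1 * Num.sqrt (ln (ln (N%:R : R)))) ->
  (2 ^ (M ^ C) <= N)%N.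
Proof.
move=> M2; set y := ln (ln _); set s := Num.sqrt y => H.
have M0 : 0 < M%:R :> R by rewrite ltr0n (leq_trans _ M2).
pose X : R := ln M%:R.
have X2 : 2^-1 <= X.
  have e2 : expR 2^-1 <= M%:R :> R.
    apply: (@le_trans _ _ 2); last by rewrite ler_nat.
    by apply: le_trans (expR_le_quadratic (lexx _)) _; rewrite expr2; lra.
  by rewrite -[leLHS]expRK ler_ln ?posrE ?expR_gt0.
have Xs : X <= (2 * C.+1%:R)^-1 * s.
  by rewrite -[leRHS]expRK ler_ln ?posrE ?expR_gt0.
have C1 : 1 <= C.+1%:R :> R by rewrite ler1n.
have C0 : 0 < 2 * C.+1%:R :> R by lra.
have {}Xs : 2 * C.+1%:R * X <= s by rewrite -ler_pdivlMl.
have p0 : 1 <= 2 * C.+1%:R * X.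
  have h : 1 <= 2 * X by clear -X2; lra.
  by have := mulr_ege1 C1 h; rewrite mulrCA mulrA.
have s1 : 1 <= s by exact: le_trans Xs.
have y0 : 0 < y by rewrite -sqrtr_gt0; exact: lt_le_trans ltr01 s1.
have ys : s ^+ 2 = y by rewrite sqr_sqrtr // ltW.
have yC : C%:R * X <= y.
  have CC : C%:R <= C.+1%:R :> R by rewrite ler_nat.
  rewrite -ys; apply: (@le_trans _ _ s); last by rewrite expr2 ler_peMl //; exact: le_trans ler01 s1.
  apply: le_trans Xs; apply: ler_wpM2r; first by clear -X2; lra.
  by clear -CC C1; lra.
have lnN0 : 0 < ln (N%:R : R).
  by rewrite ltNge; apply/negP => /ln0 h; move: y0; rewrite /y h ltxx.
have lnN : (M ^ C)%N%:R <= ln (N%:R : R).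
  have -> : ln (N%:R : R) = expR y by rewrite /y lnK // posrE.
  have -> : (M ^ C)%N%:R = expR (C%:R * X) by rewrite expRM_natl /X lnK ?posrE // natrX.
  by rewrite ler_expR.
have N0 : 0 < N%:R :> R.
  by rewrite ltNge; apply/negP => /ln0 h; move: lnN0; rewrite h ltxx.
rewrite -(ler_nat R) natrX.
apply: (@le_trans _ _ (expR (M ^ C)%N%:R)); last by rewrite -[leRHS](lnK (x := N%:R)) ?posrE // ler_expR.
have := expRN_nat_le R (M ^ C); rewrite expRN lef_pV2 ?posrE ?expR_gt0 ?exprn_gt0 //.
Qed.

Local Open Scope classical_set_scope.

Theorem theorem1p3 (R : realType) :
  exists c : R, 0 < c /\
    forall (F : set nat) (M : nat) (S : set nat) (N : nat),
      F `<=` posnat -> finite_set F -> F !=set0 ->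
      F M -> (forall t : nat, F t -> (t <= M)%N) ->
      S `<=` posnat -> mult_syndetic F S ->
      (3 <= N)%N ->
      (M%:R : R) <= expR (c * Num.sqrt (ln (ln (N%:R : R)))) ->
      exists x d : nat, [/\ posnat x, posnat d &
        [set x; d; (x + d)%N; (x + 2 * d)%N]
          `<=` S `&` [set n : nat | (1 <= n <= N)%N]].
Proof.
have [C HC] := pb_total.
exists (2 * C.+1%:R)^-1; split; first by rewrite invr_gt0 mulr_gt0 // ltr0n.
move=> F M S N Fpos _ _ FM Fmax Spos synd N3 HM.
(* For M = 1 the set S contains every positive integer, and x = d = 1 works because N >= 3. *)
have [M2|M2] := leqP 2 M; last first.
  have S1 m : (0 < m)%N -> S m.
    move=> m0; have [t Ft] := synd m m0.
    have t1 : t = 1%N.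
      have := Fpos _ Ft; have := Fmax _ Ft; rewrite /posnat /= => h1 h2.
      by apply/eqP; rewrite eqn_leq h2 andbT; apply: leq_trans h1 _; rewrite -ltnS.
    by rewrite t1 muln1.
  exists 1%N, 1%N; split => // _ [[[->|->]|->]|->];
    (split; [exact: S1|by apply/andP; split => //; exact: leq_trans N3]).
have NT := tower_bound M2 HM.
have [||||x [d [[d0 Sx Sd Sxd Sxdd] xN]]] := @syndetic_progression R (fun s => `[< S s >]) M N.
- exact: leq_trans M2.
- by apply/negP => /asboolP /Spos.
- move=> m m0; have [t Ft St] := synd m m0; exists t; last exact/asboolP.
  by rewrite (Fmax _ Ft) andbT; exact: (Fpos _ Ft).
- apply: leq_trans NT; apply: (@leq_trans (2 ^ (M + modulus_exp (density_exp M)))).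
    by rewrite expnD leq_mul2r leq_exp2 ?orbT.
  by rewrite leq_exp2l // HC.
move: Sx Sd Sxd Sxdd => /asboolP Sx /asboolP Sd /asboolP Sxd /asboolP Sxdd.
exists x, d; split; [exact: Spos|exact: Spos|].
have x0 : (0 < x)%N by exact: Spos.
have b1 : (x <= N)%N by apply: leq_trans xN; exact: leq_addr.
have b2 : (d <= N)%N by apply: leq_trans xN; rewrite mul2n -addnn addnA leq_addl.
have b3 : (x + d <= N)%N by apply: leq_trans xN; rewrite leq_add2l leq_pmull.
move=> _ [[[->|->]|->]|->]; split => //=.
- by rewrite x0.
- by rewrite d0.
- by rewrite addn_gt0 x0.
- by rewrite addn_gt0 x0.
Qed.
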